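(* Let $\mathbb K$ be a field of characteristic $0$, $x\in\mathbb K$, let $n$ be a positive integer and $D$ a dissection diagram of degree $n$. The antipode $S$ of $\mathcal H_D$ satisfies $$S(D)=\sum_{s=1}^n(-1)^s\sum_{P\in\Pi_D(s)}x^{k_P(D)}\prod_{i=1}^s r_{C_i}(q_{P_{i-1}}(D)),$$ where $\Pi_D(s)$ is the set of $s$-tuples $P=(C_1,\dots,C_s)$ of nonempty sets forming a partition of $\mathrm{Ch}(D)$, $P_0=\emptyset$, $P_i=\bigcup_{u=1}^iC_u$, and $k_P(D)=k_{C_1}(q_{P_0}(D))+\dots+k_{C_s}(q_{P_{s-1}}(D))$. In particular, for the corolla $X_n$ and the path tree $Y_n$ of degree $n$ (with $X_0=Y_0=1$), $$S(X_n)=\sum_{k=1}^n(-1)^k\sum_{(\alpha_1,\dots,\alpha_k)\models n}\ \sum_{\substack{i_{j,0}+\dots+i_{j,p_j}=\alpha_j,\ i_{j,m}\ge0\\ p_j=\alpha_{j+1}+\dots+\alpha_k\\ j\in\{1,\dots,k-1\}}}X_{\alpha_k}\prod_{j=1}^{k-1}X_{i_{j,0}}\cdots X_{i_{j,p_j}},$$ $$S(Y_n)=\sum_{k=1}^n(-1)^k\sum_{(\alpha_1,\dots,\alpha_k)\models n}\frac{n!}{\alpha_1!\cdots\alpha_k!}Y_{\alpha_1}\cdots Y_{\alpha_k}=\sum_{k=1}^n(-1)^k\sum_{(\alpha_1,\dots,\alpha_k)\vdash n}\frac{n!}{\alpha_1!\cdots\alpha_k!}\frac{k!}{u_1!\cdots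 u_s!}Y_{\alpha_{m_1}}^{u_1}\cdots Y_{\alpha_{m_s}}^{u_s},$$ where $(\alpha_1,\dots,\alpha_k)\models n$ means composition of $n$ (positive parts), $(\alpha_1,\dots,\alpha_k)\vdash n$ means partition of $n$ (parts in monotone order), and for each partition $(\alpha_1,\dots,\alpha_k)$ of $n$: $s=\mathrm{Card}\{\alpha_1,\dots,\alpha_k\}$, $m_1=\max\{i\le k:\forall j\le i,\ \alpha_j=\alpha_1\}$, $m_{l+1}=\max\{i\le k:\forall\, m_l+1\le j\le i,\ \alpha_j=\alpha_{m_l+1}\}$ for $1\le l\le s-1$, $u_1=m_1$ and $u_{l+1}=m_{l+1}-m_l$.
   Context: Dissection diagrams. For $n\ge 0$ let $\Pi_n$ be the regular $(n+1)$-gon with vertices $0,1,\dots,n$ numbered clockwise; vertex $0$ is the root. For $0\le i\le n$, side $i$ goes from vertex $i$ to vertex $i+1$ (with $n+1$ read as $0$). A chord is a segment joining two distinct vertices (adjacent vertices are allowed; such a chord is distinct from the side). A dissection diagram of degree $n$ is a set of $n$ pairwise non-crossing chords (they may share endpoints) of $\Pi_n$ forming an acyclic graph, hence a spanning tree on $\{0,\dots,n\}$. All chords are oriented towards the root. $\mathrm{Ch}(D)$ is the set of chords of $D$. The diagram of degree $0$ is identified with $1$. Coproduct. $\mathcal H_D$ is the commutative polynomial algebra on dissection diagrams of positive degree, with $\Delta(D)=\sum_{C\subset \mathrm{Ch}(D)}x^{k_C(D)}q_C(D)\otimes r_C(D)$ (with $x^0=1$), extended multiplicatively; it is a graded connected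 Hopf algebra. Here the $p=|C|$ chords of $C$ cut the polygon into $p+1$ faces; for a face $\alpha$ let $S_C(\alpha)$ be the (nonempty) set of sides of the polygon bordering $\alpha$. $q_C(D)$ is obtained by contracting every chord of $C$ to a point: each face $\alpha$ becomes a polygon with set of sides $S_C(\alpha)$, rooted at the starting vertex of its side of minimal label, carrying the chords of $D$ not in $C$ that lie in $\alpha$; this is a dissection diagram, and $q_C(D)$ is the product of these over all faces. $r_C(D)$ is the dissection diagram of degree $p$ obtained by keeping the chords of $C$ and contracting all sides which are not the minimal side of their face, the root being the image of $0$. $k_C(D)$ is the number of chords of $C$ whose orientation in $D$ is opposite to their orientation (towards the root) in $r_C(D)$. Conventions. The chords of $q_C(D)$ are identified with the chords of $D$ not in $C$. For a product $U=U_1\cdots U_m$ of diagrams and a set $C=C^1\sqcup\dots\sqcup C^m$ of chords of $U$ with $C^i\subset\mathrm{Ch}(U_i)$, $r_C(U)=\prod_i r_{C^i}(U_i)$ and $k_C(U)=\sum_i k_{C^i}(U_i)$. The corolla $X_n$ has chords $i\to0$ ($1\le i\le n$); the path tree $Y_n$ has chords $i\to i+1$ ($1\le i\le n-1$) and $n\to0$. *)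

(* Defs.v *)
From HB Require Import structures.
From mathcomp Require Export all_boot all_order all_algebra.
From mathcomp Require Export finmap.
From mathcomp Require Export monalg.

Set Implicit Arguments.
Unset Strict Implicit.
Unset Printing Implicit Defensive.

Import GRing.Theory.
Local Open Scope ring_scope.

(** * Dissection diagrams *)

(* Both the vertices and the sides of the (n+1)-gon are labelled by 'I_n.+1;
   side i goes from vertex i to vertex i+1 mod n+1.  A chord is the set of its
   two ends. *)
Notation chord n := {set 'I_n.+1}.

Definition adj n (A : {set chord n}) : rel 'I_n.+1 :=
  fun u v => [set u; v] \in A.

Definition noncrossing n (A : {set chord n}) : bool :=
  [forall a : 'I_n.+1, forall b : 'I_n.+1,
   forall c : 'I_n.+1, forall d : 'I_n.+1,
     (a < b < c)%N && (c < d)%N ==>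
       ~~ (([set a; c] \in A) && ([set b; d] \in A))].

(* A cycle has pairwise distinct vertices, hence length at most n+1. *)
Definition acyclic n (A : {set chord n}) : bool :=
  [forall l : 'I_n.+2, forall p : l.-tuple 'I_n.+1,
     (2 < l)%N ==> ~~ ucycleb (adj A) p].

Definition is_diagram n (A : {set chord n}) : bool :=
  [&& #|A| == n, [forall c in A, #|c| == 2], noncrossing A & acyclic A].

Definition diagram n := {A : {set chord n} | is_diagram A}.

(** * Faces and contractions *)

(* Side i lies on the arc from min c to max c; otherwise it lies on the other
   side of the chord c. *)
Definition side_under n (c : chord n) (i : 'I_n.+1) : bool :=
  [exists a in c, exists b in c, (a <= i < b)%N].

(* The same for a chord d which differs from c and does not cross it. *)
Definition chord_under n (c d : chord n) : bool :=
  [forall v in d, [exists a in c, exists b in c, (a <= v <= b)%N]].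

(* A face is represented by the set of sides bordering it.  The polygon being
   convex, two sides border the same face iff no chord of C separates them. *)
Definition faces n (C : {set chord n}) : {set {set 'I_n.+1}} :=
  preim_partition (fun i => [set c in C | side_under c i]) [set: 'I_n.+1].

Definition in_face n (C : {set chord n}) (alpha : {set 'I_n.+1})
    (d : chord n) : bool :=
  [forall c in C, forall i in alpha, side_under c i == chord_under c d].

Definition min_sides n (C : {set chord n}) : {set 'I_n.+1} :=
  [set i | [exists alpha in faces C,
              (i \in alpha) && [forall j in alpha, (i <= j)%N]]].

(* When the sides s_0 < ... < s_m are kept and become the sides 0, ..., m of
   an (m+1)-gon, the vertices v with s_(j-1) < v <= s_j are merged into vertex
   j, and those after s_m or up to s_0 into vertex 0. *)
Definition contract_vertex n m (Sd : {set 'I_n.+1}) (v : 'I_n.+1) : 'I_m.+1 :=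
  inZp #|[set s in Sd | (s < v)%N]|.

Definition contract_chord n m (Sd : {set 'I_n.+1}) (c : chord n) : chord m :=
  [set contract_vertex m Sd v | v in c].

(* The chords of E lying in the face alpha cut out by C, seen in the
   contracted polygon with set of sides alpha. *)
Definition qface n (C : {set chord n}) (alpha : {set 'I_n.+1})
    (E : {set chord n}) : {set chord #|alpha|.-1} :=
  [set contract_chord #|alpha|.-1 alpha d | d in E & in_face C alpha d].

Definition rdiag n (C : {set chord n}) : {set chord #|C|} :=
  [set contract_chord #|C| (min_sides C) c | c in C].

(* In the tree A, the chord {u, v} is oriented from u to v. *)
Definition oriented n (A : {set chord n}) (u v : 'I_n.+1) : bool :=
  ([set u; v] \in A) && connect (adj (A :\ [set u; v])) v ord0.

Definition kdiag n (A C : {set chord n}) : nat :=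
  #|[set c in C | [exists u in c, exists v in c,
       oriented A u v &&
       oriented (rdiag C) (contract_vertex #|C| (min_sides C) v)
                          (contract_vertex #|C| (min_sides C) u)]]|.

(* k_E(q_C(D)) for the product q_C(D), and likewise r_E(q_C(D)) below, use the identification of the chords of q_C(D)
   with those of D outside C. *)
Definition kqdiag n (A C E : {set chord n}) : nat :=
  (\sum_(alpha in faces C)
     kdiag (qface C alpha (A :\: C)) (qface C alpha E))%N.

(** * The Hopf algebra *)

Definition pos_diagram := {n : nat & diagram n.+1}.

Notation HD K := {malg K[{cmonom pos_diagram}]}.

(* Diagrams as elements of H_D, the diagram of degree 0 being 1.  The chord
   sets qface C alpha (D :\: C), rdiag C, corolla n and path_tree n used below
   are diagrams; the value 0 on other sets of chords is irrelevant. *)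
Definition diag (K : fieldType) n : {set chord n} -> HD K :=
  match n return {set chord n} -> HD K with
  | 0 => fun _ => 1
  | m.+1 => fun A =>
      if insub A is Some D
      then << ucm (Tagged (fun n => diagram n.+1) (D : diagram m.+1)) >>
      else 0
  end.

Definition qH (K : fieldType) n (A C : {set chord n}) : HD K :=
  \prod_(alpha in faces C) diag K (qface C alpha (A :\: C)).

Definition rH (K : fieldType) n (C : {set chord n}) : HD K :=
  diag K (rdiag C).

Definition rqH (K : fieldType) n (C E : {set chord n}) : HD K :=
  \prod_(alpha in faces C) rH K (qface C alpha E).

(* K[M] (x) K[N] is the monoid algebra K[M * N] of the product monoid. *)
Section ProdMonom.
Variables M N : conomType.
Implicit Types u v w : M * N.

Definition pair_one : M * N := (mone, mone).
Definition pair_mul u v : M * N := (mmul u.1 v.1, mmul u.2 v.2).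

Fact pair_mulA : associative pair_mul.
Proof. by move=> u v w; rewrite /pair_mul /= !mulmA. Qed.
Fact pair_mul1m : left_id pair_one pair_mul.
Proof. by case=> a b; rewrite /pair_mul /= !mul1m. Qed.
Fact pair_mulm1 : right_id pair_one pair_mul.
Proof. by case=> a b; rewrite /pair_mul /= !mulm1. Qed.
Fact pair_unitm u v : pair_mul u v = pair_one -> u = pair_one /\ v = pair_one.
Proof.
by case: u v => [a b] [c d] [/unitm[-> ->] /unitm[-> ->]].
Qed.
Fact pair_mulC : commutative pair_mul.
Proof. by move=> u v; congr pair; apply: mulmC. Qed.

HB.instance Definition _ := Choice_isMonomialDef.Build (M * N)%type
  pair_mulA pair_mul1m pair_mulm1 pair_unitm.
HB.instance Definition _ := MonomialDef_isConomialDef.Build (M * N)%type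
  pair_mulC.
End ProdMonom.

Notation HD2 K := {malg K[({cmonom pos_diagram} * {cmonom pos_diagram})%type]}.

Definition tens (K : fieldType) (a b : HD K) : HD2 K :=
  \sum_(u <- msupp a) \sum_(v <- msupp b) << a@_u * b@_v *g (u, v) >>.

Definition coprod_diag (K : fieldType) (x : K) (D : pos_diagram) : HD2 K :=
  let A := val (tagged D) in
  \sum_(C : {set chord (tag D).+1} | C \subset A)
     x ^+ kdiag A C *: tens (qH K A C) (rH K C).

(* The algebra morphism extending coprod_diag. *)
Definition coprod (K : fieldType) (x : K) : HD K -> HD2 K :=
  mmap (@malgC _ K)
    (fun m : {cmonom pos_diagram} => \prod_(D <- finsupp m) coprod_diag x D ^+ m D).

Definition counit (K : fieldType) (a : HD K) : K := a@_mone.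

(* mu o (f (x) g) o Delta, for linear f and g. *)
Definition convol (K : fieldType) (x : K) (f g : HD K -> HD K) (a : HD K) :
    HD K :=
  let t := coprod x a in
  \sum_(w <- msupp t) t@_w *: (f << w.1 >> * g << w.2 >>).

Definition is_antipode (K : fieldType) (x : K) (S : HD K -> HD K) : Prop :=
  forall a : HD K,
    convol x S id a = (counit a)%:MP /\ convol x id S a = (counit a)%:MP.

(** * Corollas and path trees *)

Definition corolla n : {set chord n} :=
  [set [set i; ord0] | i : 'I_n.+1 & i != ord0].

(* ordS is the successor mod n+1. *)
Definition path_tree n : {set chord n} :=
  [set [set i; ordS i] | i : 'I_n.+1 & i != ord0].

Definition corH (K : fieldType) n : HD K := diag K (corolla n).
Definition pathH (K : fieldType) n : HD K := diag K (path_tree n).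

(** * Ordered set partitions, compositions and partitions *)

(* P = (C_1, ..., C_s) with nonempty C_i forming a partition of A. *)
Definition ordered_partition n s (A : {set chord n})
    (P : s.-tuple {set chord n}) : bool :=
  uniq P && partition [set C in P] A.

(* For the 0-based index i of C_(i+1), this is C_1 u ... u C_i. *)
Definition before n s (P : s.-tuple {set chord n}) (i : 'I_s) : {set chord n} :=
  \bigcup_(u < s | (u < i)%N) tnth P u.

Definition kpart n s (A : {set chord n}) (P : s.-tuple {set chord n}) : nat :=
  (\sum_(i < s) kqdiag A (before P i) (tnth P i))%N.

(* alpha_j, for 1 <= j <= k. *)
Definition part n k (alpha : k.-tuple 'I_n.+1) (j : nat) : nat :=
  nth ord0 alpha j.-1.

Definition composition n k (alpha : k.-tuple 'I_n.+1) : bool :=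
  [forall i, 0 < tnth alpha i]%N && (\sum_(1 <= j < k.+1) part alpha j == n)%N.

Definition is_partition n k (alpha : k.-tuple 'I_n.+1) : bool :=
  composition alpha && sorted geq [seq val i | i <- alpha].

Definition tail_sum n k (alpha : k.-tuple 'I_n.+1) (j : nat) : nat :=
  (\sum_(j.+1 <= l < k.+1) part alpha l)%N.

(* The array (i_{j,m}) has its first index j in {1, ..., k-1} shifted by 1. *)
Definition array n k (alpha : k.-tuple 'I_n.+1) :=
  {dffun forall j : 'I_k.-1, {ffun 'I_(tail_sum alpha j.+1).+1 -> 'I_n.+1}}.

(* m_l = the end of the l-th run of equal parts, with m_0 = 0. *)
Fixpoint run_end n k (alpha : k.-tuple 'I_n.+1) (l : nat) : nat :=
  if l is l'.+1 then
    (\max_(i < k.+1 | [forall j : 'I_k.+1, (run_end alpha l' < j <= i) ==>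
                 (part alpha j == part alpha (run_end alpha l').+1)]) i)%N
  else 0%N.

(* u_l, for 1 <= l <= s. *)
Definition run_len n k (alpha : k.-tuple 'I_n.+1) (l : nat) : nat :=
  (run_end alpha l - run_end alpha l.-1)%N.

Definition nb_values n k (alpha : k.-tuple 'I_n.+1) : nat := #|[set i in alpha]|.

(* Main.v *)
Require Import Defs.
From HB Require Import structures.
From mathcomp Require Import all_boot all_order all_algebra.
From mathcomp Require Import finmap monalg.
From mathcomp Require Import zify ring.

Set Implicit Arguments.
Unset Strict Implicit.
Unset Printing Implicit Defensive.

(* A chord separates two sides of the polygon when they lie on different sides
   of it.  This symmetric relation is compatible with all contractions, and a
   set of non-crossing chords is a diagram iff any two sides are separated by
   some chord and every chord is the only one separating some pair of sides.
   The diagrams r_C(D) and q_C(D), and their iterates, are thereby described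
   inside the polygon of D by a set of sides and a set of chords.  A chord
   {a < b} is oriented from a to b in r_C(D) iff the face of C which borders it
   on the far side from the arc a, ..., b has a side before a; removing chords
   from C enlarges this face, so that orientations flip at most once and the
   exponents of x telescope along a chain of subsets.  Hence the identity
   id * S = 1 applied to r_C(D) only involves subsets of C, and unrolling it
   yields the formula for S(D).  For corollas and path trees the same recursion
   reads S_n = - sum_(p < n) a(n-p, p) S_p, which unrolls to a sum over
   compositions. *)

(** * Sides separated by chords *)

Section Separation.
Variable n : nat.
Implicit Types (u v s t i j : 'I_n.+1) (c d e : chord n) (A C E : {set chord n}).
Implicit Types (Sd : {set 'I_n.+1}).

(** A contraction changes the type of the polygon: a factor of q_P(r_C(D)) lives on a polygon whose
    degree is a cardinal, and such cardinals are only propositionally equal. It also merges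
    vertices, whereas the kept sides survive in the same order. Iterated contractions are therefore
    studied on pairs [system Sd E] inside one type 'I_n.+1, and images under [contr] are compared
    only as elements of H_D. The axioms of [system] are stable under two operations: keeping the
    minimal side of every face of C ([mins], which gives r_C) and keeping the sides and chords of
    one face ([inside], which gives the factors of q_C). The commutation q_P(r_C(D)) = r_{C \
    P}(q_P(D)), on which the recursion rests, then reduces to an equality of sets of sides in each
    face of P. The obstacle at the start is that diagrams are defined by acyclicity, a condition on
    vertices. Passing to sides requires exhibiting, for every chord, one side in each of the two
    faces adjacent to it. *)

Definition sep c s t := side_under c s (+) side_under c t.

Lemma side_under2 u v i :
  side_under [set u; v] i = (minn u v <= i < maxn u v)%N.
Proof.
apply/existsP/idP => [[a /andP[/set2P ha /existsP[b /andP[/set2P hb hi]]]]|hi].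
  by case: ha hb => -> [] ->{a b} in hi *; lia.
case: (leqP u v) hi => uv hi; [exists u|exists v]; rewrite !inE eqxx ?orbT /=;
  apply/existsP; [exists v|exists u]; rewrite !inE eqxx ?orbT /=; lia.
Qed.

(** The vertices v with s < v <= t form one of the two arcs into which the sides s and t divide the
    polygon; the root is on the other one. It is in this form that separation is compared with
    contractions and orientations. *)
Lemma sep_arc u v s t : (s <= t)%N ->
  sep [set u; v] s t = (s < u <= t)%N (+) (s < v <= t)%N.
Proof. by rewrite /sep !side_under2 => st; lia. Qed.

Lemma sepC c s t : sep c s t = sep c t s.
Proof. exact: addbC. Qed.

Lemma sepxx c s : sep c s s = false.
Proof. exact: addbb. Qed.

Definition is_segment c := exists a b : 'I_n.+1, (a < b)%N /\ c = [set a; b].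

Lemma segmentP c : reflect (is_segment c) (#|c| == 2).
Proof.
apply: (iffP (@cards2P _ c)) => [[a [b [ab ->]]]|[a [b [ab ->]]]].
  case: (ltngtP a b) => [lt|lt|/val_inj eq].
  - by exists a, b.
  - by exists b, a; rewrite setUC.
  - by rewrite eq eqxx in ab.
by exists a, b; split=> //; apply/eqP => eq; rewrite eq ltnn in ab.
Qed.

(** Two chords cross iff sides realise all four sign patterns. Side n is under no chord and always
    realises the pattern outside both, so three sides suffice. *)
Definition laminar A := forall c d i j k, c \in A -> d \in A ->
  side_under c i -> side_under d i ->
  side_under c j -> ~~ side_under d j ->
  ~~ side_under c k -> side_under d k -> False.

Lemma laminarP A : {in A, forall c, is_segment c} ->
  noncrossing A <-> laminar A.
Proof.
move=> segA; split => [/'forall_'forall_'forall_'forall_implyP nA | lA].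
  move=> c d i j k cA dA.
  have [a [b [ab ec]]] := segA _ cA; have [a' [b' [ab' ed]]] := segA _ dA.
  rewrite ec ed !side_under2 => *.
  have := nA a a' b b'; have := nA a' a b' b; rewrite -ec -ed cA dA /=.
  by lia.
apply/'forall_'forall_'forall_'forall_implyP => a b c d /andP[/andP[ab bc] cd].
apply/negP => /andP[acA bdA]; apply: (lA _ _ b a c acA bdA);
  rewrite !side_under2; lia.
Qed.

Lemma laminarS A C : C \subset A -> laminar A -> laminar C.
Proof. by move=> /subsetP CA lA c d i j k /CA + /CA; apply: lA. Qed.

(* Four sides realising all sign patterns exhibit a crossing. *)
Lemma laminar_sep A c d i j k l : laminar A -> c \in A -> d \in A ->
  sep c i l -> sep d i l -> sep c j l -> ~~ sep d j l ->
  ~~ sep c k l -> sep d k l -> False.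
Proof.
move=> lA cA dA; rewrite /sep.
case ci: (side_under c i); case di: (side_under d i);
case cj: (side_under c j); case dj: (side_under d j);
case ck: (side_under c k); case dk: (side_under d k);
case cl: (side_under c l); case dl: (side_under d l) => //= *;
do [ by apply: (lA c d i j k); rewrite ?ci ?di ?cj ?dj ?ck ?dk ?cl ?dl
   | by apply: (lA c d j i l); rewrite ?ci ?di ?cj ?dj ?ck ?dk ?cl ?dl
   | by apply: (lA c d k l i); rewrite ?ci ?di ?cj ?dj ?ck ?dk ?cl ?dl
   | by apply: (lA c d l k j); rewrite ?ci ?di ?cj ?dj ?ck ?dk ?cl ?dl].
Qed.

(** For e in E, the sides s and t border the two faces of E adjacent to e. *)
Definition only E e s t := sep e s t /\ {in E, forall e', sep e' s t -> e' = e}.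

Lemma onlyC E e s t : only E e s t -> only E e t s.
Proof. by case=> h1 h2; split=> [|e']; rewrite sepC //; apply: h2. Qed.

Lemma onlyS E C e s t : C \subset E -> only E e s t -> only C e s t.
Proof. by move=> /subsetP CE [h1 h2]; split=> // e' /CE; apply: h2. Qed.

(** Once the sides outside [Sd] are contracted, [E] becomes a diagram. Tightness plays the part of
    acyclicity, separation that of connectedness. *)
Record system Sd E : Prop := System {
  system_segment : {in E, forall c, is_segment c};
  system_laminar : laminar E;
  system_tight : forall e, e \in E ->
    exists s t, [/\ s \in Sd, t \in Sd & only E e s t];
  system_separated : forall s t, s \in Sd -> t \in Sd -> s != t ->
    exists2 e, e \in E & sep e s t;
  system_nonempty : exists s, s \in Sd }.

(* Chords lying in the region bordered by Sd. *)
Definition inside Sd E :=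
  [set e in E | [exists s in Sd, exists t in Sd, sep e s t]].

Lemma insideP Sd E e :
  reflect (e \in E /\ exists s t, [/\ s \in Sd, t \in Sd & sep e s t])
          (e \in inside Sd E).
Proof.
rewrite inE; apply: (iffP andP) => -[eE].
  by case/exists_inP => s sS /exists_inP[t tS h]; split=> //; exists s, t.
by case=> s [t [sS tS h]]; split=> //; apply/exists_inP; exists s => //;
  apply/exists_inP; exists t.
Qed.

Lemma inside_sub Sd E : inside Sd E \subset E.
Proof. by apply/subsetP => e /insideP[]. Qed.

(** Cutting along a chord e distributes the sides and the other chords over two halves, each of
    which is again a system; induct on the number of chords. *)
Lemma system_card Sd E : system Sd E -> #|Sd| = #|E|.+1.
Proof.
have [N leE] := ubnP #|E|; elim: N => // N IH in Sd E leE *.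
move=> [segE lamE tE sE [s0 s0S]].
have [E0|[e eE]] := set_0Vmem E.
  rewrite E0 cards0; apply/eqP/cards1P; exists s0; apply/setP => s; rewrite inE.
  apply/idP/eqP => [sS|->//]; apply/eqP; apply: contraT => ns.
  by have [e] := sE _ _ sS s0S ns; rewrite E0 inE.
have [p [q [pS qS [pq onlye]]]] := tE e eE.
pose half b := [set s in Sd | side_under e s == b].
pose E' b := inside (half b) (E :\ e).
have subE b : E' b \subset E :\ e by apply: inside_sub.
have sep_half b s t : s \in half b -> t \in half b -> sep e s t = false.
  by rewrite !inE /sep => /andP[_ /eqP->] /andP[_ /eqP->]; rewrite addbb.
have sep_halves s t : s \in half true -> t \in half false -> sep e s t.
  by rewrite !inE /sep => /andP[_ /eqP->] /andP[_ /eqP->].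
(* The pair separated by d alone is not separated by e, hence lies in one half. *)
have tightE' d : d \in E :\ e -> exists b s t,
    [/\ s \in half b, t \in half b & only E d s t].
  move=> /[dup] dE /setD1P[_ dE'].
  have [s [t [sS tS [st onlyd]]]] := tE d dE'; exists (side_under e s), s, t.
  rewrite !inE sS tS eqxx; split=> //=.
  apply/negPn/negP => nst; suff /(onlyd _ eE) ed : sep e s t.
    by move: dE; rewrite ed !inE eqxx.
  by move: nst; rewrite /sep; do 2!case: side_under.
have eE' : E' true :|: E' false = E :\ e.
  apply/eqP; rewrite eqEsubset subUset !subE /=; apply/subsetP => d dE.
  have [b [s [t [sb tb [st _]]]]] := tightE' d dE.
  rewrite inE; apply/orP; case: b sb tb => sb tb; [left|right];
    by apply/insideP; split=> //; exists s, t.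
(* A chord separating a pair of sides in each half would cross e. *)
have dE : E' true :&: E' false = set0.
  apply/setP => d; rewrite [RHS]inE; apply/negP => /setIP[/insideP[dE h1] h2].
  case/insideP: h2 => _; case: h1 => s [t [s1 t1 st]] [s' [t' [s2 t2 st']]].
  have {}dE : d \in E by case/setD1P: dE.
  (* Exchange s and t if necessary, so that s and s', which e separates, are on the same side of
     d. *)
  wlog ss' : s t s1 t1 st / ~~ sep d s s'.
    move=> W; case h: (sep d s s'); last by apply: (W s t); rewrite ?h.
    apply: (W t s) => //; first by rewrite sepC.
    by move: st h; rewrite /sep; do 3!case: (side_under d _).
  apply: (@laminar_sep E e d t s t' s') => //.
  - exact: sep_halves.
  - by move: st ss'; rewrite /sep; do 3!case: side_under.
  - exact: sep_halves.
  - by rewrite (sep_half false).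
  - by rewrite sepC.
have cE : #|E' true| + #|E' false| = #|E :\ e|.
  by rewrite -eE' cardsU dE cards0 subn0.
have cE1 := cardsD1 e E; rewrite eE -cE in cE1.
have cS : #|half true| + #|half false| = #|Sd|.
  rewrite -cardsUI [_ :&: _](_ : _ = set0) ?cards0 ?addn0.
    by apply: eq_card => s; rewrite !inE; case: side_under; rewrite ?andbT ?andbF ?orbF.
  by apply/setP => s; rewrite !inE; case: side_under; rewrite ?andbF.
have halfS b s : s \in half b -> s \in Sd by rewrite inE => /andP[].
have IHb b : #|half b| = #|E' b|.+1.
  have subE' : E' b \subset E by apply: subset_trans (subE b) (subD1set _ _).
  apply: IH; first by case: b {subE'}; lia.
  split.
  - by move=> c /(subsetP subE')/segE.
  - exact: laminarS lamE.
  - move=> d dEb.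
    have [b' [s [t [sb tb od]]]] := tightE' d (subsetP (subE b) _ dEb).
    have dEb' : d \in E' b'.
      apply/insideP; split; first exact: (subsetP (subE b)).
      by exists s, t; split=> //; case: od.
    case: (eqVneq b' b) => [eb|nb].
      by rewrite eb in sb tb; exists s, t; split=> //; apply: onlyS od.
    suff : d \in E' true :&: E' false by rewrite dE inE.
    by rewrite inE; case: b b' nb dEb dEb' {sb tb} subE' => [] [] //= _ -> ->.
  - move=> s t sb tb nst.
    have [d dE' dst] := sE s t (halfS _ _ sb) (halfS _ _ tb) nst.
    exists d => //; apply/insideP; split; last by exists s, t.
    rewrite !inE dE' andbT; apply: contraTneq dst => ->.
    by rewrite (sep_half b).
  - case: (eqVneq (side_under e p) b) => h; first by exists p; rewrite !inE pS h /=.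
    by exists q; rewrite !inE qS; move: pq h; rewrite /sep; case: (b); do 2!case: side_under.
by have := IHb true; have := IHb false; lia.
Qed.

End Separation.

(** * Contracting sides *)

Section Contraction.
Variables (n m : nat) (Sd : {set 'I_n.+1}).
Hypothesis card_Sd : #|Sd| = m.+1.
Implicit Types (u v s t : 'I_n.+1) (c e : chord n).

Let phi := contract_vertex m Sd.
Let cnt v := #|[set s in Sd | s < v]|.

Let cnt_mono u v : u <= v -> cnt u <= cnt v.
Proof.
move=> uv; apply: subset_leq_card; apply/subsetP => s; rewrite !inE.
by case: (s \in Sd) => //=; lia.
Qed.

Let cnt_lt s v : s \in Sd -> (cnt s < cnt v) = (s < v).
Proof.
move=> sS; apply/idP/idP => [|sv].
  by apply: contraLR; rewrite -!leqNgt; apply: cnt_mono.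
apply: proper_card; apply/properP; split.
  by apply/subsetP => t; rewrite !inE; case: (t \in Sd) => //=; lia.
by exists s; rewrite !inE sS //= ltnn.
Qed.

Let cnt_max v : cnt v <= m.+1.
Proof. by rewrite -card_Sd; apply/subset_leq_card/subsetP => s /setIdP[]. Qed.

Let cnt_side s : s \in Sd -> cnt s < m.+1.
Proof.
move=> sS; rewrite -card_Sd; apply: proper_card; apply/properP; split.
  by apply/subsetP => t /setIdP[].
by exists s; rewrite // !inE ltnn andbF.
Qed.

Let cnt_maxP v : cnt v = m.+1 -> forall s, s \in Sd -> s < v.
Proof. by move=> cv s sS; rewrite -cnt_lt // cv cnt_side. Qed.

(** A vertex after all the kept sides has count m + 1 and wraps around to the root. *)
Let phi_val v : phi v = (if cnt v == m.+1 then 0 else cnt v) :> nat.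
Proof.
rewrite /phi /contract_vertex /= -/(cnt v); case: eqP => [->|]; first by rewrite modnn.
by have := cnt_max v => *; rewrite modn_small //; lia.
Qed.

Let phi_side s : s \in Sd -> phi s = cnt s :> nat.
Proof. by move=> sS; rewrite phi_val; have := cnt_side sS; case: eqP; lia. Qed.

(** Counting kept sides is monotone and jumps at each of them. A vertex that wraps around to 0 comes
    after t, so it is outside the arc both before and after the contraction. *)
Lemma contract_arc s t v : s \in Sd -> t \in Sd ->
  (contract_vertex m Sd s < contract_vertex m Sd v <= contract_vertex m Sd t)
   = (s < v <= t).
Proof.
move=> sS tS; rewrite -/phi !(phi_side sS, phi_side tS) phi_val.
have := cnt_lt v sS; have := cnt_lt v tS; have := cnt_side tS.
case: eqP => [/cnt_maxP h|_]; last by lia.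
by have := h _ sS; have := h _ tS; lia.
Qed.

Lemma contract_lt s t : s \in Sd -> t \in Sd ->
  (contract_vertex m Sd s < contract_vertex m Sd t) = (s < t).
Proof. by move=> sS tS; have := contract_arc t sS tS; rewrite !leqnn !andbT. Qed.

Lemma contract_le s t : s \in Sd -> t \in Sd ->
  (contract_vertex m Sd s <= contract_vertex m Sd t) = (s <= t).
Proof. by move=> sS tS; rewrite leqNgt contract_lt // -leqNgt. Qed.

Lemma contract_inj : {in Sd &, injective (contract_vertex m Sd)}.
Proof.
move=> s t sS tS eq; apply/val_inj/eqP; rewrite eqn_leq.
by rewrite -!contract_le // eq leqnn.
Qed.

Lemma contract_surj (i : 'I_m.+1) : exists2 s, s \in Sd & contract_vertex m Sd s = i.
Proof.
suff /imsetP[s sS ->] : i \in contract_vertex m Sd @: Sd by exists s.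
suff -> : contract_vertex m Sd @: Sd = [set: 'I_m.+1] by rewrite inE.
apply/eqP; rewrite eqEcard subsetT cardsT card_ord card_in_imset ?card_Sd //=.
exact: contract_inj.
Qed.

Lemma contract_vertex0 : contract_vertex m Sd ord0 = ord0.
Proof.
apply: val_inj; rewrite /= [#|_|](_ : _ = 0) ?mod0n //.
by apply/eqP; rewrite cards_eq0; apply/eqP/setP => s; rewrite !inE andbF.
Qed.

Lemma contract_chord2 u v : contract_chord m Sd [set u; v] =
  [set contract_vertex m Sd u; contract_vertex m Sd v].
Proof. by rewrite /contract_chord imsetU1 imset_set1. Qed.

Lemma sep_contract c s t : is_segment c -> s \in Sd -> t \in Sd ->
  sep (contract_chord m Sd c) (contract_vertex m Sd s) (contract_vertex m Sd t)
  = sep c s t.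
Proof.
move=> [u [v [_ ->]]]; wlog st : s t / s <= t.
  move=> W sS tS; case/orP: (leq_total s t) => st; first exact: W.
  by rewrite sepC (sepC _ s) W.
move=> sS tS; have le := contract_le sS tS; rewrite st in le.
by rewrite contract_chord2 !sep_arc // !contract_arc.
Qed.

(** The sides in [T] are the images, in the same order, of the sides of [Sd] sent into [T], so
    counting those before a vertex can be done in one or two stages. *)
Lemma contract_vertex_comp p (T : {set 'I_m.+1}) v : #|T| = p.+1 ->
  contract_vertex p T (contract_vertex m Sd v) =
  contract_vertex p [set s in Sd | contract_vertex m Sd s \in T] v.
Proof.
move=> cT; rewrite -/phi; set S' := [set s in Sd | _].
have S'S s : s \in S' -> s \in Sd by rewrite inE => /andP[].
have eT : T = phi @: S'.
  apply/setP => i; apply/idP/imsetP => [iT|[s]]; last by rewrite inE => /andP[_ ? ->].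
  have [s sS es] := contract_surj i; rewrite -es in iT *.
  by exists s => //; rewrite inE sS.
have inj' : {in S' &, injective phi}.
  by move=> s t /S'S sS /S'S tS; apply: contract_inj.
have eTv : [set s in T | s < phi v] = phi @: [set s in S' | phi s < phi v].
  rewrite eT; apply/setP => i; rewrite inE; apply/andP/imsetP.
    by case=> /imsetP[s sS' ->] lt; exists s; rewrite // inE sS'.
  case=> s; rewrite inE => /andP[sS' lt] ->; split=> //.
  by apply/imsetP; exists s.
apply: val_inj => /=; rewrite -/phi eTv.
rewrite card_in_imset; last first.
  by move=> s t /setIdP[? _] /setIdP[? _]; apply: inj'.
(* If v wraps around, the intermediate vertex is 0 and its count is 0, while the direct count is p +
   1; they agree modulo p + 1. *)
case: (eqVneq (cnt v) m.+1) => cv.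
  rewrite [#|_|](_ : _ = 0); last first.
    apply/eqP; rewrite cards_eq0; apply/eqP/setP => s; rewrite !inE.
    by rewrite (phi_val v) cv eqxx ltn0 andbF.
  rewrite mod0n [X in _ = X %% _](_ : _ = p.+1) ?modnn //.
  rewrite -cT eT card_in_imset //; apply: eq_card => s; rewrite [LHS]inE.
  case sS: (s \in S') => //=; apply: cnt_maxP => //; exact: S'S.
congr (_ %% _); apply: eq_card => s; rewrite [LHS]inE [RHS]inE.
case sS: (s \in S'); last by [].
rewrite !andTb; rewrite phi_side ?S'S // (phi_val v) (negPf cv).
by rewrite cnt_lt ?S'S.
Qed.

End Contraction.

(** * Faces as classes of sides, and the systems attached to r_C and q_C *)

Section Classes.
Variable n : nat.
Implicit Types (u v s t i j : 'I_n.+1) (c d e : chord n) (A C E P : {set chord n}).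
Implicit Types (Sd : {set 'I_n.+1}).

Definition joined C s t := [forall c in C, ~~ sep c s t].

Lemma joinedP C s t : reflect {in C, forall c, ~~ sep c s t} (joined C s t).
Proof. exact: forall_inP. Qed.

Lemma joined_refl C s : joined C s s.
Proof. by apply/joinedP => c _; rewrite sepxx. Qed.

Lemma joined_sym C s t : joined C s t = joined C t s.
Proof. by apply: eq_forallb => c; rewrite sepC. Qed.

Lemma joined_trans C : transitive (joined C).
Proof.
move=> t s r /joinedP h1 /joinedP h2; apply/joinedP => c cC.
by have := h1 c cC; have := h2 c cC; rewrite /sep; do 3!case: side_under.
Qed.

Lemma joinedS C C' s t : C \subset C' -> joined C' s t -> joined C s t.
Proof. by move=> /subsetP CC' /joinedP h; apply/joinedP => c /CC'/h. Qed.

Definition cls C s := [set t | joined C s t].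

Lemma faces_cls C : faces C = [set cls C s | s in [set: 'I_n.+1]].
Proof.
apply: eq_imset => s; apply/setP => t; rewrite !inE /=.
apply/eqP/joinedP => [/setP h c cC|h].
  by have := h c; rewrite !inE cC /= /sep => ->; rewrite addbb.
apply/setP => c; rewrite !inE; case cC: (c \in C) => //=.
by have := h c cC; rewrite /sep; do 2!case: side_under.
Qed.

Lemma facesP C (a : {set 'I_n.+1}) : reflect (exists s, a = cls C s) (a \in faces C).
Proof.
rewrite faces_cls; apply: (iffP imsetP) => [[s _ ->]|[s ->]]; by exists s.
Qed.

Lemma faces_joined C a s t : a \in faces C -> s \in a -> (t \in a) = joined C s t.
Proof.
case/facesP => r ->; rewrite !inE => rs; apply/idP/idP => [rt|].
  by apply: joined_trans rt; rewrite joined_sym.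
exact: joined_trans.
Qed.

(** The version of [min_sides] relative to a set of kept sides. *)
Definition mins Sd C := [set s in Sd | [forall t in Sd, joined C s t ==> (s <= t)]].

Lemma minsP Sd C s : reflect (s \in Sd /\ forall t, t \in Sd -> joined C s t -> s <= t)
  (s \in mins Sd C).
Proof.
rewrite inE; apply: (iffP andP) => -[sS h]; split=> //.
  by move=> t tS st; move/forall_inP: h => /(_ t tS); rewrite st.
by apply/forall_inP => t tS; apply/implyP; apply: h.
Qed.

Lemma mins_sub Sd C : mins Sd C \subset Sd.
Proof. by apply/subsetP => s /minsP[]. Qed.

Lemma mins_ex Sd C s : s \in Sd ->
  exists t, [/\ t \in mins Sd C, joined C s t & t <= s].
Proof.
move=> sS; pose p := [pred t : 'I_n.+1 | (t \in Sd) && joined C s t].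
have ps : p s by rewrite /p /= sS joined_refl.
case: (arg_minnP (fun t : 'I_n.+1 => t : nat) ps) => t /andP[tS st] h.
exists t; split=> //; last exact: h.
apply/minsP; split=> // r rS tr; apply: h; rewrite /p /= rS /=.
exact: joined_trans tr.
Qed.

Lemma mins_uniq Sd C s t : s \in mins Sd C -> t \in mins Sd C ->
  joined C s t -> s = t.
Proof.
move=> /minsP[sS hs] /minsP[tS ht] st; apply/val_inj/eqP; rewrite eqn_leq hs //.
by rewrite ht // joined_sym.
Qed.

Lemma min_sidesE C : min_sides C = mins setT C.
Proof.
apply/setP => s; rewrite inE; apply/existsP/minsP => [[a /and3P[aF sa /forall_inP h]]|[_ h]].
  by split=> [|t _ st]; [rewrite inE|apply: h; rewrite (faces_joined _ aF sa)].
exists (cls C s); rewrite inE joined_refl; apply/andP; split.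
  by apply/facesP; exists s.
by apply/forall_inP => t; rewrite inE; apply: h; rewrite inE.
Qed.

(** The chords of C do not distinguish a side from the minimal side of its face, so pairs witnessing
    tightness can be moved to minimal sides. Distinct minimal sides are separated because each face
    of C keeps at most one; a diagram acquires its own separation property in this way. *)
Lemma mins_system_gen Sd E C : {in E, forall c, is_segment c} -> laminar E ->
  (forall e, e \in E -> exists s t, [/\ s \in Sd, t \in Sd & only E e s t]) ->
  (exists s, s \in Sd) -> C \subset E -> system (mins Sd C) C.
Proof.
move=> segE lamE tE [s0 s0S] CE; split.
- by move=> c /(subsetP CE)/segE.
- exact: laminarS lamE.
- move=> e eC; have [s [t [sS tS [st oe]]]] := tE e (subsetP CE _ eC).
  have [s' [s'S /joinedP js _]] := mins_ex C sS.
  have [t' [t'S /joinedP jt _]] := mins_ex C tS.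
  have eq c : c \in C -> sep c s' t' = sep c s t.
    by move=> cC; have := js c cC; have := jt c cC; rewrite /sep; do 4!case: side_under.
  exists s', t'; split=> //; split; first by rewrite eq.
  by move=> c cC; rewrite eq // => /(oe _ (subsetP CE _ cC)).
- move=> s t sS tS st; apply/exists_inP; apply: contraR st => h.
  apply/eqP/(mins_uniq sS tS)/joinedP => c cC; apply: contra h => cst.
  by apply/exists_inP; exists c.
- by have [t [tS _ _]] := mins_ex C s0S; exists t.
Qed.

Lemma mins_system Sd E C : system Sd E -> C \subset E -> system (mins Sd C) C.
Proof. by case=> segE lamE tE _ neS; apply: mins_system_gen segE lamE tE neS. Qed.

(** This is the fact that a chord lies in a single face of [P], expressed through pairs of sides of
    a face which it separates. *)
Lemma sep_joined E P e p q s t : laminar E -> P \subset E -> e \in E ->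
  joined P p q -> joined P s t -> sep e p q -> sep e s t -> joined P p s.
Proof.
move=> lamE PE eE /joinedP jpq /joinedP jst pq st; apply/joinedP => c cP.
(* Otherwise the chord c of P separates s from p, and crosses e. *)
have cE := subsetP PE _ cP; have {jpq} cpq := jpq c cP; have {jst} cst := jst c cP.
apply/negP => cps; wlog eps : p q cpq cps pq / sep e p s => [W|].
  case h: (sep e p s); first exact: (W p q).
  by apply: (W q p) => //; move: cpq cps pq h; rewrite /sep;
    do 2!case: (side_under c _); do 3!case: (side_under e _).
apply: (@laminar_sep _ E c e p q t s) => //; rewrite 1?(sepC _ t) //.
- by move: cpq cps; rewrite /sep; do 3!case: (side_under c _).
- by move: pq eps; rewrite /sep; do 3!case: (side_under e _).
Qed.

(** For tightness: a pair separated by e alone is joined by P, as e is not in P, and by [sep_joined]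
    it lies in the face of P in which e already separates two sides of a. *)
Lemma inside_system Sd E P (a : {set 'I_n.+1}) : system Sd E -> P \subset E -> a \subset Sd ->
  (exists s, s \in a) ->
  {in a &, forall s t, joined P s t} ->
  (forall s t, s \in a -> t \in Sd -> joined P s t -> t \in a) ->
  system a (inside a (E :\: P)).
Proof.
move=> [segE lamE tE sE _] PE /subsetP aS ne ja cl; split=> //.
- by move=> c /insideP[/setDP[/segE]].
- apply: laminarS lamE; apply: subset_trans (inside_sub _ _) (subsetDl _ _).
- move=> e /insideP[/setDP[eE eP] [p [q [pa qa pq]]]].
  have [s [t [sS tS [st oe]]]] := tE e eE.
  have jst : joined P s t.
    apply/joinedP => c cP; apply: contra eP => /(oe _ (subsetP PE _ cP)) ec.
    by rewrite -ec.
  have sub : inside a (E :\: P) \subset E.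
    apply: subset_trans (inside_sub _ _) (subsetDl _ _).
  suff sa : s \in a.
    exists s, t; split=> //; first exact: cl sa tS jst.
    by apply: (onlyS sub); split.
  exact: cl pa sS (sep_joined lamE PE eE (ja p q pa qa) jst pq st).
- move=> s t sa ta nst; have [e eE est] := sE s t (aS _ sa) (aS _ ta) nst.
  exists e => //; apply/insideP; split; last by exists s, t.
  rewrite inE eE andbT; apply: contraL est => eP.
  exact: (joinedP _ _ _ (ja s t sa ta)).
Qed.

(** These are the sides and chords which one face of P contributes to q_P of the diagram r_C. *)
Lemma inside_mins_faces Sd E P C a : system Sd E -> P \subset C -> C \subset E ->
  a \in faces P -> (exists2 s, s \in Sd & s \in a) -> 
  system (a :&: mins Sd C) (inside (a :&: mins Sd C) (C :\: P)).
Proof.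
move=> sysE PC CE aP [s sS sa]; have sysC := mins_system sysE CE.
apply: (inside_system sysC PC); rewrite ?subsetIr //.
- have [t [tM st _]] := mins_ex C sS; exists t; rewrite inE tM andbT.
  by rewrite (faces_joined _ aP sa); apply: joinedS st.
- by move=> p q /setIP[pa _] /setIP[qa _]; rewrite -(faces_joined _ aP pa).
- by move=> p q /setIP[pa _] qM pq; rewrite inE qM andbT (faces_joined _ aP pa).
Qed.

End Classes.

(** * Diagrams as systems of chords *)

Section Diagrams.
Variable n : nat.
Implicit Types (u v s t i j x y : 'I_n.+1) (c d e : chord n) (A B C E : {set chord n}).

Lemma adj_sym A : symmetric (adj A).
Proof. by move=> u v; rewrite /adj setUC. Qed.

Lemma connect_adjC A u v : connect (adj A) u v = connect (adj A) v u.
Proof. exact/sym_connect_sym/adj_sym. Qed.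

Lemma connect_cross (T : finType) (r : rel T) (P : pred T) (x y : T) :
  connect r x y -> P x -> ~~ P y ->
  exists u v : T, [/\ connect r x u, r u v, P u & ~~ P v].
Proof.
case/connectP => p + ->; elim: p x => [|z p IH] x /=; first by move=> _ ->.
case/andP=> xz pz Px nP; case Pz: (P z).
  have [u [v [zu uv Pu Pv]]] := IH z pz Pz nP.
  by exists u, v; split=> //; apply: connect_trans (connect1 xz) zu.
by exists x, z; rewrite connect0 xz Px Pz.
Qed.

Lemma acyclicP A : reflect (forall p, 2 < size p -> ~~ ucycleb (adj A) p) (acyclic A).
Proof.
apply: (iffP 'forall_'forall_implyP) => [h p ltp|h l p ltl]; last first.
  by apply: h; rewrite size_tuple.
apply/negP => cp; have up : uniq p by case/andP: cp.
have lep : size p < n.+2.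
  by rewrite ltnS -(card_uniqP up) (leq_trans (max_card _)) ?card_ord.
by have /negP := h (Ordinal lep) (in_tuple p) ltp.
Qed.

Lemma laminar_arc A p q x y : laminar A -> [set p; q] \in A -> [set x; y] \in A ->
  p < x < q -> p <= y <= q.
Proof.
move=> lA pqA xyA pxq; case: (leqP p y) => py; case: (leqP y q) => qy //; exfalso.
- by apply: (lA _ _ x p q pqA xyA); rewrite !side_under2; lia.
- by apply: (lA _ _ p x y pqA xyA); rewrite !side_under2; lia.
- by lia.
Qed.

(** By [laminar_arc] a chord starting in the open arc ends in the closed arc, so a path can leave
    only through p or q. *)
Lemma connect_arc A B p q x y : laminar A -> B \subset A -> [set p; q] \in A ->
  connect (adj B) x y -> p < x < q -> ~~ (p < y < q) ->
  connect (adj B) x p \/ connect (adj B) x q.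
Proof.
move=> lA /subsetP BA pqA xy px py.
have [u [v [xu uv pu pv]]] :=
  connect_cross (P := [pred z : 'I_n.+1 | p < z < q]) xy px py.
have xv := connect_trans xu (connect1 uv); rewrite /= in pu pv.
have /andP[l1 l2] := laminar_arc lA pqA (BA _ uv) pu.
case: (eqVneq p v) => [->|]; first by left.
rewrite -val_eqE /= => np; right; rewrite (_ : q = v) //.
by apply: val_inj => /=; move: pv l1 l2 np; lia.
Qed.

(** A path that does not survive the deletion uses the chord {u, v}, and reaches one of its ends
    beforehand. *)
Lemma connect_del A u v x y : connect (adj A) x y ->
  let r := adj (A :\ [set u; v]) in
  [\/ connect r x y, connect r x u | connect r x v].
Proof.
move=> xy r; case h: (connect r x y); first exact: Or31.
have [z [w [_ zw xz xw]]] := connect_cross (P := connect r x) xy (connect0 _ _) (negbT h).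
have : z \in [set u; v].
  have [<-|ne] := eqVneq [set z; w] [set u; v]; first by rewrite !inE eqxx.
  by move: xw; rewrite (connect_trans xz) // connect1 // /r /adj !inE ne.
by case/set2P => <-; [apply: Or32|apply: Or33].
Qed.

(** A chord with exactly one end in the arc s < . <= t separates s from t, hence is e: the chord e
    is a bridge and the arc is one side of the cut. *)
Lemma connect_only A e s t u v : s <= t -> only A e s t ->
  connect (adj (A :\ e)) u v -> (s < u <= t) = (s < v <= t).
Proof.
move=> st [_ oe] uv; apply/idP/idP => hb; apply: contraT => hb'.
  have [z [w [_ + hz hw]]] :=
    connect_cross (P := [pred z : 'I_n.+1 | s < z <= t]) uv hb hb'.
  case/setD1P => ne zw; case/eqP: ne; apply: oe => //.
  by rewrite sep_arc //; move: hz hw => /= -> /negbTE->.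
have hb2 : ~~ ~~ (s < v <= t) by rewrite hb.
have [z [w [_ + hz hw]]] :=
  connect_cross (P := [pred z : 'I_n.+1 | ~~ (s < z <= t)]) uv hb' hb2.
case/setD1P => ne zw; case/eqP: ne; apply: oe => //.
by rewrite sep_arc //; move: hz hw => /= /negbTE-> /negPn->.
Qed.

Lemma only_wlog A e s t : only A e s t -> exists s t, [/\ s < t & only A e s t].
Proof.
move=> o; case: (ltngtP s t) => [st|ts|/val_inj est]; first by exists s, t.
  by exists t, s; split=> //; apply: onlyC.
by case: o; rewrite est sepxx.
Qed.

(** By tightness every chord is a bridge, whereas the rest of a cycle joins the ends of its first
    chord. *)
Lemma system_acyclic A : system setT A -> acyclic A.
Proof.
move=> [_ _ tA _ _]; apply/acyclicP => -[|x [|y [|z q]]] //= _.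
apply/negP => /andP[/= /and3P[xy yz zx]].
rewrite !inE !negb_or -!andbA => /and5P[nxy nxz xq nyz /and3P[yq zq uq]].
have [s [t [_ _ /only_wlog[{}s [{}t [st o]]]]]] := tA _ xy.
have stle := ltnW st.
(* Each of the remaining chords of the cycle has an end other than x and y, so it survives the
   deletion. *)
have yz' : connect (adj (A :\ [set x; y])) y z.
  apply: connect1; rewrite /adj !inE -/(adj A y z) yz andbT; apply/eqP => /setP/(_ z).
  by rewrite !inE eqxx orbT (eq_sym z x) (eq_sym z y) (negPf nxz) (negPf nyz).
have zx' : connect (adj (A :\ [set x; y])) z x.
  elim: q z zx nxz xq nyz yq zq uq {yz yz'} => [|w q IH] z /=.
    move=> /andP[zx _] nxz _ nyz _ _ _; apply: connect1.
    rewrite /adj !inE -/(adj A z x) zx andbT; apply/eqP => /setP/(_ z).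
    by rewrite !inE eqxx (eq_sym z x) (eq_sym z y) (negPf nxz) (negPf nyz).
  rewrite !inE !negb_or => /andP[zw wx] nxz /andP[xw xq] nyz /andP[yw yq] /andP[zw' zq] /andP[wq uq].
  apply: connect_trans (IH w wx xw xq yw yq wq uq); apply: connect1.
  rewrite /adj !inE -/(adj A z w) zw andbT; apply/eqP => /setP/(_ z).
  by rewrite !inE eqxx (eq_sym z x) (eq_sym z y) (negPf nxz) (negPf nyz).
have eyx := connect_only stle o (connect_trans yz' zx').
by case: o => [+ _]; rewrite sep_arc // eyx addbb.
Qed.

Lemma system_diagram A : system setT A -> is_diagram A.
Proof.
move=> sysA; have [segA lamA _ _ _] := sysA.
apply/and4P; split.
- by apply/eqP; have := system_card sysA; rewrite cardsT card_ord => -[].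
- by apply/forall_inP => c /segA/segmentP.
- exact/(laminarP segA).
- exact: system_acyclic.
Qed.

(** Let a > 0 and b be the extreme vertices of a component avoiding the root. The sides a - 1 and b
    are distinct, hence separated by a chord with exactly one end in a, ..., b. This chord is not in
    the component, and would cut it in two. *)
Lemma system_connected A v : system setT A -> connect (adj A) v ord0.
Proof.
move=> sysA; have [segA lamA tA sA _] := sysA.
apply: contraT => nv0.
have [a va amin] := arg_minnP (P := connect (adj A) v) (fun x => x : nat) (connect0 _ v).
have [b vb bmax] := arg_maxnP (P := connect (adj A) v) (fun x => x : nat) (connect0 _ v).
have a_gt0 : 0 < a.
  by rewrite lt0n; apply: contra nv0 => /eqP a0; rewrite (_ : ord0 = a) //; apply: val_inj.
have lta : a.-1 < n.+1 by have := ltn_ord a; lia.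
have ab : a <= b by apply: amin.
have ne : Ordinal lta != b by apply/eqP => /(congr1 val) /=; lia.
have [d dA] := sA (Ordinal lta) b (in_setT _) (in_setT _) ne.
have [p [q [pq ed]]] := segA d dA; rewrite ed in dA *.
rewrite sep_arc /=; last by lia.
have e1 z : (a.-1 < z <= b) = (a <= z <= b) by lia.
rewrite !e1.
have vab z : connect (adj A) v z -> a <= z <= b.
  by move=> vz; rewrite amin //=; apply: bmax.
have nvp : connect (adj A) v p -> connect (adj A) v q.
  by move/connect_trans; apply; apply: connect1.
have nvq : connect (adj A) v q -> connect (adj A) v p.
  by move/connect_trans; apply; apply: connect1; rewrite adj_sym.
have cab : connect (adj A) a b by apply: connect_trans vb; rewrite connect_adjC.
have ex : connect (adj A) a p \/ connect (adj A) a q -> connect (adj A) v p /\ connect (adj A) v q.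
  by case=> h; have {}h := connect_trans va h; split; auto.
have ex' : connect (adj A) b p \/ connect (adj A) b q -> connect (adj A) v p /\ connect (adj A) v q.
  by case=> h; have {}h := connect_trans vb h; split; auto.
case vp: (connect (adj A) v p).
  by rewrite (vab p vp) (vab q (nvp vp)).
case vq: (connect (adj A) v q); first by move/nvq: vq; rewrite vp.
have pa : p != a by apply: contraFneq vp => ->.
have pb : p != b by apply: contraFneq vp => ->.
have qa : q != a by apply: contraFneq vq => ->.
have qb : q != b by apply: contraFneq vq => ->.
move: pa pb qa qb; rewrite -!val_eqE /= => pa pb qa qb h.
(* One end is strictly between a and b and the other outside, so {p, q} has a and b on different
   sides; a path from a to b has to pass through p or q. *)
case pin: (a <= p <= b) h => /= h.
  have [] := ex'; last by rewrite vp.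
  apply: (connect_arc (y := a) lamA (subxx A) dA); first by rewrite connect_adjC.
    by clear -pin h pq pb pa; lia.
  by clear -pin h pq pb pa; lia.
have [] := ex; last by rewrite vp.
by apply: (connect_arc (y := b) lamA (subxx A) dA) => //; clear -pin h pq qb qa ab; lia.
Qed.

(** Deleting {u, v} leaves two components, one inside the arc s < . <= t and one outside. The root
    is never in the arc, so v is on the side of the root iff u is in the arc. *)
Lemma oriented_only A u v s t : system setT A -> [set u; v] \in A ->
  s < t -> only A [set u; v] s t -> oriented A u v = (s < u <= t).
Proof.
move=> sysA uvA st o; rewrite /oriented uvA /=; have stle := ltnW st.
have uv : (s < v <= t) = ~~ (s < u <= t).
  by case: o; rewrite sep_arc //; do 2!case: (_ < _ <= _).
apply/idP/idP => [/(connect_only stle o)|].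
  by rewrite ltn0 /= uv => /negbFE.
move=> hu; rewrite connect_adjC.
have := @connect_del A u v ord0 v; case=> // [|/(connect_only stle o)].
  by rewrite connect_adjC system_connected.
by rewrite hu ltn0.
Qed.

Definition under c := [set i | side_under c i].

Lemma under_inj c d : is_segment c -> is_segment d -> under c = under d -> c = d.
Proof.
move=> [a [b [ab ->]]] [a' [b' [ab' ->]]] /setP h.
have lb : b.-1 < n.+1 by have := ltn_ord b; lia.
have lb' : b'.-1 < n.+1 by have := ltn_ord b'; lia.
have := h a; have := h a'; have := h (Ordinal lb); have := h (Ordinal lb').
rewrite !inE !side_under2 /= => h1 h2 h3 h4.
have -> : a = a' by apply: val_inj => /=; lia.
by have -> : b = b' by apply: val_inj => /=; lia.
Qed.

(** The witness borders the face next to c = {a, b} on the side of the arc a, ..., b. It starts at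
    the last vertex v of this arc connected to a without c; by acyclicity this vertex is not b. *)
Lemma diagram_own_side A c : is_diagram A -> c \in A -> exists s,
  side_under c s /\ {in A, forall d, side_under d s -> under c \subset under d}.
Proof.
case/and4P=> _ /forall_inP seg ncA /acyclicP acA cA.
have {}seg : {in A, forall c, is_segment c} by move=> d /seg/segmentP.
have lamA : laminar A by apply/(laminarP seg).
have [a [b [ab ec]]] := seg _ cA.
set B := A :\ c; have BA : B \subset A by apply: subD1set.
have nab : ~~ connect (adj B) a b.
  apply/negP => /connectP[p0 pp0 lb]; case/shortenP: pp0 lb => p pp up _ lb.
  have sz : 2 < size (a :: p).
    case: p pp up lb => [|x [|y p]] //=; first by move=> _ _ eb; rewrite eb ltnn in ab.
    by rewrite andbT => /setD1P[+ _] _ eb; rewrite -eb -ec eqxx.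
  have := acA _ sz; rewrite /ucycleb up andbT => /negP; apply.
  rewrite /= rcons_path -lb /adj setUC -ec cA andbT.
  by apply: sub_path pp => x y /(subsetP BA).
pose W := [pred v : 'I_n.+1 | connect (adj B) a v && (a <= v < b)].
have Wa : W a by rewrite /= connect0 leqnn.
have [v /= /andP[av /andP[lav lvb]] vmax] := arg_maxnP (fun x : 'I_n.+1 => x : nat) Wa.
have W' q : connect (adj B) a q -> a <= q <= b -> q <= v.
  move=> aq /andP[l1 l2]; apply: vmax; rewrite /= aq l1 ltn_neqAle l2 andbT.
  by apply: contra nab => /eqP/val_inj <-.
exists v; split; first by rewrite ec side_under2; lia.
move=> d dA dv; apply: contraT => nsub.
have [p [q [pq ed]]] := seg _ dA; rewrite ed side_under2 in dv.
have lpv : p <= v by lia.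
have lvq : v < q by lia.
have [k] := subsetPn nsub; rewrite !inE ec ed !side_under2 => k1 k2.
have lap : a <= p.
  rewrite leqNgt; apply/negP => lt.
  by apply: (lamA _ _ v p k dA cA); rewrite ?ec ?ed !side_under2; clear -lav lvb k1 k2 lt pq ab dv; lia.
have lqb : q <= b.
  rewrite leqNgt; apply/negP => lt.
  by apply: (lamA _ _ v b k dA cA); rewrite ?ec ?ed !side_under2; clear -lav lvb k1 k2 lt pq ab dv; lia.
have dB : [set p; q] \in B.
  rewrite !inE -ed dA andbT; apply: contraTneq k1 => e.
  by move: k2; have := side_under2 a b k; have := side_under2 p q k; rewrite -ec -ed e => <- ->.
(* If p or q were connected to a then q would be, although it comes after the last such vertex v. *)
have apq : connect (adj B) a p \/ connect (adj B) a q -> False.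
  move=> h; suff aq : connect (adj B) a q by have := W' _ aq; clear -lap pq lvq lqb; lia.
  by case: h => // h; apply: connect_trans h (connect1 _).
exfalso; case: (eqVneq p v) => [epv|]; first by apply: apq; left; rewrite epv.
case: (eqVneq p a) => [epa|]; first by case: apq; left; rewrite epa.
(* The path from v to a leaves the arc p < . < q through p or q. *)
rewrite -!val_eqE /= => npa npv; apply: apq.
have va : connect (adj B) v a by rewrite connect_adjC.
have [||h|h] := connect_arc lamA BA (subsetP BA _ dB) va.
- by clear -lpv npv lvq; lia.
- by clear -lap; lia.
- by left; apply: connect_trans av h.
- by right; apply: connect_trans av h.
Qed.

(** One side comes from each face adjacent to e: an own side of e, and an own side of the smallest
    chord strictly above e, replaced by side n, which is under no chord, if there is none. *)
Lemma diagram_tight A e : is_diagram A -> e \in A -> exists s t, only A e s t.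
Proof.
move=> dA eA; case/and4P: (dA) => _ /forall_inP seg ncA _.
have {}seg : {in A, forall c, is_segment c} by move=> d /seg/segmentP.
have lamA : laminar A by apply/(laminarP seg).
have [s [es own_s]] := diagram_own_side dA eA.
pose bigger := [pred d | (d \in A) && (under e \proper under d)].
have sub_s d : d \in A -> side_under d s = (under e \subset under d).
  move=> dA'; apply/idP/idP; first exact: own_s.
  by move/subsetP/(_ s); rewrite !inE; apply.
case: (pickP bigger) => [d0 d0b|nob].
  have [d /andP[dA' ed] dmin] := arg_minnP (fun d => #|under d|) d0b.
  have [t [dt own_t]] := diagram_own_side dA dA'.
  have sub_t c : c \in A -> side_under c t = (under d \subset under c).
    move=> cA; apply/idP/idP; first exact: own_t.
    by move/subsetP/(_ t); rewrite !inE; apply.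
  exists s, t; rewrite /only /sep es sub_t //; split.
    by rewrite addTb; case/properP: ed => _ [x xd xe]; apply/subsetPn; exists x.
  move=> c cA; rewrite sub_t // sub_s // => h; apply/eqP; apply: contraT => nce.
  case ec: (under e \subset under c) h => //= h; last first.
    case/negP: (negbT ec); apply: subset_trans h; exact: proper_sub.
  have cb : bigger c.
    rewrite /= cA /= properEneq ec andbT; apply: contra nce => /eqP h'.
    by apply/eqP/under_inj; [exact: seg|exact: seg|].
  case/subsetPn: h => x xd xc.
  (* Both c and d cover e, and d is not inside c; by laminarity c is strictly inside d, against the
     minimality of d. *)
  have cd : under c \subset under d.
    apply/subsetP => y yc; apply: contraT => yd.
    have [z ze] : exists z, z \in under e by exists s; rewrite inE.
    exfalso; apply: (lamA d c z x y dA' cA).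
    - by have := subsetP (proper_sub ed) z ze; rewrite inE.
    - by have := subsetP ec z ze; rewrite inE.
    - by rewrite inE in xd.
    - by rewrite inE in xc.
    - by rewrite inE in yd.
    - by rewrite inE in yc.
  have := dmin c cb; rewrite leqNgt proper_card //; apply/properP; split=> //.
  by exists x.
have nomax d : d \in A -> side_under d ord_max = false.
  by move/seg => [a [b [ab ->]]]; rewrite side_under2 /=; have := ltn_ord b; lia.
exists s, ord_max; rewrite /only /sep es nomax //; split=> // c cA.
rewrite nomax // sub_s // addbF => ec; apply: under_inj; [exact: seg|exact: seg|].
by have /negbT := nob c; rewrite /= cA properEneq ec andbT negbK => /eqP.
Qed.

(** Separation comes from counting: the system on the minimal sides has one side more than chords,
    hence n + 1 sides, so every side is minimal in its face. *)
Lemma diagram_system A : is_diagram A -> system setT A.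
Proof.
move=> dA; case/and4P: (dA) => /eqP cA /forall_inP seg ncA _.
have {}seg : {in A, forall c, is_segment c} by move=> d /seg/segmentP.
have lamA : laminar A by apply/(laminarP seg).
have tA e : e \in A -> exists s t, [/\ s \in setT, t \in setT & only A e s t].
  by move=> /(diagram_tight dA)[s [t o]]; exists s, t; rewrite !inE.
have sysA : system (mins setT A) A.
  by apply: mins_system_gen seg lamA tA _ (subxx A); exists ord0; rewrite inE.
suff -> : [set: 'I_n.+1] = mins setT A by [].
apply/eqP; rewrite eq_sym eqEcard subsetT (system_card sysA) cA cardsT card_ord.
exact: leqnn.
Qed.

End Diagrams.

(** * Contractions of systems *)

Definition contr n m (Sd : {set 'I_n.+1}) (C : {set chord n}) : {set chord m} :=
  [set contract_chord m Sd c | c in C].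

(** * Orientations read off the sides *)

Section Forward.
Variable n : nat.
Implicit Types (u v s t i j a b : 'I_n.+1) (c d e : chord n) (A C E P X : {set chord n}).
Implicit Types (Sd : {set 'I_n.+1}).

(* For a < b, the chord {a, b} is oriented from a to b in the diagram with set
   of chords C iff the region of C adjacent to it and lying on the other side
   from the arc a, ..., b has a side before a. *)
Definition forward Sd C e := [exists s in Sd, exists t in Sd,
  [&& t < s, side_under e s, ~~ side_under e t &
      [forall c in C, sep c s t ==> (c == e)]]].

Lemma forwardP Sd C e : reflect (exists s t, [/\ s \in Sd, t \in Sd & t < s] /\
    [/\ side_under e s, ~~ side_under e t & only C e s t]) (forward Sd C e).
Proof.
apply: (iffP exists_inP) => [[s sS /exists_inP[t tS /and4P[ts es et h]]]|].
  exists s, t; split=> //; split=> //; split; first by rewrite /sep es (negPf et).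
  by move=> c cC cst; apply/eqP; move/forall_inP: h => /(_ c cC); rewrite cst.
move=> [s [t [[sS tS ts] [es et [_ h]]]]]; exists s => //; apply/exists_inP.
exists t => //; rewrite ts es et; apply/forall_inP => c cC; apply/implyP => h'.
by apply/eqP/h.
Qed.

(** A pair separated by e alone stays so when other chords are removed. All the telescoping of
    exponents comes from this monotonicity. *)
Lemma forwardS Sd C E e : C \subset E -> forward Sd E e -> forward Sd C e.
Proof.
move=> CE /forwardP[s [t [h [es et o]]]]; apply/forwardP; exists s, t; split=> //.
by split=> //; apply: onlyS CE o.
Qed.

Lemma only_joined C e s t : e \in C -> only C e s t -> joined (C :\ e) s t.
Proof.
move=> eC [_ o]; apply/joinedP => c /setD1P[ce cC].
by apply: contra ce => /(o _ cC) ->.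
Qed.

(** Apart from e, no chord of C separates s from t or p from q; by [sep_joined] the four sides lie
    in one face of C minus e, which e divides in two. *)
Lemma only_unique C e s t p q : laminar C -> e \in C -> only C e s t ->
  only C e p q -> ~~ sep e s p -> joined C s p.
Proof.
move=> lC eC o1 o2 sp; have [[st _] [pq _]] := (o1, o2).
have := sep_joined lC (subD1set _ e) eC (only_joined eC o1) (only_joined eC o2) st pq.
move=> /joinedP j; apply/joinedP => c cC; case: (eqVneq c e) => [->//|ce].
by apply: j; rewrite !inE ce.
Qed.

(** A side q < p not under {a, b}, with p under it, lies before a. The minimal side of the face of q
    is then before a too, which fixes the positions of s and t. *)
Lemma forward_arc Sd C a b s t : laminar C -> [set a; b] \in C -> a < b ->
  s \in mins Sd C -> t \in mins Sd C -> s < t -> only C [set a; b] s t ->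
  (s < a <= t) = forward Sd C [set a; b].
Proof.
move=> lC eC ab sM tM st o; have [/minsP[sS ms] /minsP[tS mt]] := (sM, tM).
have := o.1; rewrite sep_arc ?(ltnW st) // => sab.
apply/idP/forwardP => [hb|[p [q [[pS qS qp] [ep eq o']]]]].
  exists t, s; split=> //; rewrite !side_under2; split; last exact: onlyC.
    by clear -hb sab ab; lia.
  by clear -hb sab ab; lia.
have o'' := onlyC o'.
have est : side_under [set a; b] s = ~~ side_under [set a; b] t.
  by have := o.1; rewrite /sep; do 2!case: (side_under _ _).
(* If s is under the chord, t is after it and in the same face as q; minimality gives t <= q, which
   is absurd. *)
case es : (side_under [set a; b] s) in est.
  have tq : t <= q.
    apply: mt => //; apply: only_unique lC eC (onlyC o) o'' _.
    by rewrite /sep (negPf eq) -(negbK (side_under _ t)) -est.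
  by move: est es eq ep; rewrite !side_under2; clear -tq qp st ab; lia.
have sq : s <= q.
  by apply: ms => //; apply: only_unique lC eC o o'' _; rewrite /sep (negPf eq) es.
by move: est es eq ep; rewrite !side_under2; clear -sq qp st ab; lia.
Qed.

(** Replace s and t by the minimal sides s' and t' of their faces: the chords of P see no
    difference, and t' <= t is still before the arc of e, which contains s'. *)
Lemma forward_mins Sd C P e : P \subset C -> e \in P -> is_segment e ->
  forward (mins Sd C) P e = forward Sd P e.
Proof.
move=> PC eP [a [b [ab ee]]]; apply/forwardP/forwardP => -[s [t [[sS tS ts] [es et o]]]].
  exists s, t; split=> //; split; rewrite ?(subsetP (mins_sub _ _) _ sS) //.
  by rewrite (subsetP (mins_sub _ _) _ tS).
have [s' [s'S /(joinedS PC)/joinedP js _]] := mins_ex C sS.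
have [t' [t'S /(joinedS PC)/joinedP jt let']] := mins_ex C tS.
have eqs c : c \in P -> side_under c s' = side_under c s.
  by move=> /js; rewrite /sep; do 2!case: (side_under _ _).
have eqt c : c \in P -> side_under c t' = side_under c t.
  by move=> /jt; rewrite /sep; do 2!case: (side_under _ _).
exists s', t'; rewrite eqs // eqt //; split; split=> //.
  move: es et (eqs e eP); rewrite ee !side_under2; clear -ab ts let'; lia.
case: o => o1 o2; split; first by rewrite /sep eqs // eqt.
by move=> c cP; rewrite /sep eqs // eqt //; apply: o2.
Qed.

Lemma inside_faceP E P e p q : laminar E -> P \subset E -> e \in E ->
  joined P p q -> sep e p q -> forall f, f \in faces P ->
  (exists s t, [/\ s \in f, t \in f & sep e s t]) <-> p \in f.
Proof.
move=> lE PE eE jpq pq f fP; split=> [[s [t [sf tf st]]]|pf].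
  rewrite (faces_joined p fP sf) joined_sym.
  by apply: (sep_joined lE PE eE jpq _ pq st); rewrite -(faces_joined t fP sf).
by exists p, q; rewrite pf (faces_joined q fP pf).
Qed.

(** Two sides of f are not separated by P, and a chord of X separating them is inside f; conversely
    a pair separated by e alone is joined by P, hence in the face of e. So orientations in
    r_X(q_P(D)) are those of the chord set [P :|: X] in the polygon of D. *)
Lemma forward_inside E P X f e : laminar E -> P \subset E -> X \subset E :\: P ->
  f \in faces P -> e \in inside f X ->
  forward f (inside f X) e = forward setT (P :|: X) e.
Proof.
move=> lE PE XE fP /insideP[eX [p [q [pf qf pq]]]].
have /setDP[eE eP] := subsetP XE _ eX.
have jpq : joined P p q by rewrite -(faces_joined q fP pf).
apply/forwardP/forwardP => -[s [t [[sS tS ts] [es et [o1 o2]]]]]; exists s, t.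
  rewrite !inE; split=> //; split=> //; split=> // c /setUP[cP|cX] cst.
    have /joinedP/(_ c cP) : joined P s t by rewrite -(faces_joined t fP sS).
    by rewrite cst.
  by apply: o2 => //; apply/insideP; split=> //; exists s, t.
have jst : joined P s t.
  apply/joinedP => c cP; apply: contra eP => cst.
  by rewrite -(o2 c) // inE cP.
have sf : s \in f.
  by rewrite (faces_joined s fP pf); apply: sep_joined lE PE eE jpq jst pq o1.
split; split=> //; first by rewrite (faces_joined t fP sf).
split=> // c /insideP[cX _]; apply: o2; first by rewrite inE cX orbT.
Qed.

Lemma mins_id Sd E : system Sd E -> mins Sd E = Sd.
Proof.
move=> [_ _ _ sE _]; apply/eqP; rewrite eqEsubset mins_sub; apply/subsetP => s sS.
apply/minsP; split=> // t tS; case: (eqVneq s t) => [->//|/(sE _ _ sS tS)[e eE est]].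
by move=> /joinedP/(_ e eE); rewrite est.
Qed.

(** A chord e outside P lies, relative to every chord of P, like the sides of its own face, and this
    pattern determines the face. *)
Lemma in_face_inside A P f e : system setT A -> P \subset A -> f \in faces P ->
  e \in A :\: P ->
  in_face P f e = [exists s in f, exists t in f, sep e s t].
Proof.
move=> [seg lA tA _ _] PA fP /setDP[eA eP].
have [p [q [_ _ [pq oe]]]] := tA e eA.
have jpq : joined P p q.
  apply/joinedP => c cP; apply: contra eP => cst.
  by rewrite -(oe c) // (subsetP PA).
(* Both members say that the arc of e is contained in that of c. *)
have under_e c : c \in P -> chord_under c e =
    [forall i, side_under e i ==> side_under c i].
  move=> cP; have [a [b [ab ec]]] := seg _ (subsetP PA _ cP).
  have [a' [b' [ab' ee]]] := seg _ eA.
  have -> : chord_under c e = (a <= a') && (b' <= b).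
    have E v : [exists a0 in c, exists b0 in c, a0 <= v <= b0] = (a <= v <= b).
      apply/exists_inP/idP => [[x xc /exists_inP[y yc]]|h].
        by move: xc yc; rewrite ec => /set2P[]-> /set2P[]->; clear -ab; lia.
      exists a; first by rewrite ec !inE eqxx.
      by apply/exists_inP; exists b; rewrite // ec !inE eqxx orbT.
    apply/forall_inP/idP => [h|h v]; last first.
      by rewrite ee E => /set2P[]->; clear -ab' h; lia.
    have := h a'; have := h b'; rewrite ee !E !inE !eqxx orbT.
    by move=> /(_ isT) h1 /(_ isT) h2; clear -h1 h2; lia.
  rewrite ee ec; apply/idP/forallP => [h i|h].
    by rewrite !side_under2; apply/implyP; clear -ab ab' h; lia.
  have lb : b'.-1 < n.+1 by have := ltn_ord b'; clear; lia.
  have := h a'; have := h (Ordinal lb); rewrite !side_under2 /=.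
  by clear -ab ab'; lia.
have key g s t : g \in faces P -> s \in g -> t \in g -> sep e s t ->
    forall c i, c \in P -> i \in g -> side_under c i = chord_under c e.
  move=> gP sg tg st c i cP ig; rewrite under_e //.
  have jc j : j \in g -> side_under c j = side_under c i.
    move=> jg; have /joinedP/(_ c cP) : joined P j i by rewrite -(faces_joined i gP jg).
    by rewrite /sep; do 2!case: (side_under _ _).
  case ci: (side_under c i).
    apply/esym/forallP => j; apply/implyP => ej; apply: contraT => cj; exfalso.
    wlog es : s t sg tg st / side_under e s => [W|].
      case h: (side_under e s); first exact: (W s t).
      apply: (W t s) => //; first by rewrite sepC.
      by move: st h; rewrite /sep; do 2!case: (side_under _ _).
    have et : ~~ side_under e t by move: st; rewrite /sep es; case: (side_under _ _).
    by apply: (lA c e s t j (subsetP PA _ cP) eA); rewrite ?(jc s sg) ?(jc t tg).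
  apply/esym/forallP => h.
  have h1 := h s; have h2 := h t; rewrite !jc // ci in h1 h2.
  by move: st h1 h2; rewrite /sep; do 2!case: (side_under e _).
apply/forall_inP/exists_inP => [h|[s sf /exists_inP[t tf st]] c cP]; last first.
  by apply/forall_inP => i iif; rewrite (key f s t).
(* The face of p and q has the same pattern as e, which by assumption is also that of f; hence it is
   f. *)
suff pf : p \in f.
  by exists p => //; apply/exists_inP; exists q; rewrite // (faces_joined q fP pf).
have [r rf] : exists r, r \in f.
  by case/facesP: fP => r ->; exists r; rewrite inE joined_refl.
rewrite (faces_joined p fP rf); apply/joinedP => c cP.
have gP : cls P p \in faces P by apply/facesP; exists p.
have pg : p \in cls P p by rewrite inE joined_refl.
have qg : q \in cls P p by rewrite inE.
have := forall_inP (h c cP) r rf; rewrite -(key _ p q gP pg qg pq c p cP pg) /sep.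
by move/eqP->; rewrite addbb.
Qed.

Lemma qfaceE A P X f : system setT A -> P \subset A -> X \subset A :\: P ->
  f \in faces P -> qface P f X = contr #|f|.-1 f (inside f X).
Proof.
move=> sysA PA XA fP; have <- : [set d in X | in_face P f d] = inside f X.
  apply/setP => d; rewrite !inE; case dX: (d \in X) => //=.
  by rewrite (in_face_inside sysA PA fP) // (subsetP XA).
by [].
Qed.

End Forward.

(** * Transport of a system to the contracted polygon *)

Section Transport.
Variables (n m : nat) (Sd : {set 'I_n.+1}) (E : {set chord n}).
Hypotheses (sysE : system Sd E) (card_Sd : #|Sd| = m.+1).
Implicit Types (s t : 'I_n.+1) (c d e : chord n) (C P X : {set chord n}).

Let phi := contract_vertex m Sd.
Let kappa := contract_chord m Sd : chord n -> chord m.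

Let sepK c s t : c \in E -> s \in Sd -> t \in Sd -> sep (kappa c) (phi s) (phi t) = sep c s t.
Proof. by move=> /(system_segment sysE) seg; apply: sep_contract. Qed.

(** Chords with the same image separate the same sides of [Sd], in particular the pair of which c is
    the only separator. *)
Lemma contract_chord_inj : {in E &, injective (contract_chord m Sd : chord n -> chord m)}.
Proof.
move=> c d cE dE eq; have [s [t [sS tS [st o]]]] := system_tight sysE cE.
by apply/esym/o => //; rewrite -sepK // /kappa -eq; rewrite -/kappa sepK.
Qed.

Lemma mem_contr C e : C \subset E -> e \in E -> (contract_chord m Sd e \in contr m Sd C) = (e \in C).
Proof.
move=> /subsetP CE eE; apply/imsetP/idP => [[c cC eq]|eC]; last by exists e.
by rewrite (contract_chord_inj eE _ eq) ?CE.
Qed.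

Lemma card_contr C : C \subset E -> #|contr m Sd C| = #|C|.
Proof.
move=> /subsetP CE; apply: card_in_imset => c d /CE cE /CE dE.
exact: contract_chord_inj.
Qed.

Lemma contr_sub C C' : C \subset C' -> contr m Sd C \subset contr m Sd C'.
Proof. exact: imsetS. Qed.

Lemma contrD C P : C \subset E -> P \subset E ->
  contr m Sd C :\: contr m Sd P = contr m Sd (C :\: P).
Proof.
move=> CE PE; apply/setP => d; rewrite inE; apply/andP/imsetP.
  case=> h /imsetP[c cC ec]; move: h; rewrite ec mem_contr ?(subsetP CE) // => cP.
  by exists c; rewrite // inE cP.
case=> c /setDP[cC cP] ->; rewrite mem_contr ?(subsetP CE) //.
by rewrite imset_f.
Qed.

Lemma joined_contr C s t : C \subset E -> s \in Sd -> t \in Sd ->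
  joined (contr m Sd C) (contract_vertex m Sd s) (contract_vertex m Sd t) = joined C s t.
Proof.
move=> /subsetP CE sS tS; apply/joinedP/joinedP => h c cC.
  by rewrite -sepK // ?CE //; apply/h/imset_f.
by case/imsetP: cC => d dC ->; rewrite sepK ?CE //; apply: h.
Qed.

Lemma only_contr C e s t : C \subset E -> e \in C -> s \in Sd -> t \in Sd ->
  only C e s t -> only (contr m Sd C) (contract_chord m Sd e) (contract_vertex m Sd s) (contract_vertex m Sd t).
Proof.
move=> /subsetP CE eC sS tS [st o]; split; first by rewrite sepK // CE.
move=> _ /imsetP[d dC ->]; rewrite sepK ?CE // => dst.
by rewrite /kappa (o d).
Qed.

Lemma contr_system : system setT (contr m Sd E).
Proof.
have [seg lE tE sE [s0 s0S]] := sysE; split.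
- move=> _ /imsetP[e eE ->]; have [s [t [sS tS [st _]]]] := tE e eE.
  have := sepK eE sS tS; rewrite st; have [a [b [_ ->]]] := seg e eE.
  rewrite /kappa contract_chord2; case: (ltngtP (phi a) (phi b)) => h.
  + by exists (phi a), (phi b).
  + by exists (phi b), (phi a); rewrite setUC.
  have F (x i : 'I_m.+1) : side_under [set x; x] i = false.
    by rewrite side_under2 minnn maxnn; lia.
  by rewrite -/phi (val_inj h) /sep !F.
- move=> _ _ i j k /imsetP[c cE ->] /imsetP[d dE ->].
  (* l is the kept side that becomes the last one. No contracted chord covers it, so [side_under] in
     the contracted polygon is separation from l, and [laminar_sep] applies. *)
  have [l lS el] := contract_surj card_Sd ord_max.
  have [i' iS <-] := contract_surj card_Sd i.
  have [j' jS <-] := contract_surj card_Sd j.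
  have [k' kS <-] := contract_surj card_Sd k.
  have E' c' : c' \in E -> forall z, z \in Sd -> side_under (kappa c') (phi z) = sep c' z l.
    move=> cE' z zS; rewrite -sepK // /sep [X in _ (+) X](_ : _ = false) ?addbF //.
    have [a [b [_ ec']]] := seg c' cE'.
    rewrite -/phi in el; rewrite el /kappa ec' contract_chord2 side_under2 /=.
    have := ltn_ord (phi a); have := ltn_ord (phi b); rewrite -/phi; lia.
  by rewrite -/kappa -/phi !E' //; apply: laminar_sep lE cE dE.
- move=> _ /imsetP[e eE ->]; have [s [t [sS tS o]]] := tE e eE.
  by exists (phi s), (phi t); split; rewrite ?inE //; apply: only_contr.
- move=> i j _ _; have [s sS <-] := contract_surj card_Sd i.
  have [t tS <-] := contract_surj card_Sd j => nst.
  have {nst} nst : s != t by apply: contra nst => /eqP->.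
  have [e eE est] := sE s t sS tS nst; exists (kappa e); first exact: imset_f.
  by rewrite sepK.
- by exists ord0; rewrite inE.
Qed.

Lemma mins_contr C : C \subset E ->
  [set s in Sd | contract_vertex m Sd s \in mins setT (contr m Sd C)] = mins Sd C.
Proof.
move=> CE; apply/setP => s; rewrite inE; apply/andP/minsP => [[sS /minsP[_ h]]|[sS h]].
  split=> // t tS st; rewrite -(contract_le card_Sd) //.
  by apply: h; rewrite ?inE // joined_contr.
split=> //; apply/minsP; split; first by rewrite inE.
move=> i _; have [t tS <-] := contract_surj card_Sd i.
by rewrite joined_contr // contract_le //; apply: h.
Qed.

Lemma card_mins_contr C : C \subset E -> #|mins setT (contr m Sd C)| = #|contr m Sd C|.+1.
Proof.
move=> CE; apply: system_card; apply: mins_system contr_system _; exact: contr_sub.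
Qed.

Lemma contract_chord_comp p (T : {set 'I_m.+1}) c : #|T| = p.+1 ->
  contract_chord p T (contract_chord m Sd c) =
  contract_chord p [set s in Sd | contract_vertex m Sd s \in T] c.
Proof.
move=> cT; rewrite /contract_chord -imset_comp; apply: eq_imset => v /=.
exact: contract_vertex_comp.
Qed.

Lemma contr_contr p (T : {set 'I_m.+1}) C : #|T| = p.+1 ->
  contr p T (contr m Sd C) = contr p [set s in Sd | contract_vertex m Sd s \in T] C.
Proof.
move=> cT; rewrite /contr -imset_comp; apply: eq_imset => c /=.
exact: contract_chord_comp.
Qed.

Lemma rdiag_contr C : C \subset E ->
  rdiag (contr m Sd C) = contr #|contr m Sd C| (mins Sd C) C.
Proof.
move=> CE; rewrite /rdiag -/(contr _ _ _) min_sidesE contr_contr ?card_mins_contr //.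
by rewrite mins_contr.
Qed.

Lemma inside_contr (a : {set 'I_n.+1}) X : X \subset E -> a \subset Sd ->
  inside (contract_vertex m Sd @: a) (contr m Sd X) = contr m Sd (inside a X).
Proof.
move=> /subsetP XE /subsetP aS; apply/setP => d; apply/insideP/imsetP.
  case=> /imsetP[c cX ->] [_ [_ [/imsetP[s sa ->] /imsetP[t ta ->]]]].
  rewrite sepK ?aS ?XE // => cst; exists c => //; apply/insideP; split=> //.
  by exists s, t.
case=> c /insideP[cX [s [t [sa ta st]]]] ->; split; first exact: imset_f.
by exists (phi s), (phi t); split; rewrite ?imset_f // sepK ?aS ?XE.
Qed.

Lemma face_contr P a : P \subset E -> a \in faces P -> (exists s, s \in a :&: Sd) ->
  contract_vertex m Sd @: (a :&: Sd) \in faces (contr m Sd P).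
Proof.
move=> PE aP [s /setIP[sa sS]]; apply/facesP; exists (phi s).
apply/setP => i; have [t tS <-] := contract_surj card_Sd i.
rewrite inE joined_contr // -(faces_joined t aP sa); apply/imsetP/idP.
  by case=> r /setIP[ra rS] /(contract_inj card_Sd tS rS) ->.
by move=> ta; exists t; rewrite // inE ta.
Qed.

(** The second hypothesis excludes faces without kept sides, whose image would be empty. *)
Lemma faces_contr P : P \subset E ->
  (forall a, a \in faces P -> exists s, s \in a :&: Sd) ->
  faces (contr m Sd P) = [set contract_vertex m Sd @: (a :&: Sd) | a in faces P].
Proof.
move=> PE meet; apply/setP => f; apply/idP/imsetP => [|[a aP ->]]; last first.
  by apply: face_contr => //; apply: meet.
move=> /[dup] fP /facesP[i ef]; have [s sS es] := contract_surj card_Sd i.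
have aP : cls P s \in faces P by apply/facesP; exists s.
exists (cls P s) => //; rewrite ef -es; apply/setP => j.
have [t tS <-] := contract_surj card_Sd j.
rewrite inE joined_contr //; apply/idP/imsetP => [st|[r]].
  by exists t; rewrite // !inE st.
by rewrite !inE => /andP[sr rS] /(contract_inj card_Sd tS rS) ->.
Qed.

Lemma faces_contr_inj P : P \subset E ->
  (forall a, a \in faces P -> exists s, s \in a :&: Sd) ->
  {in faces P &, injective (fun a : {set 'I_n.+1} => contract_vertex m Sd @: (a :&: Sd))}.
Proof.
move=> PE meet a b aP bP /= eq; have [s sa] := meet a aP.
have : phi s \in phi @: (b :&: Sd) by rewrite -eq imset_f.
case/imsetP => r /setIP[rb rS] /(contract_inj card_Sd (subsetP (subsetIr _ _) _ sa) rS) er.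
rewrite -er in rb; case/setIP: sa => sa _.
by apply/setP => x; rewrite (faces_joined x aP sa) (faces_joined x bP rb).
Qed.

Lemma card_face_contr (a : {set 'I_n.+1}) : a \subset Sd -> #|contract_vertex m Sd @: a| = #|a|.
Proof.
move=> /subsetP aS; apply: card_in_imset => s t /aS sS /aS tS.
exact: contract_inj.
Qed.

Lemma oriented_contr s t u v : s \in Sd -> t \in Sd -> s < t ->
  [set u; v] \in E -> only E [set u; v] s t ->
  oriented (contr m Sd E) (contract_vertex m Sd u) (contract_vertex m Sd v) = (s < u <= t).
Proof.
move=> sS tS st uvE o; rewrite -(contract_arc card_Sd u sS tS).
have := only_contr (subxx E) uvE sS tS o; rewrite /kappa contract_chord2 => o'.
apply: (oriented_only contr_system) o'; last by rewrite contract_lt.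
by rewrite -contract_chord2; apply: imset_f.
Qed.

End Transport.

Lemma oriented_neq n (A : {set chord n}) (u v : 'I_n.+1) :
  system setT A -> oriented A u v -> u != v.
Proof.
move=> [seg _ _ _ _] /andP[/seg[a [b [ab /setP e]]] _]; apply: contraTneq ab => uv.
have := e a; have := e b; rewrite !inE !eqxx orbT uv !orbb => /eqP-> /eqP->.
by rewrite ltnn.
Qed.

(** * Chords reversed by r_C *)

Section Flips.
Variables (n m : nat) (Sd : {set 'I_n.+1}) (E C : {set chord n}).
Hypotheses (sysE : system Sd E) (card_Sd : #|Sd| = m.+1) (CE : C \subset E).

Let flips (d : chord m) := [exists u in d, exists v in d,
  oriented (contr m Sd E) u v &&
  oriented (rdiag (contr m Sd C))
    (contract_vertex #|contr m Sd C| (min_sides (contr m Sd C)) v)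
    (contract_vertex #|contr m Sd C| (min_sides (contr m Sd C)) u)].

(** Orientations are read on pairs of kept sides separated by the chord alone, one pair s < t for E
    and another one s' < t' for C. *)
Let flipsE e : e \in C ->
  flips (contract_chord m Sd e) = ~~ forward Sd E e && forward Sd C e.
Proof.
move=> eC; have eE := subsetP CE _ eC.
have [seg lE tE _ _] := sysE; have lC := laminarS CE lE.
have sysC := mins_system sysE CE.
have [a [b [ab ee]]] := seg e eE; rewrite ee in eC eE *.
have [s [t [sS tS st o]]] : exists s t, [/\ s \in Sd, t \in Sd, s < t & only E [set a; b] s t].
  have [s [t [sS tS o]]] := tE _ eE.
  case: (ltngtP s t) => [h|h|/val_inj h]; first by exists s, t.
    by exists t, s; split=> //; apply: onlyC.
  by case: o; rewrite h sepxx.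
have [s' [t' [sS' tS' st' o']]] : exists s t,
    [/\ s \in mins Sd C, t \in mins Sd C, s < t & only C [set a; b] s t].
  have [p [q [pS qS pq]]] := system_tight sysC eC.
  case: (ltngtP p q) => [h|h|/val_inj h]; first by exists p, q.
    by exists q, p; split=> //; apply: onlyC.
  by case: pq; rewrite h sepxx.
have cE := card_mins_contr sysE card_Sd CE.
have cM : #|mins Sd C| = #|contr m Sd C|.+1.
  by rewrite (system_card sysC) (card_contr sysE card_Sd CE).
have psi v : contract_vertex #|contr m Sd C| (min_sides (contr m Sd C))
    (contract_vertex m Sd v) = contract_vertex #|contr m Sd C| (mins Sd C) v.
  by rewrite min_sidesE contract_vertex_comp // (mins_contr sysE card_Sd CE).
have sysE' := contr_system sysE card_Sd.
have sysC' := contr_system sysC cM.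
rewrite -(forward_arc lC eC ab sS' tS' st' o').
rewrite -(@forward_arc _ Sd _ _ _ _ _ lE eE ab _ _ st o) ?(mins_id sysE) //.
have ob : (s < b <= t) = ~~ (s < a <= t).
  by case: o; rewrite sep_arc ?(ltnW st) //; do 2!case: (_ < _ <= _).
have ob' : (s' < b <= t') = ~~ (s' < a <= t').
  by case: o'; rewrite sep_arc ?(ltnW st') //; do 2!case: (_ < _ <= _).
have eE' : [set b; a] \in E by rewrite setUC.
have eC' : [set b; a] \in C by rewrite setUC.
have ow : only E [set b; a] s t by rewrite setUC.
have ow' : only C [set b; a] s' t' by rewrite setUC.
have o1 := oriented_contr sysE card_Sd sS tS st eE o.
have o2 := oriented_contr sysE card_Sd sS tS st eE' ow.
have o3 := oriented_contr sysC cM sS' tS' st' eC o'.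
have o4 := oriented_contr sysC cM sS' tS' st' eC' ow'.
(* By [forwardS], a reversal can only go from b -> a in the larger set to a -> b in the smaller
   one. *)
have imp : s < a <= t -> s' < a <= t'.
  rewrite (forward_arc lC eC ab sS' tS' st' o').
  by rewrite (@forward_arc _ Sd _ _ _ _ _ lE eE ab _ _ st o) ?(mins_id sysE) //; apply: forwardS.
rewrite ob in o2; rewrite ob' in o4.
rewrite /flips contract_chord2 (rdiag_contr sysE card_Sd CE).
apply/exists_inP/andP => [[x xin /exists_inP[y yin /andP[]]]|[h1 h2]].
  case/set2P: xin => ->; case/set2P: yin => ->; rewrite !psi.
  - by move/(oriented_neq sysE'); rewrite eqxx.
  - by rewrite o1 o4 => /imp ->.
  - by rewrite o2 o3 => -> ->.
  - by move/(oriented_neq sysE'); rewrite eqxx.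
exists (contract_vertex m Sd b); first by rewrite !inE eqxx orbT.
apply/exists_inP; exists (contract_vertex m Sd a); first by rewrite !inE eqxx.
by rewrite !psi o2 o3 h1 h2.
Qed.

Lemma kdiag_contr : kdiag (contr m Sd E) (contr m Sd C) =
  #|[set e in C | ~~ forward Sd E e && forward Sd C e]|.
Proof.
have inj : {in [set e in C | ~~ forward Sd E e && forward Sd C e] &,
    injective (contract_chord m Sd : chord n -> chord m)}.
  move=> c d /setIdP[/(subsetP CE) cE _] /setIdP[/(subsetP CE) dE _].
  exact: (contract_chord_inj sysE card_Sd).
rewrite /kdiag -(card_in_imset inj); apply: eq_card => d; rewrite inE.
apply/andP/imsetP => [[/imsetP[e eC ->]]|[e /setIdP[eC fe] ->]].
  by rewrite -/(flips _) flipsE // => fe; exists e; rewrite // inE eC.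
by split; [apply: imset_f|rewrite -/(flips _) flipsE].
Qed.

End Flips.

(** * Contractions of diagrams *)

Import GRing.Theory.
Local Open Scope ring_scope.

Section Restriction.
Variables (n : nat) (A : {set chord n}).
Hypothesis sysA : system setT A.
Implicit Types (C P X : {set chord n}) (f : {set 'I_n.+1}).

Let lamA : laminar A. Proof. exact: system_laminar sysA. Qed.

Lemma mins_mins (Sd : {set 'I_n.+1}) C P : P \subset C -> mins (mins Sd C) P = mins Sd P.
Proof.
move=> PC; apply/setP => s; apply/minsP/minsP => [[sM h]|[sS h]].
  split=> [|t tS st]; first exact: subsetP (mins_sub _ _) _ sM.
  have [t' [tM' tt' le]] := mins_ex C tS.
  by apply: leq_trans (h t' tM' _) le; apply: joined_trans st (joinedS PC tt').
split=> [|t tM st]; last by apply: h => //; apply: subsetP (mins_sub _ _) _ tM.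
by apply/minsP; split=> // t tS /(joinedS PC); apply: h.
Qed.

Lemma face_system P f : P \subset A -> f \in faces P ->
  system f (inside f (A :\: P)).
Proof.
move=> PA fP; apply: (inside_system sysA) => //.
- by case/facesP: fP => s ->; exists s; rewrite inE joined_refl.
- by move=> s t sf tf; rewrite -(faces_joined t fP sf).
- by move=> s t sf _; rewrite (faces_joined t fP sf).
Qed.

Lemma card_face P f : P \subset A -> f \in faces P ->
  #|f| = #|inside f (A :\: P)|.+1.
Proof. by move=> PA fP; apply/system_card/face_system. Qed.

Lemma qface_contr P f X : P \subset A -> f \in faces P -> X \subset A :\: P ->
  qface P f X = contr #|f|.-1 f (inside f X).
Proof. by move=> PA fP XA; apply: qfaceE sysA PA XA fP. Qed.

Lemma rdiagE C : rdiag C = contr #|C| (mins setT C) C.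
Proof. by rewrite /rdiag min_sidesE. Qed.

Lemma card_mins C : C \subset A -> #|mins setT C| = #|C|.+1.
Proof. by move=> CA; apply/system_card/(mins_system sysA CA). Qed.

Lemma rdiag_system C : C \subset A -> system setT (rdiag C).
Proof.
by move=> CA; rewrite rdiagE; apply: contr_system (mins_system sysA CA) (card_mins CA).
Qed.

Lemma inside_mins f P C : P \subset C -> C \subset A -> f \in faces P ->
  inside (f :&: mins setT C) (C :\: P) = inside f (C :\: P).
Proof.
move=> PC CA fP; apply/setP => e; apply/insideP/insideP => -[eC [s [t [sf tf st]]]].
  by split=> //; exists s, t; split=> //; [case/setIP: sf|case/setIP: tf].
split=> //; have [s' [sM ss' _]] := mins_ex C (in_setT s).
have [t' [tM tt' _]] := mins_ex C (in_setT t).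
exists s', t'; rewrite !in_setI sM tM (faces_joined s' fP sf) (faces_joined t' fP tf).
rewrite !(joinedS PC) //; split=> //; case/setDP: eC => eC _.
have := joinedP _ _ _ ss' e eC; have := joinedP _ _ _ tt' e eC; move: st.
by rewrite /sep; do 4!case: (side_under _ _).
Qed.

(** On f the chords of P separate nothing and those of C outside P act through [inside f], so both
    relations [joined] agree; a face of C never leaves f, as P is contained in C. *)
Lemma mins_face f P C : P \subset C -> C \subset A -> f \in faces P ->
  mins f (inside f (C :\: P)) = f :&: mins setT C.
Proof.
move=> PC CA fP.
have E s t : s \in f -> t \in f -> joined (inside f (C :\: P)) s t = joined C s t.
  move=> sf tf; apply/joinedP/joinedP => h c cC; last first.
    by apply: h; case/insideP: cC => /setDP[].
  case cP: (c \in P).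
    by have /joinedP/(_ c cP) : joined P s t by rewrite -(faces_joined t fP sf).
  apply/negP => cst; suff /h : c \in inside f (C :\: P) by rewrite cst.
  by apply/insideP; rewrite inE cC cP; split=> //; exists s, t.
apply/setP => s; apply/minsP/setIP => [[sf h]|[sf /minsP[_ h]]]; split=> //.
  apply/minsP; split=> [|t _ st]; first by rewrite inE.
  have tf : t \in f by rewrite (faces_joined t fP sf) (joinedS PC).
  by apply: h; rewrite ?E.
by move=> t tf; rewrite E //; apply: h; rewrite inE.
Qed.

Lemma face_meets P C f : P \subset C -> f \in faces P ->
  exists s, s \in f :&: mins setT C.
Proof.
move=> PC /[dup] fP /facesP[s ef]; have sf : s \in f by rewrite ef inE joined_refl.
have [t [tM st _]] := mins_ex C (in_setT s); exists t.
by rewrite in_setI tM (faces_joined t fP sf) (joinedS PC).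
Qed.

(* A chord of X lies in exactly one face of P. *)
Lemma card_faces_inside P X (Q : pred (chord n)) : P \subset A -> X \subset A :\: P ->
  (\sum_(f in faces P) #|[set e in inside f X | Q e]| = #|[set e in X | Q e]|)%N.
Proof.
move=> PA XA; under eq_bigr => f _ do rewrite -sum1_card.
rewrite (exchange_big_dep (mem [set e in X | Q e])) /=; last first.
  by move=> f e _; rewrite !inE -andbA => /and3P[-> _ ->].
rewrite -[RHS]sum1_card; apply: eq_bigr => e; rewrite inE => /andP[eX Qe].
have /setDP[eA eP] := subsetP XA _ eX.
have [_ _ tA _ _] := sysA; have [s [t [_ _ o]]] := tA e eA.
have [st _] := o.
have jst : joined P s t.
  by apply: joinedS (only_joined eA o); rewrite subsetD1 PA eP.
have clsP : cls P s \in faces P by apply/facesP; exists s.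
rewrite (big_pred1 (cls P s)) // => f /=; rewrite inE Qe andbT.
apply/andP/eqP => [[fP /insideP[_ h]]|->].
  have sf : s \in f by apply/(inside_faceP lamA PA eA jst st fP).
  by apply/setP => z; rewrite inE (faces_joined z fP sf).
split=> //; apply/insideP; split=> //; exists s, t; rewrite !inE joined_refl.
by split.
Qed.

(** By [forward_inside], with [A :\: P] and then X as the set of remaining chords, orientations in
    q_P(D) are those of D, and after r_X those of [P :|: X]. *)
Lemma kqdiagE P X : P \subset A -> X \subset A :\: P ->
  kqdiag A P X =
  #|[set e in X | ~~ forward setT A e && forward setT (P :|: X) e]|.
Proof.
move=> PA XA; rewrite -(card_faces_inside _ PA XA); apply: eq_bigr => f fP.
rewrite !qface_contr // (kdiag_contr (face_system PA fP)); first last.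
- apply/subsetP => e /insideP[eX h]; apply/insideP; split=> //.
  exact: subsetP XA e eX.
- by rewrite prednK // (card_face PA fP).
apply: eq_card => e; rewrite [LHS]inE [RHS]inE; case eX: (e \in inside f X) => //.
have eA : e \in inside f (A :\: P).
  by case/insideP: eX => eX h; apply/insideP; split=> //; apply: subsetP XA e eX.
rewrite (forward_inside lamA PA XA fP eX) (forward_inside lamA PA (subxx _) fP eA).
by rewrite setDE setUIr setUCr setIT (setUidPr PA).
Qed.

Lemma kdiag_rdiag C P : C \subset A -> P \subset C ->
  kdiag (rdiag C) (contr #|C| (mins setT C) P) =
  #|[set e in P | ~~ forward setT C e && forward setT P e]|.
Proof.
move=> CA PC; have sysC := mins_system sysA CA.
rewrite rdiagE (kdiag_contr sysC (card_mins CA) PC).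
apply: eq_card => e; rewrite !inE; case eP: (e \in P) => //=.
have eC := subsetP PC _ eP; have seg := system_segment sysC eC.
by rewrite !forward_mins.
Qed.

End Restriction.

Lemma contract_vertexT n (v : 'I_n.+1) : contract_vertex n setT v = v.
Proof.
apply: val_inj => /=; rewrite [#|_|](_ : _ = v :> nat) ?modn_small //.
have vn := ltnW (ltn_ord v); rewrite -[RHS]card_ord.
rewrite -(card_imset _ (_ : injective (widen_ord vn))); last first.
  by move=> i j /(congr1 val) /= /val_inj.
apply: eq_card => i; rewrite !inE; apply/idP/imsetP => [iv|[j _ ->]] //=.
by exists (Ordinal iv) => //; apply: val_inj.
Qed.

Lemma contr_id n (C : {set chord n}) : contr n setT C = C.
Proof.
rewrite /contr -[RHS]imset_id; apply: eq_imset => c.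
by rewrite /contract_chord (eq_imset _ (@contract_vertexT n)) imset_id.
Qed.

Lemma kdiagE n (A C : {set chord n}) : system setT A -> C \subset A ->
  kdiag A C = #|[set e in C | ~~ forward setT A e && forward setT C e]|.
Proof.
move=> sysA CA; have cT : #|[set: 'I_n.+1]| = n.+1 by rewrite cardsT card_ord.
by rewrite -(kdiag_contr sysA cT CA) !contr_id.
Qed.

Lemma diag0 (K : fieldType) k (X : {set chord k}) : k = 0%N -> diag K X = 1.
Proof. by move=> k0; subst k. Qed.

Lemma rH0 (K : fieldType) n : rH K (set0 : {set chord n}) = 1.
Proof. by apply: diag0; rewrite cards0. Qed.

(** * Iterated contractions as elements of the Hopf algebra *)

Section Elements.
Variables (K : fieldType) (n : nat) (A : {set chord n}).
Hypothesis sysA : system setT A.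
Implicit Types (C P X : {set chord n}) (f : {set 'I_n.+1}).

(** The comparison takes place in H_D because the two sets of chords have different types. *)
Lemma diag_contr m m' Sd Sd' C C' : m = m' -> Sd = Sd' -> C = C' ->
  diag K (contr m Sd C : {set chord m}) = diag K (contr m' Sd' C' : {set chord m'}) :> HD K.
Proof. by move=> -> -> ->. Qed.

(** This is r_P(r_C(D)) = r_P(D), which rests on [mins_mins]. *)
Lemma rH_contr C P : C \subset A -> P \subset C ->
  rH K (contr #|C| (mins setT C) P) = rH K P.
Proof.
move=> CA PC; have sysC := mins_system sysA CA.
rewrite /rH (rdiag_contr sysC (card_mins sysA CA) PC) rdiagE.
apply: diag_contr => //; first by rewrite (card_contr sysC (card_mins sysA CA) PC).
exact: mins_mins.
Qed.

(** This is q_P(r_C(D)) = r_{C \ P}(q_P(D)). In each face f of P, both members contract the chords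
    of C \ P inside f onto the sides [f :&: mins setT C]. *)
Lemma qH_rdiag C P : C \subset A -> P \subset C ->
  qH K (rdiag C) (contr #|C| (mins setT C) P) = rqH K P (C :\: P).
Proof.
move=> CA PC; have sysC := mins_system sysA CA.
have PA := subset_trans PC CA.
have cM := card_mins sysA CA; have sysC' := rdiag_system sysA CA.
have meet f : f \in faces P -> exists s, s \in f :&: mins setT C by apply: face_meets.
rewrite /qH (faces_contr sysC cM PC meet) big_imset /=; last first.
  exact: (faces_contr_inj cM PC meet).
rewrite /rqH; apply: eq_bigr => f fP.
have CP : C :\: P \subset C by apply: subsetDl.
have XA : C :\: P \subset A :\: P by apply: setSD.
have sub : f :&: mins setT C \subset mins setT C by apply: subsetIr.
rewrite (qface_contr sysA PA fP XA) (qface_contr sysC'); first last.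
- by rewrite rdiagE.
- exact: (face_contr sysC cM PC fP (meet f fP)).
- by rewrite rdiagE; apply: contr_sub.
rewrite rdiagE (contrD sysC cM (subxx C) PC).
rewrite (inside_contr sysC cM CP sub) (inside_mins PC CA fP).
have [s0 /setIP[s0f s0M]] := meet f fP.
have sysf : system (f :&: mins setT C) (inside f (C :\: P)).
  rewrite -(inside_mins PC CA fP).
  by apply: (inside_mins_faces sysA PC CA fP); exists s0; rewrite ?inE.
have cf := system_card sysf.
have cphi := card_face_contr cM sub.
rewrite (contr_contr cM) ?cphi ?cf //.
have sysF := face_system sysA PA fP.
have sub' : inside f (C :\: P) \subset inside f (A :\: P).
  apply/subsetP => e /insideP[eX h]; apply/insideP; split=> //.
  exact: subsetP XA e eX.
have cF : #|f| = #|f|.-1.+1 by rewrite (card_face sysA PA fP).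
rewrite /rH (rdiag_contr sysF cF sub').
apply: diag_contr => //.
- by rewrite (card_contr sysF cF sub').
- rewrite (mins_face PC CA fP); apply/setP => s; rewrite inE.
  apply/andP/setIP => [[sM /imsetP[t /setIP[tf tM] eq]]|[sf sM]].
    by rewrite (contract_inj cM sM tM eq).
  by split=> //; apply: imset_f; rewrite inE sf.
Qed.

Lemma rH_diag : rH K A = diag K A.
Proof.
have cA : #|A| = n by have := system_card sysA; rewrite cardsT card_ord => -[].
rewrite /rH rdiagE (mins_id sysA) (@diag_contr _ n _ setT _ A) //.
by rewrite contr_id.
Qed.

Lemma qH_full : qH K A A = 1.
Proof.
apply: big1 => f fA; apply: diag0.
rewrite (card_face sysA (subxx A) fA) setDv /=.
by apply/eqP; rewrite cards_eq0 -subset0; apply: inside_sub.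
Qed.

End Elements.

(** * The recursion for the antipode *)

Lemma setDK (T : finType) (C E : {set T}) : E \subset C -> C :\: (C :\: E) = E.
Proof. by move=> EC; rewrite setDDr setDv set0U; apply/setIidPr. Qed.

Lemma scaler_swapAr (K : fieldType) (a b : K) (u v : HD K) :
  a *: (b *: (u * v)) = b *: (u * (a *: v)).
Proof. by rewrite scalerA mulrC -scalerA scalerAr. Qed.

(** * Evaluation of the convolution product *)

Section LinearExtension.
Variables (K : fieldType) (M : choiceType) (V : lmodType K) (ev : M -> V).

(** [convol x id S] has this form, evaluated at the coproduct. Linearity, not apparent on a sum over
    the support, is what distributes it over the sum defining the coproduct. *)
Definition malg_ext (t : {malg K[M]}) : V := \sum_(w <- msupp t) t@_w *: ev w.

Lemma malg_extEw (d : {fset M}) t : (msupp t `<=` d)%fset ->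
  malg_ext t = \sum_(w <- d) t@_w *: ev w.
Proof.
move=> le; rewrite [LHS](big_fset_incl _ le) => //= w _ /mcoeff_outdom ->.
by rewrite scale0r.
Qed.

Lemma malg_ext_is_linear : linear malg_ext.
Proof.
move=> c t u; pose d := (msupp (c *: t + u) `|` (msupp t `|` msupp u))%fset.
rewrite (@malg_extEw d) ?fsubsetUl // (@malg_extEw d t); last first.
  by rewrite fsubsetU // fsubsetUl orbT.
rewrite (@malg_extEw d u); last by rewrite fsubsetU // fsubsetUr orbT.
have E w : (c *: t + u)@_w *: ev w = c *: (t@_w *: ev w) + u@_w *: ev w.
  by rewrite mcoeffD mcoeffZ scalerDl scalerA.
rewrite (eq_bigr _ (fun w _ => E w)) big_split /=; congr (_ + _).
exact/esym/scaler_sumr.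
Qed.

HB.instance Definition _ := GRing.isLinear.Build K {malg K[M]} V *:%R malg_ext
  malg_ext_is_linear.

Lemma malg_extU c w : malg_ext << c *g w >> = c *: ev w.
Proof. by rewrite (malg_extEw msuppU_le) big_seq_fset1 mcoeffUU. Qed.

End LinearExtension.

Section Antipode.
Variables (K : fieldType) (x : K) (S : {linear HD K -> HD K}).
Hypothesis antipodeS : is_antipode x S.

Let ev (w : ({cmonom pos_diagram} * {cmonom pos_diagram})%type) : HD K :=
  << w.1 >> * S << w.2 >>.

Lemma malgU_scale (M : choiceType) (c : K) (w : M) :
  << c *g w >> = c *: << w >> :> {malg K[M]}.
Proof. by apply/malgP => k; rewrite mcoeffZ !mcoeffU mulr_natr. Qed.

Let ext_tens (a b : HD K) : malg_ext ev (tens a b) = a * S b.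
Proof.
rewrite /tens linear_sum /= [in RHS](monalgE a) [in RHS](monalgE b).
rewrite mulr_suml; apply: eq_bigr => u _; rewrite !linear_sum /= mulr_sumr.
apply: eq_bigr => v _; rewrite malg_extU /ev /=.
rewrite (malgU_scale (a@_u)) (malgU_scale (b@_v)) linearZ /=.
by rewrite -scalerAl -scalerAr scalerA.
Qed.

Let coprodU (D : {cmonom pos_diagram}) : coprod x << D >> =
  \prod_(D' <- finsupp D) coprod_diag x D' ^+ D D'.
Proof. by rewrite /coprod /mmap msuppU oner_eq0 big_seq_fset1 mcoeffUU mul1r. Qed.

Lemma antipode1 : S 1 = 1.
Proof.
have e1 : 1 = << (mone : {cmonom pos_diagram}) >> :> HD K by [].
have e2 : 1 = << (mone : ({cmonom pos_diagram} * {cmonom pos_diagram})%type) >> :> HD2 K by [].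
have [_] := antipodeS 1; rewrite /convol {1}e1 coprodU mdom1 big_seq_fset0.
rewrite -/(malg_ext ev 1) [in malg_ext _ _]e2 malg_extU scale1r /ev /= -e1 mul1r => ->.
by rewrite /counit e1 mcoeffUU.
Qed.

Lemma antipode_diag n (A : {set chord n}) : (0 < n)%N -> is_diagram A ->
  \sum_(C : {set chord n} | C \subset A)
     x ^+ kdiag A C *: (qH K A C * S (rH K C)) = 0.
Proof.
case: n A => // n A _ dA.
pose D : pos_diagram := Tagged (fun n => diagram n.+1) (Sub A dA : diagram n.+1).
have eD : diag K A = << ucm D >> by rewrite /= insubT.
have [_] := antipodeS (diag K A); rewrite /convol eD coprodU.
rewrite mdomU big_seq_fset1 cmUU expr1 -/(malg_ext ev _).
rewrite /counit mcoeffU [_ == _](_ : _ = false) ?mulr0n; last first.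
  by apply/eqP => /(congr1 (fun m : {cmonom pos_diagram} => m D)); rewrite cmUU cm1.
rewrite malgC0E /coprod_diag linear_sum /= => E; rewrite -[RHS]E; apply: eq_bigr => C _.
by rewrite linearZ /= ext_tens.
Qed.

(** * Chains of sets of chords, and the unrolling of the recursion *)

Section Chains.
Variables (n : nat) (A : {set chord n}).
Hypothesis sysA : system setT A.
Implicit Types (C E P Q X : {set chord n}).

Definition nflips C P X :=
  #|[set e in X | ~~ forward setT C e && forward setT P e]|.

(** [antipode_diag] for the diagram r_C(D): [h] and [h'] reindex its sets of chords by the subsets P
    of C, and iterated contractions are rewritten in terms of D. *)
Lemma antipode_rdiag C : C \subset A -> C != set0 ->
  \sum_(P : {set chord n} | P \subset C)
     x ^+ nflips C P P *: (rqH K P (C :\: P) * S (rH K P)) = 0.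
Proof.
move=> CA C0; have sysC := mins_system sysA CA; have cM := card_mins sysA CA.
have E := antipode_diag _ (system_diagram (rdiag_system sysA CA)).
rewrite -[RHS]E ?card_gt0 //; symmetry.
pose h P := contr #|C| (mins setT C) P.
pose h' (Q : {set chord #|C|}) := [set e in C | contract_chord #|C| (mins setT C) e \in Q].
have rC : rdiag C = h C by rewrite rdiagE.
have hK (Q : {set chord #|C|}) : Q \subset rdiag C -> h (h' Q) = Q.
  move=> /subsetP QC; apply/setP => d; apply/imsetP/idP => [[e]|dQ].
    by rewrite inE => /andP[_ ?] ->.
  have := QC d dQ; rewrite rC => /imsetP[e eC ed]; exists e => //.
  by rewrite inE eC -ed.
rewrite (reindex_onto h h' hK); apply: eq_big => [P|P /andP[hP /eqP hP']].
  apply/andP/idP => [[hP /eqP <-]|PC].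
    by apply/subsetP => e; rewrite inE => /andP[].
  rewrite rC imsetS //; split=> //; apply/eqP/setP => e; rewrite inE.
  case eC: (e \in C); first by rewrite (mem_contr sysC cM PC).
  by apply/esym/negP => /(subsetP PC); rewrite eC.
have PC : P \subset C by rewrite -hP'; apply/subsetP => e; rewrite inE => /andP[].
by rewrite /h (kdiag_rdiag sysA CA PC) (qH_rdiag K sysA CA PC) (rH_contr K sysA CA PC).
Qed.

Lemma antipode_rec C : C \subset A -> C != set0 ->
  S (rH K C) = - \sum_(P : {set chord n} | P \proper C)
     x ^+ nflips C P P *: (rqH K P (C :\: P) * S (rH K P)).
Proof.
move=> CA C0; apply/eqP; rewrite -addr_eq0; apply/eqP.
rewrite -[RHS](antipode_rdiag CA C0) [RHS](bigD1 C) //=; congr (_ + _).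
  rewrite [nflips _ _ _](_ : _ = 0%N) ?expr0 ?scale1r; last first.
    by apply/eqP; rewrite cards_eq0; apply/eqP/setP => e; rewrite !inE andNb andbF.
  rewrite setDv [rqH _ _ _](_ : _ = 1) ?mul1r //; apply: big1 => f _.
  rewrite [qface _ _ _](_ : _ = set0) ?rH0 //.
  by apply/setP => d; rewrite inE; apply/imsetP => -[e]; rewrite !inE.
by apply: eq_bigl => P; rewrite properEneq andbC.
Qed.

(** The counterpart of [kpart] for r_C(D): chords of C_i are compared between C and P_i, the union
    of the first i blocks. *)
Definition nflips_tuple s C (P : s.-tuple {set chord n}) :=
  (\sum_(i < s) nflips C (before P i :|: tnth P i) (tnth P i))%N.

Definition chain_sum s C : HD K :=
  \sum_(P : s.-tuple {set chord n} | ordered_partition C P)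
    x ^+ nflips_tuple C P *: \prod_(i < s) rqH K (before P i) (tnth P i).

(** The last block is the one split off, since the recursion passes from C to the union of all the
    blocks but the last. *)
Lemma ordered_partition_rcons s C (P : s.-tuple {set chord n}) X :
  ordered_partition C [tuple of rcons P X] =
  [&& X != set0, X \subset C & ordered_partition (C :\: X) P].
Proof.
have E : [set Y in rcons P X] = X |: [set Y in P].
  by apply/setP => Y; rewrite !inE mem_rcons inE.
rewrite /ordered_partition /= rcons_uniq E.
apply/andP/and3P => [[/andP[XP uP] pC]|[X0 XC /andP[uP pC]]].
  have XE : X \in X |: [set Y in P] by rewrite !inE eqxx.
  split.
  - by case/and3P: pC => _ _; apply: contraNneq => <-.
  - by rewrite -(cover_partition pC); apply: (bigcup_sup X).
  - rewrite uP; have := partitionD1 pC XE; rewrite setU1K //.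
    by rewrite inE.
have XP : X \notin P.
  apply/negP => XP; have : X \subset C :\: X.
    by rewrite -(cover_partition pC); apply: (bigcup_sup X); rewrite inE.
  by rewrite subsetD => /andP[_]; rewrite -setI_eq0 setIid (negPf X0).
rewrite XP uP; split=> //; have dX : [disjoint X & C :\: X].
  by rewrite disjoints_subset setCD subsetUr.
have := partitionU1 pC X0 dX; rewrite (_ : X :|: (C :\: X) = C) //.
by rewrite -{2}(setID C X) (setIidPr XC).
Qed.

Lemma cover_before s C (P : s.-tuple {set chord n}) : ordered_partition C P ->
  \bigcup_(i < s) tnth P i = C.
Proof.
case/andP=> _ /cover_partition; rewrite /cover => <-; apply/setP => e.
apply/bigcupP/bigcupP => [[i _ ei]|[Y]]; first by exists (tnth P i); rewrite // inE mem_tnth.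
by rewrite inE => /tnthP[i ->] ei; exists i.
Qed.

Lemma tnth_sub s C (P : s.-tuple {set chord n}) i : ordered_partition C P ->
  tnth P i \subset C.
Proof. by move=> /cover_before <-; apply: (bigcup_sup i). Qed.

Lemma before_sub s C (P : s.-tuple {set chord n}) i : ordered_partition C P ->
  before P i \subset C.
Proof. by move=> pC; apply/bigcupsP => j _; apply: tnth_sub. Qed.

Lemma before_disjoint s C (P : s.-tuple {set chord n}) i : ordered_partition C P ->
  tnth P i \subset C :\: before P i.
Proof.
move=> pC; rewrite subsetD (tnth_sub _ pC) /=.
apply: bigcup_disjoint => j ji; case/andP: pC => uP /and3P[_ /trivIsetP tP _].
apply: tP; rewrite ?inE ?mem_tnth //; apply: contraTneq ji => /eqP.
by rewrite !(tnth_nth set0) nth_uniq ?size_tuple // => /eqP->; rewrite ltnn.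
Qed.

Lemma nflips_sum s C (P : s.-tuple {set chord n}) E Q : ordered_partition C P ->
  nflips E Q C = (\sum_(i < s) nflips E Q (tnth P i))%N.
Proof.
case/andP=> uP pC; rewrite /nflips -sum1_card.
under eq_bigl => e do rewrite inE.
rewrite (set_partition_big_cond _ pC) /= -(big_tuple _ _ P predT (nflips E Q)).
rewrite big_uniq //= (eq_bigl (mem P)) => [|Y]; last by rewrite inE.
by apply: eq_bigr => Y _; rewrite /nflips -sum1_card; apply: eq_bigl => e; rewrite inE.
Qed.

(** Being forward for C implies it for E, and for E implies it for Q; a chord reversed between C and
    Q is thus reversed at exactly one of the two steps. *)
Lemma nflips_trans C E Q X : Q \subset E -> E \subset C ->
  (nflips C E X + nflips E Q X = nflips C Q X)%N.
Proof.
move=> QE EC; rewrite /nflips -cardsUI [X in (_ + X)%N](_ : _ = 0%N) ?addn0.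
  apply: eq_card => e; rewrite !inE; case: (e \in X) => //=.
  have := @forwardS _ setT _ _ e QE; have := @forwardS _ setT _ _ e EC.
  by do 3!case: (forward _ _ e) => //; move=> h1 h2; rewrite ?h1 ?h2.
apply/eqP; rewrite cards_eq0; apply/eqP/setP => e; rewrite !inE.
by case: (forward _ E e); rewrite !andbF.
Qed.

Lemma nflips_same C X : nflips C C X = 0%N.
Proof. by apply/eqP; rewrite cards_eq0; apply/eqP/setP => e; rewrite !inE andNb andbF. Qed.

Section Rcons.
Variables (s : nat) (P : s.-tuple {set chord n}) (X C : {set chord n}).
Hypotheses (XC : X \subset C) (pCX : ordered_partition (C :\: X) P).
Let R := [tuple of rcons P X].

Lemma tnth_rcons_widen (i : 'I_s) : tnth R (widen_ord (leqnSn s) i) = tnth P i.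
Proof. by rewrite !(tnth_nth set0) /= nth_rcons size_tuple ltn_ord. Qed.

Lemma tnth_rcons_max : tnth R ord_max = X.
Proof. by rewrite (tnth_nth set0) /= nth_rcons size_tuple ltnn eqxx. Qed.

Lemma before_rcons_widen (i : 'I_s) : before R (widen_ord (leqnSn s) i) = before P i.
Proof.
rewrite /before big_mkcond big_ord_recr /= ltnNge ltnW //= setU0 [RHS]big_mkcond.
by apply: eq_bigr => j _; rewrite /= tnth_rcons_widen.
Qed.

Lemma before_rcons_max : before R ord_max = C :\: X.
Proof.
rewrite /before big_mkcond big_ord_recr /= ltnn setU0 -(cover_before pCX).
by apply: eq_bigr => j _; rewrite /= ltn_ord tnth_rcons_widen.
Qed.

(** The chords of X are compared between C and itself. For those of an earlier block, [nflips_trans]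
    inserts C \ X between C and P_i; the first halves add up over the blocks to a count on C \ X. *)
Lemma nflips_rcons : nflips_tuple C R =
  (nflips C (C :\: X) (C :\: X) + nflips_tuple (C :\: X) P)%N.
Proof.
rewrite /nflips_tuple big_ord_recr /= tnth_rcons_max before_rcons_max setUC.
rewrite [X :|: _](_ : _ = C); last by rewrite -[RHS](setID C X) (setIidPr XC).
rewrite nflips_same addn0 (nflips_sum _ _ pCX) -big_split; apply: eq_bigr => i _.
rewrite /= before_rcons_widen tnth_rcons_widen nflips_trans ?subsetDl //.
by rewrite subUset (before_sub _ pCX) (tnth_sub _ pCX).
Qed.

Lemma prod_rcons : \prod_(i < s.+1) rqH K (before R i) (tnth R i) =
  rqH K (C :\: X) X * \prod_(i < s) rqH K (before P i) (tnth P i).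
Proof.
rewrite big_ord_recr /= before_rcons_max tnth_rcons_max mulrC; congr (_ * _).
by apply: eq_bigr => i _; rewrite before_rcons_widen tnth_rcons_widen.
Qed.

End Rcons.

Lemma chain_sumS s C : chain_sum s.+1 C =
  \sum_(E : {set chord n} | E \proper C)
     x ^+ nflips C E E *: (rqH K E (C :\: E) * chain_sum s E).
Proof.
pose h (q : {set chord n} * s.-tuple {set chord n}) : s.+1.-tuple {set chord n} :=
  [tuple of rcons q.2 (C :\: q.1)].
pose h' (P : s.+1.-tuple {set chord n}) : {set chord n} * s.-tuple {set chord n} :=
  (C :\: tnth P ord_max, [tuple tnth P (widen_ord (leqnSn s) i) | i < s]).
have hK (P : s.+1.-tuple {set chord n}) : ordered_partition C P -> h (h' P) = P.
  move=> pC; apply: eq_from_tnth => i; rewrite /h /h' /=.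
  rewrite setDK ?(tnth_sub _ pC) //.
  case: (unliftP ord_max i) => [j ->|->]; last by rewrite tnth_rcons_max.
  rewrite [lift _ _](_ : _ = widen_ord (leqnSn s) j); last first.
    by apply: val_inj; rewrite /= /bump leqNgt ltn_ord.
  by rewrite tnth_rcons_widen tnth_mktuple.
have hP E (P : s.-tuple {set chord n}) : ordered_partition C (h (E, P)) && (h' (h (E, P)) == (E, P)) =
    (E \proper C) && ordered_partition E P.
  rewrite /h /= ordered_partition_rcons subsetDl /= /h' tnth_rcons_max.
  have eP : [tuple tnth [tuple of rcons P (C :\: E)] (widen_ord (leqnSn s) i) | i < s] = P.
    by apply: eq_from_tnth => i; rewrite tnth_mktuple tnth_rcons_widen.
  rewrite xpair_eqE eP eqxx andbT properE.
  apply/andP/andP => [[/andP[ne pE] /eqP eE]|[/andP[EC ne] pE]].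
    by rewrite eE in pE; rewrite pE -{1}eE subsetDl -setD_eq0.
  by rewrite setDK // eqxx pE setD_eq0 ne.
rewrite /chain_sum (reindex_onto h h' hK) /=.
under [RHS]eq_bigr => E _ do rewrite mulr_sumr scaler_sumr.
rewrite pair_big_dep /=; apply: eq_big => [[E P]|[E P]] /=; first exact: hP.
rewrite hP => /andP[/proper_sub EC pE].
have pE' : ordered_partition (C :\: (C :\: E)) P by rewrite setDK.
rewrite /h /= (nflips_rcons (subsetDl _ _) pE') (prod_rcons pE').
rewrite (setDK EC).
rewrite exprD.
rewrite -[LHS]scalerA.
congr (_ *: _); exact: scalerAr.
Qed.

Lemma chain_sum0 C : chain_sum 0 C = if C == set0 then 1 else 0.
Proof.
have op0 (P : 0.-tuple {set chord n}) : ordered_partition C P = (C == set0).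
  rewrite tuple0 /ordered_partition /=; apply/idP/eqP => [/cover_partition <-|->].
    by apply: big_pred0 => Y; rewrite inE.
  by apply/and3P; split; rewrite ?inE //; [rewrite /cover big_pred0 // => Y; rewrite inE
    | apply/trivIsetP => Y Z; rewrite inE].
rewrite /chain_sum; under eq_bigl => P do rewrite op0.
case: eqP => _; last by rewrite big_pred0.
rewrite (big_pred1 [tuple]) => [|P]; last by apply/esym/eqP; apply: tuple0.
by rewrite /nflips_tuple !big_ord0 scale1r.
Qed.

(** Blocks are nonempty, so chains with more than #|C| blocks do not exist. A bound N common to all
    the subsets allows the sums over s and over E to be exchanged. *)
Lemma antipode_chain_sum N C : C \subset A -> (#|C| < N)%N ->
  S (rH K C) = \sum_(s < N) (-1) ^+ s *: chain_sum s C.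
Proof.
elim: N C => // N IH C CA CN; rewrite big_ord_recl expr0 scale1r chain_sum0.
have [C0|C0] := eqVneq C set0.
  rewrite C0 rH0 antipode1 big1 ?addr0 // => s _.
  rewrite chain_sumS big1 ?scaler0 // => E; rewrite properE.
  by case/andP=> E0; rewrite sub0set.
rewrite add0r antipode_rec //.
have step (s : 'I_N) : (-1) ^+ lift ord0 s *: chain_sum (lift ord0 s) C =
    - \sum_(E : {set chord n} | E \proper C)
        x ^+ nflips C E E *: (rqH K E (C :\: E) * ((-1) ^+ s *: chain_sum s E)).
  rewrite lift0 exprS mulN1r scaleNr chain_sumS scaler_sumr.
  apply: (congr1 -%R).
  by apply: eq_bigr => E _; apply: scaler_swapAr.
rewrite (eq_bigr _ (fun s _ => step s)) sumrN exchange_big /=; apply: (congr1 -%R).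
apply: eq_bigr => E EC; rewrite -scaler_sumr -mulr_sumr IH //.
  exact: subset_trans (proper_sub EC) CA.
exact: leq_trans (proper_card EC) CN.
Qed.

Lemma nflips_tupleE s (P : s.-tuple {set chord n}) : ordered_partition A P ->
  nflips_tuple A P = kpart A P.
Proof.
move=> pA; apply: eq_bigr => i _.
by rewrite (kqdiagE sysA (before_sub _ pA) (before_disjoint _ pA)).
Qed.

End Chains.

Lemma antipode_formula n (A : {set chord n}) : (0 < n)%N -> is_diagram A ->
  S (diag K A) =
  \sum_(1 <= s < n.+1) (-1) ^+ s *:
    \sum_(P : s.-tuple {set chord n} | ordered_partition A P)
      x ^+ kpart A P *: \prod_(i < s) rqH K (before P i) (tnth P i).
Proof.
move=> n0 dA; have sysA := diagram_system dA.
have cA : #|A| = n by case/andP: dA => /eqP.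
rewrite -(rH_diag K sysA) (antipode_chain_sum sysA (N := n.+1)) ?cA //.
(* The term s = 0 vanishes because D has a chord. *)
rewrite big_ord_recl chain_sum0 -cards_eq0 cA -[n == 0%N]negbK -lt0n n0 /= scaler0 add0r.
rewrite big_add1 big_mkord; apply: eq_bigr => s _.
apply: (congr1 ( *:%R _)).
by apply: eq_bigr => P pA; rewrite nflips_tupleE.
Qed.

Lemma antipode_diag_rec n (A : {set chord n}) : (0 < n)%N -> is_diagram A ->
  S (diag K A) = - \sum_(C : {set chord n} | C \proper A)
     x ^+ kdiag A C *: (qH K A C * S (rH K C)).
Proof.
move=> n0 dA; have sysA := diagram_system dA.
apply/eqP; rewrite -addr_eq0; apply/eqP; rewrite -[RHS](antipode_diag n0 dA).
rewrite [RHS](bigD1 A) //= (kdiagE sysA (subxx A)) -/(nflips A A A) nflips_same.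
rewrite scale1r (qH_full K sysA) mul1r (rH_diag K sysA); congr (_ + _).
by apply: eq_bigl => C; rewrite properEneq andbC.
Qed.

End Antipode.

(** * Sums over compositions *)

Section Parts.
Variables (n k : nat) (alpha : k.-tuple 'I_n.+1).

Lemma partE j : part alpha j = nth 0%N (map val alpha) j.-1.
Proof.
rewrite /part; case: (ltnP j.-1 k) => le; first by rewrite (nth_map ord0) ?size_tuple.
by rewrite !nth_default ?size_map ?size_tuple.
Qed.

Lemma tail_sumE j : tail_sum alpha j = sumn (drop j (map val alpha)).
Proof.
rewrite /tail_sum big_add1 /= sumnE [RHS](big_nth 0%N) size_drop size_map size_tuple.
rewrite -{1}[j]add0n big_addn; apply: eq_bigr => i _.
by rewrite nth_drop partE addnC.
Qed.

Lemma sum_part : (\sum_(1 <= j < k.+1) part alpha j)%N = sumn (map val alpha).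
Proof. by rewrite -[in RHS](drop0 (map _ _)) -tail_sumE. Qed.

Lemma compositionE :
  composition alpha = all (leq 1) (map val alpha) && (sumn (map val alpha) == n).
Proof.
rewrite /composition sum_part; congr (_ && _); rewrite all_map.
by apply/forallP/all_tnthP.
Qed.

End Parts.

Section Compositions.
Variables (R : comNzRingType) (V : algType R) (a : nat -> nat -> V).

(** The coefficient produced by unrolling S_n = - sum a(n - p, p) S_p: each part comes with the sum
    of the parts after it. *)
Fixpoint weight (s : seq nat) : V :=
  if s is i :: s' then a i (sumn s') * weight s' else 1.

Lemma weightE s :
  weight s = \prod_(j < size s) a (nth 0%N s j) (sumn (drop j.+1 s)).
Proof.
elim: s => [|i s IH] /=; first by rewrite big_ord0.
by rewrite big_ord_recl /= drop0 IH.
Qed.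

(** The parts are bounded by a fixed N, so that the recursion on n stays in one type of tuples. *)
Definition comp_sum N k n : V :=
  \sum_(t : k.-tuple 'I_N.+1 | all (leq 1) (map val t) && (sumn (map val t) == n))
    weight (map val t).

Lemma comp_sum0 N n : comp_sum N 0 n = (n == 0%N)%:R.
Proof.
rewrite /comp_sum (eq_bigl (fun t => n == 0%N)) => [|t]; last by rewrite tuple0 /= eq_sym.
case: eqP => _; last by rewrite big_pred0.
by rewrite (big_pred1 [tuple]) // => t; apply/esym/eqP/tuple0.
Qed.

(** Split off the first part n - p; the others add up to p < n. *)
Lemma comp_sumS N k n : (n <= N)%N ->
  comp_sum N k.+1 n = \sum_(p < n) a (n - p)%N p * comp_sum N k p.
Proof.
move=> nN; pose h (q : 'I_N.+1 * k.-tuple 'I_N.+1) := [tuple of q.1 :: q.2].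
have h_bij : bijective h.
  exists (fun t => (thead t, [tuple of behead t])) => [[i t]|t]; rewrite /h /=.
    by rewrite theadE; congr pair; apply: val_inj.
  by rewrite -tuple_eta.
rewrite [LHS]/comp_sum (reindex h) /=; last exact: onW_bij.
rewrite (eq_bigl (fun q : 'I_N.+1 * k.-tuple 'I_N.+1 => (0 < q.1 <= n)%N &&
    (all (leq 1) (map val q.2) && (sumn (map val q.2) == n - q.1)%N))); last first.
  case=> i t /=; case: (all _ _); rewrite ?andbF //= ?andbT; case: (posnP i) => //= i0.
  by apply/eqP/andP => [<-|[le /eqP->]]; [rewrite leq_addr addKn|rewrite subnKC].
rewrite -(pair_big_dep (fun i : 'I_N.+1 => 0 < i <= n)%N (fun i (t : k.-tuple 'I_N.+1) =>
   all (leq 1) (map val t) && (sumn (map val t) == n - i)%N)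
   (fun i t => a i (sumn (map val t)) * weight (map val t))) /=.
rewrite (eq_bigr (fun i : 'I_N.+1 => a i (n - i)%N * comp_sum N k (n - i)%N)); last first.
  move=> i _; rewrite /comp_sum mulr_sumr; apply: eq_bigr => t /andP[_ /eqP->].
  by [].
rewrite -(big_mkord (fun i => 0 < i <= n)%N (fun i => a i (n - i)%N * comp_sum N k (n - i)%N)).
rewrite -(big_mkord predT (fun p => a (n - p)%N p * comp_sum N k p)).
rewrite (big_cat_nat (leq0n n.+1)) ?ltnS //= [X in _ + X]big1_seq ?addr0; last first.
  by move=> i /andP[/andP[_ +]]; rewrite mem_index_iota => le /andP[lt _]; move: le; rewrite leqNgt lt.
rewrite big_ltn_cond //= big_add1 /= [RHS]big_nat_rev /= add0n.
rewrite big_nat_cond [RHS]big_nat_cond; apply: eq_big => i.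
  by case: (ltnP i n).
by move=> /andP[/andP[_ lt] _]; rewrite subKn.
Qed.

Lemma comp_sumE n k : comp_sum n k n =
  \sum_(alpha : k.-tuple 'I_n.+1 | composition alpha)
    \prod_(1 <= j < k.+1) a (part alpha j) (tail_sum alpha j).
Proof.
apply: eq_big => [t|t _]; first by rewrite compositionE.
rewrite weightE size_map size_tuple big_add1 big_mkord; apply: eq_bigr => j _.
by rewrite partE tail_sumE.
Qed.

Variables (s : nat -> V) (N : nat).
Hypotheses (s0 : s 0 = 1)
  (sS : forall n, (0 < n <= N)%N -> s n = - \sum_(p < n) a (n - p)%N p * s p).

Lemma comp_sum_rec M n : (n <= N)%N -> (n < M)%N ->
  s n = \sum_(k < M) (-1) ^+ k *: comp_sum N k n.
Proof.
elim: M n => // M IH n nN nM; rewrite big_ord_recl expr0 scale1r comp_sum0.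
have [->|n0] := posnP n.
  rewrite s0 big1 ?addr0 // => k _.
  by rewrite comp_sumS // big_ord0 scaler0.
rewrite add0r sS ?n0 //.
have step (k : 'I_M) : (-1) ^+ lift ord0 k *: comp_sum N (lift ord0 k) n =
   - \sum_(p < n) a (n - p)%N p * ((-1) ^+ k *: comp_sum N k p).
  rewrite lift0 exprS mulN1r scaleNr comp_sumS // scaler_sumr; congr (- _).
  by apply: eq_bigr => p _; rewrite scalerAr.
rewrite (eq_bigr _ (fun k _ => step k)) sumrN exchange_big /=; congr (- _).
apply: eq_bigr => p _; rewrite -mulr_sumr IH //; first by apply: leq_trans nN; apply: ltnW.
exact: leq_trans (ltn_ord p) nM.
Qed.


Lemma composition_rec : (0 < N)%N ->
  s N = \sum_(1 <= k < N.+1) (-1) ^+ k *: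
    \sum_(alpha : k.-tuple 'I_N.+1 | composition alpha)
      \prod_(1 <= j < k.+1) a (part alpha j) (tail_sum alpha j).
Proof.
move=> N0; rewrite (@comp_sum_rec N.+1 N) // big_ord_recl comp_sum0.
rewrite -[N == _]negbK -lt0n N0 scaler0 add0r big_add1 big_mkord.
by apply: eq_bigr => k _; rewrite comp_sumE.
Qed.

End Compositions.

(** * Corollas *)

Section Corolla.
Variable n : nat.
Implicit Types (i j s t : 'I_n.+1) (C X : {set chord n}) (f : {set 'I_n.+1}).

Lemma side_under_spoke i s : side_under [set i; ord0] s = (s < i)%N.
Proof. by rewrite side_under2 /=; lia. Qed.

Lemma spoke_inj i j : [set i; ord0] = [set j; ord0] :> chord n -> i = j.
Proof.
move/setP => h; apply: val_inj => /=; have := h i; have := h j.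
rewrite !inE !eqxx /= -!val_eqE /=; lia.
Qed.

Lemma mem_corolla i : ([set i; ord0] \in corolla n) = (i != ord0).
Proof.
apply/imsetP/idP => [[j + /spoke_inj->]|i0]; first by rewrite inE.
by exists i; rewrite ?inE.
Qed.

Lemma corollaP c : reflect (exists2 i, i != ord0 & c = [set i; ord0]) (c \in corolla n).
Proof.
by apply: (iffP imsetP) => -[i]; [rewrite inE => ? ->|move=> ? ->]; exists i; rewrite ?inE.
Qed.

Lemma corolla_system : system setT (corolla n).
Proof.
split.
- move=> c /corollaP[i i0 ->]; exists ord0, i; rewrite setUC; split=> //.
  by rewrite /= lt0n; move: i0; rewrite -val_eqE.
- move=> _ _ s t r /corollaP[i _ ->] /corollaP[j _ ->]; rewrite !side_under_spoke; lia.
(* Spoke i is the only one between the sides i - 1 and i. *)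
- move=> _ /corollaP[i i0 ->]; have lt : (i.-1 < n.+1)%N by have := ltn_ord i; lia.
  exists (Ordinal lt), i; rewrite !inE; split=> //; move: i0; rewrite -val_eqE /= => i0.
  split=> [|_ /corollaP[j _ ->]]; rewrite /sep !side_under_spoke /=; first by lia.
  by move=> h; congr [set _; _]; apply: val_inj => /=; lia.
- move=> s t _ _; rewrite -val_eqE neq_ltn /= => /orP[]lt.
    exists [set t; ord0]; first by rewrite mem_corolla -val_eqE /=; lia.
    by rewrite /sep !side_under_spoke lt ltnn.
  exists [set s; ord0]; first by rewrite mem_corolla -val_eqE /=; lia.
  by rewrite /sep !side_under_spoke lt ltnn.
- by exists ord0; rewrite inE.
Qed.

Lemma corolla_diagram : is_diagram (corolla n).
Proof. exact: system_diagram corolla_system. Qed.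

Lemma card_corolla : #|corolla n| = n.
Proof. by case/andP: corolla_diagram => /eqP. Qed.

End Corolla.

(** The root goes to the root, so spokes remain spokes, and counting shows that all of them are
    obtained. *)
Lemma contr_corolla n m (Sd : {set 'I_n.+1}) (X : {set chord n}) :
  X \subset corolla n -> system Sd X -> #|Sd| = m.+1 -> contr m Sd X = corolla m.
Proof.
move=> /subsetP XC sysX cS; have sysX' := contr_system sysX cS.
apply/eqP; rewrite eqEcard card_corolla.
have cX : #|contr m Sd X| = m.
  by have := system_card sysX'; rewrite cardsT card_ord => -[].
rewrite cX leqnn andbT; apply/subsetP => d /[dup] dX /imsetP[c /XC /corollaP[i _ ->]].
rewrite contract_chord2 contract_vertex0 => ed; rewrite ed mem_corolla.
apply/eqP => i0; have [a [b [ab]]] := system_segment sysX' dX.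
rewrite ed i0 setUid => /setP eab; have := eab a; have := eab b.
rewrite !inE !eqxx orbT /= => /eqP eb /eqP ea; move: ab; rewrite ea eb.
by [].
Qed.

Section CorollaRecursion.
Variables (K : fieldType) (x : K) (S : {linear HD K -> HD K}).
Hypothesis antipodeS : is_antipode x S.

Lemma corolla_rdiag n (C : {set chord n}) : C \subset corolla n ->
  rdiag C = corolla #|C|.
Proof.
move=> CA; rewrite rdiagE; have sysA := corolla_system n.
exact: contr_corolla CA (mins_system sysA CA) (card_mins sysA CA).
Qed.

Lemma corolla_qH n (C : {set chord n}) : C \subset corolla n ->
  qH K (corolla n) C = \prod_(f in faces C) corH K #|f|.-1.
Proof.
move=> CA; have sysA := corolla_system n; apply: eq_bigr => f fC.
rewrite (qface_contr sysA CA fC (subxx _)); congr diag.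
apply: contr_corolla; first by apply: subset_trans (inside_sub _ _) (subsetDl _ _).
  exact: (face_system sysA CA fC).
by rewrite (card_face sysA CA fC).
Qed.

(** The arc of a spoke starts at vertex 0, which no side precedes, so a spoke is never forward. *)
Lemma corolla_kdiag n (C : {set chord n}) : C \subset corolla n ->
  kdiag (corolla n) C = 0%N.
Proof.
move=> CA; rewrite (kdiagE (corolla_system n) CA); apply/eqP; rewrite cards_eq0.
apply/eqP/setP => e; rewrite !inE; apply/negP => /and3P[/(subsetP CA)/corollaP[i _ ->] _].
by case/forwardP=> s [t [[_ _ ts]]]; rewrite !side_under_spoke => -[]; clear -ts; lia.
Qed.

Lemma corolla_rec n : (0 < n)%N -> S (corH K n) =
  - \sum_(C : {set chord n} | C \proper corolla n)
      (\prod_(f in faces C) corH K #|f|.-1) * S (corH K #|C|).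
Proof.
move=> n0; rewrite /corH (antipode_diag_rec antipodeS n0 (corolla_diagram n)).
apply: (congr1 -%R); apply: eq_bigr => C /proper_sub CA.
by rewrite (corolla_kdiag CA) expr0 scale1r (corolla_qH CA) /rH (corolla_rdiag CA).
Qed.

End CorollaRecursion.

(** * Sets of spokes and the sizes of their faces *)

Section Gaps.
Variable n : nat.
Implicit Types (i j s t : 'I_n.+1) (C : {set chord n}).

(* The faces cut out by a set of spokes C are the level sets of rank C. *)
Definition rank C t := #|[set c in C | ~~ side_under c t]|.

Definition level C m := [set t | rank C t == m].

Lemma rank_le C t : (rank C t <= #|C|)%N.
Proof. by apply/subset_leq_card/subsetP => c; rewrite inE => /andP[]. Qed.

Section Spokes.
Variable C : {set chord n}.
Hypothesis CA : C \subset corolla n.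

Lemma rank_sub s t : (s <= t)%N ->
  [set c in C | ~~ side_under c s] \subset [set c in C | ~~ side_under c t].
Proof.
move=> st; apply/subsetP => c; rewrite !inE => /andP[cC].
have /corollaP[i _ ec] := subsetP CA _ cC.
by rewrite cC ec !side_under_spoke -!leqNgt => is_; apply: leq_trans st.
Qed.

Lemma rank_mono s t : (s <= t)%N -> (rank C s <= rank C t)%N.
Proof. by move=> st; apply/subset_leq_card/rank_sub. Qed.

Lemma joined_rank s t : joined C s t = (rank C s == rank C t).
Proof.
wlog st : s t / (s <= t)%N => [W|].
  by case/orP: (leq_total s t) => st; [|rewrite joined_sym eq_sym]; apply: W.
apply/joinedP/eqP => [h|e c cC].
  apply: eq_card => c; rewrite !inE; case cC: (c \in C) => //=.
  by have := h c cC; rewrite /sep; do 2!case: (side_under _ _).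
have /eqP/setP/(_ c) : [set c in C | ~~ side_under c s] == [set c in C | ~~ side_under c t].
  by rewrite eqEcard rank_sub // -/(rank C s) -/(rank C t) e leqnn.
by rewrite !inE cC /sep; do 2!case: (side_under _ _).
Qed.

Let M := mins setT C.
Let phi t : 'I_#|C|.+1 := inord (rank C t).

Let phiE t : phi t = rank C t :> nat.
Proof. by rewrite inordK // ltnS rank_le. Qed.

Let phi_inj : {in M &, injective phi}.
Proof.
move=> s t sM tM e; apply: (mins_uniq sM tM).
by rewrite joined_rank -!phiE e.
Qed.

(** The #|C| + 1 minimal sides have distinct ranks, so all the ranks 0, ..., #|C| occur. *)
Let phi_M : phi @: M = setT.
Proof.
apply/eqP; rewrite eqEcard subsetT cardsT card_ord card_in_imset //.
by rewrite /= /M (card_mins (corolla_system n) CA).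
Qed.

Let level_phi s : level C (phi s) = cls C s.
Proof. by apply/setP => t; rewrite !inE joined_rank phiE eq_sym. Qed.

Lemma prod_faces (V : comNzRingType) (g : nat -> V) :
  \prod_(f in faces C) g #|f|.-1 = \prod_(m < #|C|.+1) g #|level C m|.-1.
Proof.
have -> : \prod_(m < #|C|.+1) g #|level C m|.-1 =
    \prod_(m in [set: 'I_#|C|.+1]) g #|level C m|.-1.
  by apply: eq_bigl => m; rewrite inE.
rewrite -phi_M [RHS]big_imset // (_ : faces C = cls C @: M); last first.
  rewrite faces_cls; apply/setP => f; apply/imsetP/imsetP => -[s sM ->]; last by exists s; rewrite ?inE.
  have [t [tM st _]] := mins_ex C sM; exists t => //.
  apply/setP => r; rewrite !inE; apply/idP/idP; apply: joined_trans => //.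
  by rewrite joined_sym.
rewrite big_imset => [|s t sM tM /setP/(_ t)]; last first.
  by rewrite !inE joined_refl => /(mins_uniq sM tM).
by apply: eq_bigr => s _; rewrite level_phi.
Qed.

Lemma level_gt0 m : (m < #|C|.+1)%N -> (0 < #|level C m|)%N.
Proof.
move=> lt; have : Ordinal lt \in phi @: M by rewrite phi_M inE.
case/imsetP=> s _ /(congr1 val) /= ->; rewrite level_phi card_gt0.
by apply/set0Pn; exists s; rewrite inE joined_refl.
Qed.

Lemma sum_levels : (\sum_(m < #|C|.+1) #|level C m| = n.+1)%N.
Proof.
rewrite -[RHS]card_ord -[RHS]sum1_card (partition_big phi predT) //=.
apply: eq_bigr => m _; rewrite -sum1_card; apply: eq_bigl => t.
by rewrite inE -(phiE t).
Qed.

Lemma sum_gaps : (\sum_(m < #|C|.+1) #|level C m|.-1 = n - #|C|)%N.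
Proof.
have : (\sum_(m < #|C|.+1) #|level C m| =
    \sum_(m < #|C|.+1) #|level C m|.-1 + #|C|.+1)%N.
  rewrite -[X in (_ + X)%N]card_ord -[X in (_ + X)%N]sum1_card -big_split.
  by apply: eq_bigr => m _; rewrite /= addn1 prednK // level_gt0.
rewrite sum_levels; lia.
Qed.

(** The rank is monotone, so the sides of rank less than m form an initial segment, whose length is
    a sum of level sizes. The level sizes therefore determine the rank. *)
Lemma rank_lt t m : (m <= #|C|)%N ->
  (rank C t < m)%N = (t < \sum_(l < m) #|level C l|)%N.
Proof.
move=> mC; have -> : (\sum_(l < m) #|level C l| = #|[set s | rank C s < m]|)%N.
  elim: m mC => [|m IH] mC.
    by rewrite big_ord0; apply/esym/eqP; rewrite cards_eq0; apply/eqP/setP => s; rewrite !inE.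
  rewrite big_ord_recr /= IH 1?ltnW // -cardsUI [X in (_ + X)%N](_ : _ = 0%N) ?addn0.
    by apply: eq_card => s; rewrite !inE [in RHS]ltnS [in RHS]leq_eqVlt orbC.
  by apply/eqP; rewrite cards_eq0; apply/eqP/setP => s; rewrite !inE; case: ltngtP.
have cardlt k : (k <= n.+1)%N -> #|[set s : 'I_n.+1 | (s < k)%N]| = k.
  move=> kn; rewrite -[RHS]card_ord -(card_imset _ (_ : injective (widen_ord kn))).
    apply: eq_card => i; rewrite !inE; apply/idP/imsetP => [ik|[j _ ->]] //=.
    by exists (Ordinal ik) => //; apply: val_inj.
  by move=> i j /(congr1 val) /= /val_inj.
apply/idP/idP => h.
  rewrite -[X in (X < _)%N](cardlt _ (ltnW (ltn_ord t))).
  apply: proper_card; apply/properP; split; last by exists t; rewrite !inE ?ltnn.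
  by apply/subsetP => s; rewrite !inE => /ltnW/rank_mono/leq_ltn_trans; apply.
rewrite ltnNge; apply: contraL h => h; rewrite -leqNgt.
rewrite -[X in (_ <= X)%N](cardlt _ (ltnW (ltn_ord t))).
apply/subset_leq_card/subsetP => s; rewrite !inE => h'.
by rewrite ltnNge; apply: contraL h' => /rank_mono h'; rewrite -leqNgt (leq_trans h).
Qed.

(** The rank increases exactly where a spoke of C is passed, so C can be recovered from it. *)
Lemma mem_spoke i : i != ord0 ->
  ([set i; ord0] \in C) = [exists s : 'I_n.+1, (s.+1 == i :> nat) && (rank C s < rank C i)%N].
Proof.
move=> i0; apply/idP/existsP => [iC|[s /andP[/eqP si]]].
  have lt : (i.-1 < n.+1)%N by have := ltn_ord i; lia.
  have i1 : (0 < i)%N by rewrite lt0n; move: i0; rewrite -val_eqE.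
  exists (Ordinal lt); rewrite /= prednK // eqxx /=; apply: proper_card; apply/properP.
  split; first by apply: rank_sub; rewrite /= leq_pred.
  by exists [set i; ord0]; rewrite !inE iC side_under_spoke /=; lia.
apply: contraLR => iC; rewrite -leqNgt; apply/subset_leq_card/subsetP => c.
rewrite !inE => /andP[cC]; rewrite cC; have /corollaP[j _ ec] := subsetP CA _ cC.
rewrite ec !side_under_spoke -!leqNgt => ji.
rewrite -ltnS si ltn_neqAle ji andbT; apply: contraNneq iC => /val_inj <-.
by rewrite -ec.
Qed.

End Spokes.

Lemma levels_inj C C' : C \subset corolla n -> C' \subset corolla n -> #|C| = #|C'| ->
  (forall m, (m <= #|C|)%N -> #|level C m| = #|level C' m|) -> C = C'.
Proof.
move=> CA CA' cC e.
have rlt t m : (m <= #|C|)%N -> (rank C t < m)%N = (rank C' t < m)%N.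
  move=> mC; rewrite !rank_lt -?cC //; congr (_ < _)%N; apply: eq_bigr => l _.
  by apply: e; apply: leq_trans mC; apply: ltnW.
have r t : rank C t = rank C' t.
  have h := rlt t (rank C t) (rank_le C t).
  have := rlt t (rank C' t); rewrite cC => /(_ (rank_le C' t)) h'.
  by apply/eqP; move: h h'; rewrite !ltnn; case: ltngtP.
apply/setP => c; case cA: (c \in corolla n); last first.
  by apply/idP/idP => h; move: cA; rewrite ?(subsetP CA _ h) ?(subsetP CA' _ h).
have /corollaP[i i0 ->] := cA; rewrite !mem_spoke //.
by apply: eq_existsb => s; rewrite !r.
Qed.

(** No entry exceeds the sum q, so the sequences embed into those bounded by q, which are counted by
    the binomial coefficient. *)
Lemma card_bounded_sums N p q :
  (#|[set i : {ffun 'I_p.+1 -> 'I_N.+1} | \sum_m i m == q]| <= 'C(p + q, p))%N.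
Proof.
rewrite -card_ord_partitions.
pose h (i : {ffun 'I_p.+1 -> 'I_N.+1}) : p.+1.-tuple 'I_q.+1 := [tuple inord (i m) | m < p.+1].
have le (i : {ffun 'I_p.+1 -> 'I_N.+1}) m : (\sum_m i m)%N = q -> (i m <= q)%N.
  by move=> <-; rewrite (bigD1 m) //= leq_addr.
rewrite -(card_in_imset (f := h)) => [|i j]; last first.
  rewrite !inE => /eqP si /eqP sj e; apply/ffunP => m; apply: val_inj => /=.
  have := congr1 (fun v : p.+1.-tuple 'I_q.+1 => val (tnth v m)) e.
  by rewrite /= !tnth_mktuple !inordK // ltnS le.
apply/subset_leq_card/subsetP => t /imsetP[i]; rewrite inE => /eqP si ->.
rewrite inE big_tuple; apply/eqP; rewrite -[RHS]si; apply: eq_bigr => m _.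
by rewrite tnth_mktuple inordK // ltnS le.
Qed.

(** A set of p spokes is encoded by the degrees of its p + 1 faces in increasing order of rank. The
    encoding is injective by [levels_inj], and surjective because there are at most as many
    sequences as sets of p spokes. *)
Lemma sum_spokes (V : comNzRingType) (g : nat -> V) N p : (n <= N)%N -> (p <= n)%N ->
  \sum_(C : {set chord n} | (C \subset corolla n) && (#|C| == p))
     \prod_(f in faces C) g #|f|.-1 =
  \sum_(i : {ffun 'I_p.+1 -> 'I_N.+1} | (\sum_m i m == n - p)%N) \prod_m g (i m).
Proof.
move=> nN pn; pose D := [set C : {set chord n} | (C \subset corolla n) && (#|C| == p)].
pose G (C : {set chord n}) := [ffun m : 'I_p.+1 => inord #|level C m|.-1 : 'I_N.+1].
have GE C m : G C m = #|level C m|.-1 :> nat.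
  rewrite ffunE inordK // ltnS (leq_trans _ nN) // -ltnS.
  rewrite (@leq_ltn_trans #|'I_n.+1|.-1) ?card_ord // -!subn1 leq_sub2r //.
  by rewrite -[X in (_ <= X)%N]card_ord max_card.
have Ginj : {in D &, injective G}.
  move=> C C' /setIdP[CA /eqP cC] /setIdP[CA' /eqP cC'] e.
  apply: levels_inj => //; rewrite ?cC // => m mp.
  have := congr1 (fun f : {ffun 'I_p.+1 -> 'I_N.+1} => val (f (Ordinal (mp : m < p.+1)%N))) e.
  rewrite /= !GE /=; have := level_gt0 CA (_ : m < #|C|.+1)%N; have := level_gt0 CA' (_ : m < #|C'|.+1)%N.
  rewrite cC cC' ltnS => /(_ mp) h /(_ mp) h' e'.
  by rewrite -[LHS](prednK h') -[RHS](prednK h) e'.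
have GD : G @: D = [set i : {ffun 'I_p.+1 -> 'I_N.+1} | (\sum_m i m == n - p)%N].
  apply/eqP; rewrite eqEcard card_in_imset //; apply/andP; split.
    apply/subsetP => _ /imsetP[C /setIdP[CA /eqP cC] ->]; rewrite inE; apply/eqP.
    by under eq_bigr => m _ do rewrite GE; rewrite -cC sum_gaps.
  apply: leq_trans (card_bounded_sums _ _ _) _; rewrite subnKC //.
  by rewrite cards_draws card_corolla.
transitivity (\sum_(C in D) \prod_(f in faces C) g #|f|.-1).
  by apply: eq_bigl => C; rewrite inE.
transitivity (\sum_(i in G @: D) \prod_m g (i m)); last first.
  by apply: eq_bigl => i; rewrite GD inE.
rewrite [RHS]big_imset //=; apply: eq_bigr => C /setIdP[CA /eqP cC].
by rewrite prod_faces // cC; apply: eq_bigr => m _; rewrite GE.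
Qed.

End Gaps.

Lemma big_by_value (V : nmodType) (T : finType) (P : pred T) (h : T -> nat) n (F : T -> V) :
  (forall t, P t -> h t < n)%N ->
  \sum_(t | P t) F t = \sum_(p < n) \sum_(t | P t && (h t == p)) F t.
Proof.
move=> hn; rewrite (exchange_big_dep P) /=; last by move=> p t _ /andP[].
apply: eq_bigr => t Pt; rewrite (big_pred1 (Ordinal (hn t Pt))) // => p.
by rewrite Pt /= eq_sym; apply/eqP/eqP => [e|-> //]; apply: val_inj.
Qed.

(** The rows of the arrays have different lengths, so distributivity is needed for index types
    varying with i. It is obtained for [fprod] and transported to dependent finite functions. *)
Lemma bigA_distr_dffun (R : comNzRingType) (I : finType) (T_ : I -> finType)
    (F : forall i, T_ i -> R) :
  \prod_(i : I) \sum_(t : T_ i) F i t =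
  \sum_(f : {dffun forall i, T_ i}) \prod_(i : I) F i (f i).
Proof.
pose P_ i : {ffun T_ i -> R} := [ffun t => F i t].
have -> : \prod_(i : I) \sum_(t : T_ i) F i t =
    \prod_(i : I) \sum_(j in tagged_with T_ i) untag 0 (P_ i) j.
  apply: eq_bigr => i _; rewrite -(big_tag (fun i t => P_ i t)).
  by apply: eq_bigr => t _; rewrite ffunE.
rewrite (bigA_distr_big_dep (fun i j => j \in tagged_with T_ i)).
have := @big_fprod R 0 1 *%R +%R I T_ P_.
rewrite /= => e; transitivity (\sum_(t : fprod T_) \prod_(i in I) P_ i (t i)).
  by rewrite e; apply: eq_bigl => g; apply/familyP/familyP.
rewrite (reindex (@fprod_of_dffun I T_)); last exact/onW_bij/fprod_of_dffun_bij.
apply: eq_bigr => f _; apply: eq_bigr => i _; rewrite ffunE; congr F.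
by have := congr1 (fun h : {dffun forall i, T_ i} => h i) (fprod_of_dffunK f); rewrite ffunE.
Qed.

Lemma bigA_distr_dffun_cond (R : comNzRingType) (I : finType) (T_ : I -> finType)
    (Q : forall i, pred (T_ i)) (F : forall i, T_ i -> R) :
  \prod_(i : I) \sum_(t : T_ i | Q i t) F i t =
  \sum_(f : {dffun forall i, T_ i} | [forall i, Q i (f i)]) \prod_(i : I) F i (f i).
Proof.
under eq_bigr => i _ do rewrite big_mkcond.
rewrite bigA_distr_dffun [RHS]big_mkcond; apply: eq_bigr => f _.
case: forallP => [h|/forallP]; first by apply: eq_bigr => i _; rewrite h.
by rewrite negb_forall => /existsP[i /negPf h]; rewrite (bigD1 i) //= h mul0r.
Qed.

Section SpokeSums.
Variables (V : comNzRingType) (g : nat -> V).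

(** For g = [corH K], the coefficient a(q, p) of the corollas: by [sum_spokes], the contribution of
    the sets of p spokes of X_{q + p}. *)
Definition spoke_sum N q p : V :=
  \sum_(i : {ffun 'I_p.+1 -> 'I_N.+1} | (\sum_m i m == q)%N) \prod_m g (i m).

Lemma spoke_sum0 N q : (q <= N)%N -> spoke_sum N q 0 = g q.
Proof.
move=> qN; rewrite /spoke_sum (big_pred1 [ffun _ => inord q : 'I_N.+1]) => [|i].
  by rewrite big_ord1 ffunE inordK.
rewrite big_ord1; apply/eqP/eqP => [e|->]; last by rewrite ffunE inordK.
by apply/ffunP => m; rewrite ffunE ord1; apply: val_inj; rewrite /= -e inordK.
Qed.

(** The factor j = k has an empty tail, hence a single entry, equal to alpha_k; the other k - 1
    factors are distributed into a sum over arrays. *)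
Lemma prod_spoke_sum n k (alpha : k.-tuple 'I_n.+1) : (0 < k)%N ->
  \prod_(1 <= j < k.+1) spoke_sum n (part alpha j) (tail_sum alpha j) =
  \sum_(i : array alpha |
         [forall j : 'I_k.-1, (\sum_m i j m)%N == part alpha j.+1])
    g (part alpha k) * \prod_(j < k.-1) \prod_m g (i j m).
Proof.
case: k alpha => // k alpha _; rewrite -mulr_sumr big_nat_recr //= mulrC.
rewrite tail_sumE drop_oversize ?size_map ?size_tuple //= spoke_sum0; last first.
  by rewrite /part -ltnS.
congr (_ * _); rewrite big_add1 /= big_mkord.
exact: (@bigA_distr_dffun_cond V 'I_k
  (fun j => {ffun 'I_(tail_sum alpha j.+1).+1 -> 'I_n.+1} : finType)
  (fun j i => (\sum_m i m == part alpha j.+1)%N) (fun j i => \prod_m g (i m))).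
Qed.

End SpokeSums.

Section CorollaFormula.
Variables (K : fieldType) (x : K) (S : {linear HD K -> HD K}).
Hypothesis antipodeS : is_antipode x S.

Lemma corolla_rec_sum N n : (0 < n <= N)%N ->
  S (corH K n) = - \sum_(p < n) spoke_sum (corH K) N (n - p)%N p * S (corH K p).
Proof.
case/andP=> n0 nN; rewrite (corolla_rec antipodeS n0); apply: (congr1 -%R).
rewrite (big_by_value (h := fun C : {set chord n} => #|C|) (n := n)); last first.
  by move=> C /proper_card; rewrite card_corolla.
apply: eq_bigr => p _; rewrite /spoke_sum.
rewrite -(@sum_spokes n (HD K) (corH K) N p nN (ltnW (ltn_ord p))) mulr_suml.
apply: eq_big => [C|C /andP[_ /eqP->]] //.
rewrite properEcard card_corolla; case: eqP => [->|]; rewrite ?andbF // ltn_ord !andbT.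
by [].
Qed.

Lemma corolla_antipode n : (0 < n)%N ->
  S (corH K n) =
    \sum_(1 <= k < n.+1) (-1) ^+ k *:
      \sum_(alpha : k.-tuple 'I_n.+1 | composition alpha)
        \sum_(i : array alpha |
                [forall j : 'I_k.-1, (\sum_m i j m)%N == part alpha j.+1])
           corH K (part alpha k) * \prod_(j < k.-1) \prod_m corH K (i j m).
Proof.
move=> n0; have s0 : S (corH K 0) = 1 by apply: antipode1 antipodeS.
have E := @composition_rec K (HD K) (spoke_sum (corH K) n) (fun n => S (corH K n)) n s0
  (fun m h => corolla_rec_sum h) n0.
rewrite [LHS]E {E}; apply: eq_big_nat => k /andP[k0 _].
apply: (congr1 ( *:%R _)); apply: eq_bigr => alpha _.
exact: prod_spoke_sum.
Qed.

End CorollaFormula.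

(** * Path trees *)

Lemma under_segment n (c : chord n) : is_segment c -> side_under c ord_max = false.
Proof. by case=> [a [b [_ ->]]]; rewrite side_under2 /=; have := ltn_ord a; have := ltn_ord b; lia. Qed.

Lemma sep_inj n (c d : chord n) : is_segment c -> is_segment d ->
  (forall s t, sep c s t = sep d s t) -> c = d.
Proof.
move=> sc sd h; apply: under_inj => //; apply/setP => s; rewrite !inE.
by have := h s ord_max; rewrite /sep !under_segment // !addbF.
Qed.

Section PathTree.
Variable n : nat.
Implicit Types (i j s t : 'I_n.+1) (C X : {set chord n}) (f : {set 'I_n.+1}).

Definition link i : chord n := [set i; ordS i].

Lemma side_under_link i s : i != ord0 ->
  side_under (link i) s = if i == ord_max then (s < n)%N else s == i.
Proof.
rewrite -!val_eqE /= => i0; rewrite side_under2 /=; have := ltn_ord i; have := ltn_ord s.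
case: eqP => [->|ni] sn lt; first by rewrite modnn; lia.
rewrite modn_small; last by lia.
by apply/idP/eqP; lia.
Qed.

(** A link cuts off one side: for i < n side i is the only one under it, for i = n the only one not
    under it. *)
Lemma sep_link i s t : i != ord0 -> sep (link i) s t = (s == i) (+) (t == i).
Proof.
move=> i0; rewrite /sep !side_under_link //; case: eqP => // ->.
have E (r : 'I_n.+1) : (r < n)%N = (r != ord_max).
  by rewrite -val_eqE /=; have := ltn_ord r; lia.
by rewrite !E; do 2!case: (_ == ord_max).
Qed.

Lemma link_segment i : i != ord0 -> is_segment (link i).
Proof.
rewrite -val_eqE /= => i0; have lt := ltn_ord i.
case: (ltnP i n) => h.
  exists i, (ordS i); split=> //; rewrite /= modn_small; lia.
exists (ordS i), i; rewrite /link setUC; split=> //=.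
have -> : i = n :> nat by lia.
by rewrite modnn; lia.
Qed.

Lemma link_inj : {in predC1 ord0 &, injective link}.
Proof.
move=> i j i0 j0 e; have := sep_link i ord0 j0; rewrite -e sep_link // eqxx.
by rewrite !(eq_sym ord0) (negPf (i0 : i != ord0)) (negPf (j0 : j != ord0)) !addbF => /esym/eqP.
Qed.

Lemma pathP c : reflect (exists2 i, i != ord0 & c = link i) (c \in path_tree n).
Proof.
by apply: (iffP imsetP) => -[i]; [rewrite inE => ? ->|move=> ? ->]; exists i; rewrite ?inE.
Qed.

Lemma mem_path i : i != ord0 -> link i \in path_tree n.
Proof. by move=> i0; apply/pathP; exists i. Qed.

Lemma path_system : system setT (path_tree n).
Proof.
split.
- by move=> c /pathP[i i0 ->]; apply: link_segment.
- move=> _ _ s t r /pathP[i i0 ->] /pathP[j j0 ->]; rewrite !side_under_link //.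
  rewrite -!val_eqE /=; clear; have := ltn_ord s; have := ltn_ord t; have := ltn_ord r.
  by case: ifP; case: ifP; lia.
- move=> _ /pathP[i i0 ->]; exists i, ord0; rewrite !inE; split=> //; split.
    by rewrite sep_link // eqxx eq_sym (negPf i0).
  by move=> _ /pathP[j j0 ->]; rewrite sep_link // (eq_sym ord0) (negPf j0) addbF => /eqP->.
- move=> s t _ _ st; have [s0|s0] := eqVneq s ord0.
    have t0 : t != ord0 by rewrite -s0 eq_sym.
    by exists (link t); [apply: mem_path|rewrite sep_link // eqxx (negPf st)].
  by exists (link s); [apply: mem_path|rewrite sep_link // eqxx eq_sym (negPf st)].
- by exists ord0; rewrite inE.
Qed.

Lemma path_diagram : is_diagram (path_tree n).
Proof. exact: system_diagram path_system. Qed.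

Lemma card_path : #|path_tree n| = n.
Proof. by case/andP: path_diagram => /eqP. Qed.

Lemma joined_links C s t : C \subset path_tree n ->
  reflect (forall i, i != ord0 -> link i \in C -> (s == i) = (t == i)) (joined C s t).
Proof.
move=> /subsetP CA; apply: (iffP (joinedP _ _ _)) => [h i i0 iC|h c cC].
  by have := h _ iC; rewrite sep_link //; do 2!case: (_ == i).
have /pathP[i i0 ec] := CA _ cC; rewrite ec sep_link //.
by rewrite (h i i0) ?addbb // -ec.
Qed.

Lemma cls_link C i : C \subset path_tree n -> i != ord0 -> link i \in C -> cls C i = [set i].
Proof.
move=> CA i0 iC; apply/setP => t; rewrite !inE; apply/idP/eqP => [|->]; last exact: joined_refl.
by move/(joined_links _ _ CA)/(_ i i0 iC); rewrite eqxx => /esym/eqP.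
Qed.

End PathTree.

(** Cutting off one kept side is preserved by contraction, and a chord is determined by the sides it
    separates, so links go to links; counting gives equality. *)
Lemma contr_path n m (Sd : {set 'I_n.+1}) (X : {set chord n}) :
  X \subset path_tree n -> system Sd X -> #|Sd| = m.+1 -> ord0 \in Sd ->
  (forall i, i != ord0 -> link i \in X -> i \in Sd) -> contr m Sd X = path_tree m.
Proof.
move=> /subsetP XC sysX cS S0 XS; have sysX' := contr_system sysX cS.
apply/eqP; rewrite eqEcard card_path.
have cX : #|contr m Sd X| = m.
  by have := system_card sysX'; rewrite cardsT card_ord => -[].
rewrite cX leqnn andbT; apply/subsetP => d /[dup] dX /imsetP[c cX' ed].
have /pathP[i i0 ec] := XC _ cX'; rewrite ec in cX' ed.
have iS := XS i i0 cX'.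
have i0' : contract_vertex m Sd i != ord0.
  apply: contra i0 => /eqP e; apply/eqP/(contract_inj cS iS S0).
  by rewrite e contract_vertex0.
suff -> : d = link (contract_vertex m Sd i) by apply: mem_path.
apply: sep_inj; [exact: system_segment sysX' _ dX|exact: link_segment|].
move=> s' t'; have [s sS <-] := contract_surj cS s'; have [t tS <-] := contract_surj cS t'.
rewrite ed sep_contract // ?sep_link //; last exact: link_segment.
by rewrite !(inj_in_eq (contract_inj cS)).
Qed.

Section PathRecursion.
Variables (K : fieldType) (x : K) (S : {linear HD K -> HD K}).
Hypothesis antipodeS : is_antipode x S.

Lemma path_rdiag n (C : {set chord n}) : C \subset path_tree n ->
  rdiag C = path_tree #|C|.
Proof.
move=> CA; rewrite rdiagE; have sysA := path_system n.
apply: (contr_path CA (mins_system sysA CA) (card_mins sysA CA)).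
  by apply/minsP; split=> [|t _ _]; rewrite ?inE.
move=> i i0 iC; apply/minsP; split=> [|t _ it]; first by rewrite inE.
have : t \in cls C i by rewrite inE.
by rewrite (cls_link CA i0 iC) inE => /eqP->.
Qed.

Lemma path_qface n (C : {set chord n}) : C \subset path_tree n ->
  qface C (cls C ord0) (path_tree n :\: C) = path_tree #|cls C ord0|.-1.
Proof.
move=> CA; have sysA := path_system n.
have fC : cls C ord0 \in faces C by apply/facesP; exists ord0.
rewrite (qface_contr sysA CA fC (subxx _)); apply: contr_path.
- by apply: subset_trans (inside_sub _ _) (subsetDl _ _).
- exact: (face_system sysA CA fC).
- by rewrite (card_face sysA CA fC).
- by rewrite inE joined_refl.
- move=> i i0 /insideP[_ [s [t [sf tf]]]]; rewrite sep_link //.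
  by case: eqP sf => [-> //|_ _]; case: eqP tf => [->|].
Qed.

Lemma card_cls0 n (C : {set chord n}) : C \subset path_tree n ->
  #|cls C ord0| = (n - #|C|).+1.
Proof.
move=> CA; pose I := [set i : 'I_n.+1 | (i != ord0) && (link i \in C)].
have -> : cls C ord0 = ~: I.
  apply/setP => t; rewrite !inE; apply/(joined_links _ _ CA)/idP => [h|h i i0 iC].
    apply/negP => /andP[t0 tC]; have := h t t0 tC.
    by rewrite eqxx eq_sym (negPf t0).
  rewrite eq_sym (negPf i0); apply/esym/eqP => ti; move: h; rewrite ti i0 iC.
  by [].
have eC : (@link n) @: I = C.
  apply/setP => c; apply/imsetP/idP => [[i]|cC]; first by rewrite inE => /andP[_ h] ->.
  have /pathP[i i0 ec] := subsetP CA _ cC; exists i => //.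
  by rewrite inE i0 -ec.
have cI : #|C| = #|I|.
  rewrite -eC card_in_imset // => i j; rewrite !inE => /andP[i0 _] /andP[j0 _].
  exact: link_inj.
have le : (#|C| <= n)%N by rewrite -[X in (_ <= X)%N](card_path n) subset_leq_card.
rewrite -subSn //; have := cardsC I; rewrite -cI card_ord => e.
by apply/eqP; rewrite -(eqn_add2l #|C|) subnKC ?e // ltnW.
Qed.

(** Each link of C cuts off a face with a single side, hence a factor of degree 0; the remaining
    links all lie in the face of side 0. *)
Lemma path_qH n (C : {set chord n}) : C \subset path_tree n ->
  qH K (path_tree n) C = pathH K (n - #|C|).
Proof.
move=> CA; rewrite /qH (bigD1 (cls C ord0)) /=; last by apply/facesP; exists ord0.
rewrite path_qface // card_cls0 // big1 ?mulr1 //.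
move=> f /andP[/facesP[s ->] ns]; apply: diag0.
suff [i i0 [iC ->]] : exists2 i, i != ord0 & link i \in C /\ cls C s = [set i].
  by rewrite cards1.
have : ~~ joined C ord0 s.
  apply: contra ns => j0; apply/eqP/setP => t; rewrite !inE.
  by apply/idP/idP; apply: joined_trans; rewrite // joined_sym.
rewrite negb_forall_in => /exists_inP[c cC]; rewrite negbK.
have /pathP[i i0 ec] := subsetP CA _ cC; rewrite ec in cC *.
rewrite sep_link // eq_sym (negPf i0) => /eqP si; exists i => //; split=> //.
by rewrite si cls_link.
Qed.

(** For i < n, link i is already forward in the whole tree, being the only one to separate the sides
    0 and i. Link n, whose arc starts at vertex 0, is never forward. *)
Lemma path_kdiag n (C : {set chord n}) : C \subset path_tree n ->
  kdiag (path_tree n) C = 0%N.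
Proof.
move=> CA; rewrite (kdiagE (path_system n) CA); apply/eqP; rewrite cards_eq0.
apply/eqP/setP => e; rewrite !inE; apply/negP => /and3P[/(subsetP CA)/pathP[i i0 ->]].
move=> /negP nf /forwardP[s [t [[_ _ ts] [si ti _]]]]; apply: nf; apply/forwardP.
exists i, ord0; rewrite !inE; split=> //.
  by move: i0; rewrite -val_eqE lt0n.
have ni : i != ord_max.
  apply: contraTneq ts => ei; move: si ti; rewrite !side_under_link // ei eqxx.
  by clear; lia.
rewrite !side_under_link // (negPf ni) eqxx eq_sym i0; split=> //; split.
  by rewrite sep_link // eqxx eq_sym (negPf i0).
by move=> _ /pathP[j j0 ->]; rewrite sep_link // (eq_sym ord0) (negPf j0) addbF => /eqP->.
Qed.

Lemma path_rec n : (0 < n)%N -> S (pathH K n) =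
  - \sum_(p < n) ('C(n, p)%:R *: pathH K (n - p)) * S (pathH K p).
Proof.
move=> n0; rewrite {1}/pathH (antipode_diag_rec antipodeS n0 (path_diagram n)).
apply: (congr1 -%R).
rewrite (big_by_value (h := fun C : {set chord n} => #|C|) (n := n)); last first.
  by move=> C /proper_card; rewrite card_path.
apply: eq_bigr => p _.
have E (C : {set chord n}) : (C \proper path_tree n) && (#|C| == p) =
    (C \in [set C : {set chord n} | (C \subset path_tree n) && (#|C| == p)]).
  rewrite inE properEcard card_path; case: eqP => [->|]; rewrite ?andbF // ltn_ord !andbT.
  by [].
rewrite (eq_bigl _ _ E) (eq_bigr (fun _ => pathH K (n - p) * S (pathH K p))); last first.
  move=> C; rewrite inE => /andP[CA /eqP cC].
  by rewrite (path_kdiag CA) expr0 scale1r (path_qH CA) /rH (path_rdiag CA) cC.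
by rewrite sumr_const cards_draws card_path -scaler_nat scalerAl.
Qed.

End PathRecursion.

(** * Partitions *)

(** Group the permutations by their first letter v and induct on [rem v s]; the multiplicities of
    the letters add up to the length of s. *)
Lemma size_permutationsE (T : finType) (s : seq T) :
  (size (permutations s) * \prod_(v : T) (count_mem v s)`! = (size s)`!)%N.
Proof.
have [N] := ubnP (size s); elim: N s => // N IH s sN.
have [/size0nil->|s0] := posnP (size s).
  by rewrite big1 => [|v _]; rewrite ?muln1.
rewrite (perm_size (permutationsE s0)) size_allpairs_dep sumnE big_map.
rewrite big_distrl /= [RHS](_ : _ = \sum_(v <- undup s) (size s).-1`! * count_mem v s)%N.
  apply: eq_big_seq => v; rewrite mem_undup => vs.
  have sv : size (rem v s) = (size s).-1 by rewrite size_rem.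
  have vr : (size (rem v s) < N)%N by rewrite sv; case: (size s) s0 sN.
  rewrite -sv -(IH _ vr) -mulnA; congr (_ * _)%N.
  rewrite (bigD1 v) // [in RHS](bigD1 v) //= [RHS]mulnAC.
  have cs w : count_mem w s = ((v == w) + count_mem w (rem v s))%N.
    by have /permP -> := perm_to_rem vs.
  rewrite !cs eqxx add1n factS [X in _ = (X * _)%N]mulnC; congr (_ * _)%N.
  by apply: eq_bigr => w wv; rewrite cs eq_sym (negPf wv).
rewrite -big_distrr /= -[in LHS](prednK s0) factS mulnC prednK //; congr (_ * _)%N.
rewrite -sum1_size -big_undup_iterop_count; apply: eq_bigr => v _.
by rewrite Monoid.iteropE iter_addn_0 mul1n.
Qed.

(** * Runs of a nonincreasing sequence *)

Section Runs.
Variables (n k : nat) (alpha : k.-tuple 'I_n.+1).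
Let b := map val alpha.
Hypothesis sorted_b : sorted geq b.

Lemma sorted_geq_head v r : sorted geq (v :: r) ->
  exists u r', r = nseq u v ++ r' /\ v \notin r'.
Proof.
elim: r => [|w r IH] /=; first by exists 0%N, [::].
case/andP=> wv pw; have [ew|nw] := eqVneq w v.
  by rewrite ew in pw *; have [u [r' [-> vr']]] := IH pw; exists u.+1, r'.
exists 0%N, (w :: r); split=> //; apply/negP => vr.
have /allP/(_ v vr) : all (geq w) (w :: r).
  by rewrite /= leqnn; apply: order_path_min pw => x y z /=; lia.
by move=> vw; case/eqP: nw; apply/eqP; rewrite eqn_leq; apply/andP.
Qed.

Let size_b : size b = k. Proof. by rewrite size_map size_tuple. Qed.

(** Indices i <= m satisfy the defining condition vacuously and do not affect the maximum; an index
    beyond the run fails because the next part belongs to r. *)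
Lemma run_endS l m u v r : run_end alpha l = m -> drop m b = nseq u.+1 v ++ r ->
  v \notin r -> run_end alpha l.+1 = (m + u.+1)%N.
Proof.
move=> el eb vr; have mk : (m + u.+1 + size r = k)%N.
  have := congr1 size eb; rewrite size_drop size_cat size_nseq size_b.
  by clear; lia.
have pv j : (m < j <= m + u.+1)%N -> part alpha j = v.
  move=> hj; rewrite partE -/b (_ : j.-1 = m + (j.-1 - m))%N; last by clear -hj; lia.
  rewrite -nth_drop eb nth_cat size_nseq nth_nseq (_ : (_ < _)%N) //.
  by clear -hj; lia.
have pr j : (m + u.+1 < j <= k)%N -> part alpha j \in r.
  move=> hj; rewrite partE -/b (_ : j.-1 = m + (j.-1 - m))%N; last by clear -hj; lia.
  rewrite -nth_drop eb nth_cat size_nseq ifN; last by clear -hj; lia.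
  by apply: mem_nth; rewrite -(ltn_add2l (m + u.+1)) mk; clear -hj; lia.
rewrite /= el; apply/eqP; rewrite eqn_leq; apply/andP; split.
  apply/bigmax_leqP => i /forallP h; rewrite leqNgt; apply: contra vr => lt.
  have ltk : ((m + u.+1).+1 < k.+1)%N by apply: leq_ltn_trans (ltn_ord i).
  have := h (Ordinal ltk); rewrite /= lt andbT (_ : (m < _)%N) /=; last by clear; lia.
  by rewrite (pv m.+1) => [/eqP <-|]; [apply: pr; rewrite ltnSn|clear; lia].
have ltk : (m + u.+1 < k.+1)%N by clear -mk; lia.
apply: (@bigmax_sup _ (Ordinal ltk)) => //=; apply/forallP => j; apply/implyP => hj.
by rewrite !pv // ; clear; lia.
Qed.

(** In a nonincreasing sequence each value forms one run, whose length is its multiplicity. The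
    induction removes the first run; the last hypothesis ensures that its value does not occur
    before. *)
Lemma prod_runs_from (V : comNzRingType) (G : nat -> nat -> V) N l :
  let m := run_end alpha l in
  size (undup (drop m b)) = N ->
  (forall v, v \in drop m b -> v \notin take m b) ->
  \prod_(l.+1 <= i < (l.+1 + N)%N) G (part alpha (run_end alpha i)) (run_len alpha i) =
  \prod_(v <- undup (drop m b)) G v (count_mem v b).
Proof.
elim: N l => [|N IH] l m sN bm.
  by rewrite addn0 big_geq // (size0nil sN) big_nil.
case eb: (drop m b) sN => [|v r0] // sN.
have [u [r [er vr]]] : exists u r', r0 = nseq u v ++ r' /\ v \notin r'.
  by apply: sorted_geq_head; rewrite -eb; apply: drop_sorted.
have {er} eb' : drop m b = nseq u.+1 v ++ r by rewrite eb er.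
have el := run_endS (erefl _) eb' vr; rewrite -/m in el.
have er : drop (m + u.+1)%N b = r.
  by rewrite addnC -drop_drop eb' drop_size_cat ?size_nseq.
have et : take (m + u.+1)%N b = take m b ++ nseq u.+1 v.
  by rewrite takeD eb' take_size_cat ?size_nseq.
have up : perm_eq (undup (drop m b)) (v :: undup r).
  apply: uniq_perm; rewrite /= ?undup_uniq ?mem_undup ?vr // => w.
  rewrite inE !mem_undup eb' mem_cat mem_nseq /=.
  by rewrite eq_sym.
rewrite -eb (perm_big _ up) /= big_cons.
have cv : count_mem v b = u.+1.
  rewrite -[b](cat_take_drop m) eb' !count_cat count_nseq /= eqxx mul1n.
  rewrite !(count_memPn _) ?addn0 //; apply: bm.
  by rewrite eb' mem_cat mem_nseq eqxx.
rewrite big_ltn ?addnS ?ltnS ?leq_addr //; congr (_ * _).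
  have -> : run_len alpha l.+1 = u.+1.
    by rewrite /run_len el -[run_end alpha l.+1.-1]/m addKn.
  rewrite cv el; congr (G _ _).
  rewrite partE -/b addnS /= -nth_drop eb' nth_cat size_nseq ltnSn nth_nseq.
  by rewrite ltnSn.
rewrite -addSn -er -el; apply: IH.
  have := perm_size up; rewrite eb sN el er /=; by case.
move=> w; rewrite el er et mem_cat mem_nseq negb_or => wr.
rewrite bm /=; last by rewrite eb' mem_cat wr orbT.
by apply: contraTneq wr => ->.
Qed.

Lemma prod_runs (V : comNzRingType) (G : nat -> nat -> V) :
  \prod_(1 <= l < (nb_values alpha).+1) G (part alpha (run_end alpha l)) (run_len alpha l) =
  \prod_(v <- undup b) G v (count_mem v b).
Proof.
have e : nb_values alpha = size (undup b).
  rewrite /b undup_map_inj ?size_map; last exact: val_inj.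
  by rewrite /nb_values cardsE -(card_uniqP (undup_uniq _)); apply: eq_card => i; rewrite mem_undup.
have := @prod_runs_from V G (size (undup b)) 0; rewrite /= drop0 add1n e => -> //.
by rewrite take0.
Qed.

End Runs.

Lemma prod_parts (V : comNzRingType) (g : nat -> V) n k (alpha : k.-tuple 'I_n.+1) :
  \prod_(1 <= j < k.+1) g (part alpha j) = \prod_(i <- map val alpha) g i.
Proof.
rewrite big_add1 /= [RHS](big_nth 0%N) size_map size_tuple.
by apply: eq_bigr => j _; rewrite partE.
Qed.

Lemma prod_weight (R : comNzRingType) (V : algType R) (a : nat -> nat -> V)
    n k (alpha : k.-tuple 'I_n.+1) :
  \prod_(1 <= j < k.+1) a (part alpha j) (tail_sum alpha j) = weight a (map val alpha).
Proof.
rewrite weightE size_map size_tuple big_add1 big_mkord; apply: eq_bigr => j _.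
by rewrite partE tail_sumE.
Qed.

(** The binomial coefficients telescope into a multinomial one; in characteristic 0 the factorials
    are invertible. *)
Lemma weight_binomial (K : fieldType) (V : comAlgType K) (g : nat -> V) (s : seq nat) :
  [pchar K] =i pred0 ->
  weight (fun q p => 'C(q + p, p)%:R *: g q) s =
  ((sumn s)`!%:R / \prod_(i <- s) i`!%:R) *: \prod_(i <- s) g i.
Proof.
move=> /GRing.pcharf0P char0; have fact_neq0 i : i`!%:R != 0 :> K by rewrite char0 -lt0n fact_gt0.
elim: s => [|i s IH] /=; first by rewrite !big_nil divr1 scale1r.
rewrite IH !big_cons -scalerAl -scalerAr scalerA; congr (_ *: _).
have := bin_fact (leq_addl i (sumn s)); rewrite addnK => <-.
rewrite natrM natrM invfM; have P0 : \prod_(i <- s) i`!%:R != 0 :> K.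
  by rewrite prodf_seq_neq0; apply/allP => j _; rewrite fact_neq0.
by field; rewrite P0 fact_neq0.
Qed.

Lemma prod_binomial (K : fieldType) (V : comAlgType K) (g : nat -> V)
    n k (alpha : k.-tuple 'I_n.+1) : [pchar K] =i pred0 -> composition alpha ->
  \prod_(1 <= j < k.+1) ('C(part alpha j + tail_sum alpha j, tail_sum alpha j)%:R *:
    g (part alpha j)) =
  (n`!%:R / \prod_(1 <= j < k.+1) (part alpha j)`!%:R) *:
    \prod_(1 <= j < k.+1) g (part alpha j).
Proof.
move=> char0; rewrite compositionE => /andP[_ /eqP e].
rewrite (prod_weight (fun q p => 'C(q + p, p)%:R *: g q)) (weight_binomial g _ char0) e.
by rewrite prod_parts (prod_parts (fun i => i`!%:R : K)).
Qed.

Lemma card_perm_eq_tuples (T : finType) k (t : k.-tuple T) :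
  #|[set u : k.-tuple T | perm_eq u t]| = size (permutations t).
Proof.
rewrite cardE -(size_map val); apply/perm_size/uniq_perm.
- by rewrite (map_inj_uniq val_inj) enum_uniq.
- exact: permutations_uniq.
- move=> u; rewrite mem_permutations; apply/mapP/idP => [[v]|ut].
    by rewrite mem_enum inE => vt ->.
  have su : size u == k by rewrite (perm_size ut) size_tuple.
  by exists (Tuple su); rewrite // mem_enum inE.
Qed.

Section Partitions.
Variables (K : fieldType) (V : comAlgType K) (g : nat -> V) (n k : nat).
Hypothesis char0 : [pchar K] =i pred0.

Let fact_neq0 i : i`!%:R != 0 :> K.
Proof. by move/GRing.pcharf0P: char0 => ->; rewrite -lt0n fact_gt0. Qed.

(** The rearrangements of beta are counted by the multinomial coefficient of its multiplicities,
    which are the run lengths. *)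
Lemma prod_run_fact (beta : k.-tuple 'I_n.+1) : is_partition beta ->
  (size (permutations beta))%:R =
  k`!%:R / \prod_(1 <= l < (nb_values beta).+1) (run_len beta l)`!%:R :> K.
Proof.
case/andP=> _ sb.
have -> : \prod_(1 <= l < (nb_values beta).+1) (run_len beta l)`!%:R =
    (\prod_(v : 'I_n.+1) (count_mem v beta)`!)%:R :> K.
  rewrite (prod_runs sb (fun _ c => c`!%:R : K)) undup_map_inj; last exact: val_inj.
  rewrite big_map natr_prod big_uniq ?undup_uniq //= [RHS](bigID (mem (undup beta))) /=.
  (* Values absent from beta contribute 0! = 1. *)
  rewrite [X in _ = _ * X]big1 ?mulr1 => [|v]; last by rewrite mem_undup => /count_memPn ->.
  apply: eq_bigr => v _; rewrite count_map; congr (_`!%:R); exact: eq_count.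
have e := size_permutationsE beta; rewrite size_tuple in e.
rewrite -e natrM mulfK // natr_prod; apply/prodf_neq0 => v _; exact: fact_neq0.
Qed.

Let F (alpha : k.-tuple 'I_n.+1) : V :=
  (n`!%:R / \prod_(1 <= j < k.+1) (part alpha j)`!%:R) *:
     \prod_(1 <= j < k.+1) g (part alpha j).

Let F_perm (alpha beta : k.-tuple 'I_n.+1) : perm_eq alpha beta -> F alpha = F beta.
Proof.
move=> ab; rewrite /F !prod_parts; have mab := perm_map val ab.
by rewrite (prod_parts (fun i => i`!%:R : K)) (prod_parts (fun i => i`!%:R : K)) !(perm_big _ mab).
Qed.

(** Compositions are grouped by their nonincreasing rearrangement, on which alone [F] depends;
    [prod_run_fact] gives the size of each group. *)
Lemma sum_compositions_partitions :
  \sum_(alpha : k.-tuple 'I_n.+1 | composition alpha) F alpha =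
  \sum_(alpha : k.-tuple 'I_n.+1 | is_partition alpha)
    ((n`!%:R / \prod_(1 <= j < k.+1) (part alpha j)`!%:R) *
     (k`!%:R / \prod_(1 <= l < (nb_values alpha).+1) (run_len alpha l)`!%:R)) *:
    \prod_(1 <= l < (nb_values alpha).+1)
       g (part alpha (run_end alpha l)) ^+ run_len alpha l.
Proof.
pose ge : rel 'I_n.+1 := fun i j => geq i j.
have ge_total : total ge by move=> i j; apply: leq_total.
have ge_trans : transitive ge by move=> j i l /= ij jl; apply: leq_trans jl ij.
have ge_anti : antisymmetric ge.
  by move=> i j /andP[h1 h2]; apply/val_inj/eqP; rewrite eqn_leq; apply/andP.
pose srt (alpha : k.-tuple 'I_n.+1) : k.-tuple 'I_n.+1 := [tuple of sort ge alpha].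
have srtP alpha : perm_eq (srt alpha) alpha by rewrite perm_sort.
have compP (alpha beta : k.-tuple 'I_n.+1) : perm_eq alpha beta -> composition alpha = composition beta :> bool.
  move=> ab; rewrite !compositionE; have mab := perm_map val ab.
  by rewrite (perm_all _ mab) (perm_sumn mab).
have sortedE (beta : k.-tuple 'I_n.+1) : sorted geq (map val beta) = sorted ge beta.
  by rewrite sorted_map.
rewrite (partition_big srt (@is_partition n k)) /=; last first.
  move=> alpha ca; apply/andP; split; first by rewrite (compP _ alpha).
  by rewrite sortedE; apply: sort_sorted.
apply: eq_bigr => beta pb; have [cb sb] := andP pb.
have E (alpha : k.-tuple 'I_n.+1) : composition alpha && (srt alpha == beta) = perm_eq alpha beta.
  apply/andP/idP => [[_ /eqP <-]|ab]; first by rewrite perm_sym.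
  rewrite (compP _ _ ab) cb; split=> //; apply/eqP/val_inj => /=.
  rewrite sortedE in sb; apply: (sorted_eq ge_trans ge_anti) => //; first exact: sort_sorted.
  by rewrite perm_sort.
rewrite (eq_bigl _ _ E) (eq_bigr (fun _ => F beta)); last by move=> alpha; apply: F_perm.
rewrite sumr_const -(cardsE (fun alpha : k.-tuple 'I_n.+1 => perm_eq alpha beta)) card_perm_eq_tuples.
rewrite -scaler_nat prod_run_fact // /F scalerA mulrC; congr (_ *: _).
by rewrite prod_parts (prod_runs sb (fun v c => g v ^+ c)) prodr_undup_exp_count.
Qed.

End Partitions.

Section PathFormula.
Variables (K : fieldType) (x : K) (S : {linear HD K -> HD K}).
Hypotheses (antipodeS : is_antipode x S) (char0 : [pchar K] =i pred0).

Lemma path_antipode n : (0 < n)%N ->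
  S (pathH K n) =
    \sum_(1 <= k < n.+1) (-1) ^+ k *:
      \sum_(alpha : k.-tuple 'I_n.+1 | composition alpha)
        (n`!%:R / \prod_(1 <= j < k.+1) (part alpha j)`!%:R) *:
        \prod_(1 <= j < k.+1) pathH K (part alpha j).
Proof.
move=> n0; have s0 : S (pathH K 0) = 1 by apply: antipode1 antipodeS.
pose a q p := 'C(q + p, p)%:R *: pathH K q.
have sS m : (0 < m <= n)%N -> S (pathH K m) = - \sum_(p < m) a (m - p)%N p * S (pathH K p).
  case/andP=> m0 _; rewrite (path_rec antipodeS m0); apply: (congr1 -%R).
  by apply: eq_bigr => p _; rewrite /a subnK // ltnW.
have E := @composition_rec K (HD K) a (fun n => S (pathH K n)) n s0 sS n0.
rewrite [LHS]E {E}; apply: eq_big_nat => k _.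
apply: (congr1 ( *:%R _)); apply: eq_bigr => alpha calpha.
exact: (@prod_binomial K (HD K)).
Qed.

End PathFormula.

Theorem proposition12 (K : fieldType) (charK0 : [pchar K] =i pred0) (x : K)
    (S : {linear HD K -> HD K}) (antipodeS : is_antipode x S)
    (n : nat) (n_gt0 : (0 < n)%N) :
  [/\ forall D : diagram n,
        S (diag K (val D)) =
        \sum_(1 <= s < n.+1) (-1) ^+ s *:
          \sum_(P : s.-tuple {set chord n} | ordered_partition (val D) P)
             x ^+ kpart (val D) P *:
             \prod_(i < s) rqH K (before P i) (tnth P i),
      S (corH K n) =
        \sum_(1 <= k < n.+1) (-1) ^+ k *:
          \sum_(alpha : k.-tuple 'I_n.+1 | composition alpha)
            \sum_(i : array alpha |
                    [forall j : 'I_k.-1,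
                       (\sum_m i j m)%N == part alpha j.+1])
               corH K (part alpha k) *
               \prod_(j < k.-1) \prod_m corH K (i j m),
      S (pathH K n) =
        \sum_(1 <= k < n.+1) (-1) ^+ k *:
          \sum_(alpha : k.-tuple 'I_n.+1 | composition alpha)
            (n`!%:R / \prod_(1 <= j < k.+1) (part alpha j)`!%:R) *:
            \prod_(1 <= j < k.+1) pathH K (part alpha j)
    & S (pathH K n) =
        \sum_(1 <= k < n.+1) (-1) ^+ k *:
          \sum_(alpha : k.-tuple 'I_n.+1 | is_partition alpha)
            ((n`!%:R / \prod_(1 <= j < k.+1) (part alpha j)`!%:R) *
             (k`!%:R / \prod_(1 <= l < (nb_values alpha).+1)
                          (run_len alpha l)`!%:R)) *:
            \prod_(1 <= l < (nb_values alpha).+1)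
               pathH K (part alpha (run_end alpha l)) ^+ run_len alpha l].
Proof.
split.
- by move=> D; apply: (antipode_formula antipodeS n_gt0 (valP D)).
- exact: corolla_antipode antipodeS n n_gt0.
- exact: path_antipode antipodeS charK0 n n_gt0.
- rewrite (path_antipode antipodeS charK0 n_gt0); apply: eq_bigr => k _.
  apply: (congr1 ( *:%R _)).
  exact: (@sum_compositions_partitions K (HD K) (pathH K) n k charK0).
Qed.
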